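(* Let $X_n=(X_n,d_n,\mu_n)$, $n\in\mathbb N$, be a sequence of compact metric-measure spaces converging to a compact metric-measure space $X=(X,d,\mu)$ in the sense of Fukaya. Assume that $d$ is a length metric and that there is $\Lambda>0$ such that $$\frac{\mu(B_{r_1}(x))}{\mu(B_{r_2}(x))}\le\left(\frac{r_1}{r_2}\right)^{\Lambda}$$ for all $x\in X$ and $r_1\ge r_2>0$. Then $$\lambda_k(X,\rho)=\lim_{n\to\infty}\lambda_k(X_n,\rho)$$ for all $\rho>0$ and all $k\in\mathbb N$ such that $\lambda_k(X,\rho)<\rho^{-2}$.
   Context: All metric-measure spaces $X=(X,d,\mu)$ are compact metric spaces equipped with finite Borel measures, and $B_r(x)=\{y: d(x,y)<r\}$. A metric is a length metric if every pair of points can be connected by a geodesic segment realizing the distance between the points. The ratio hypothesis is understood to include that the balls $B_r(x)$, $x\in X$, $r>0$, have positive measure. For $\rho>0$ the $\rho$-Laplacian $\Delta^\rho_X\colon L^2(X,\mu)\to L^2(X,\mu)$ is $$\Delta^\rho_X u(x)=\frac1{\rho^2\mu(B_\rho(x))}\int_{B_\rho(x)}(u(x)-u(y))\,d\mu(y).$$ It is a bounded, non-negative, self-adjoint operator with respect to the inner product $\langle u,v\rangle_{X^\rho}=\rho^2\int_X\mu(B_\rho(x))u(x)v(x)\,d\mu(x)$. The discrete spectrum is the set of isolated eigenvalues of finite multiplicity, and the essential spectrum is the rest of the spectrum. Let $\lambda_\infty(X,\rho)$ be the infimum of the essential spectrum of $\Delta^\rho_X$, with $\lambda_\infty=\infty$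 if there is no essential spectrum (i.e. if $L^2(X)$ is finite-dimensional). Let $0=\lambda_1\le\lambda_2\le\dots$ be the eigenvalues of $\Delta^\rho_X$, counted with multiplicities, that are smaller than $\lambda_\infty$; if there are only finitely many of them, set $\lambda_k=\lambda_\infty$ for all larger $k$. This defines $\lambda_k(X,\rho)\in[0,\infty]$ for all $k\in\mathbb N$. Fukaya convergence: $X_n=(X_n,d_n,\mu_n)$ converges to $X=(X,d,\mu)$ in the sense of Fukaya if there exist positive numbers $\sigma_n\to0$ and measurable maps $f_n\colon X_n\to X$ such that (1) $f_n(X_n)$ is a $\sigma_n$-net in $X$; (2) $|d(f_n(x),f_n(y))-d_n(x,y)|<\sigma_n$ for all $x,y\in X_n$; (3) the push-forward measures $(f_n)_*\mu_n$ weakly converge to $\mu$. *)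

(* Defs.v *)
From HB Require Import structures.
From mathcomp Require Import all_boot all_order all_algebra.
From mathcomp Require Import all_classical all_reals all_analysis.

Set Implicit Arguments.
Unset Strict Implicit.
Unset Printing Implicit Defensive.

Import Order.TTheory GRing.Theory Num.Theory.
Import numFieldNormedType.Exports.

Local Open Scope classical_set_scope.
Local Open Scope ring_scope.

(* The measurable types of MathComp-Analysis are pointed, so the metric spaces
   considered below come with a base point; all it encodes is nonemptiness. *)
#[short(type="pointedMetricType")]
HB.structure Definition PointedMetric (R : numDomainType) :=
  { T of Metric R T & isPointed T }.

Definition borel (T : ptopologicalType) := g_sigma_algebraType (@open T).

Record mmSpace (R : realType) := MMSpace {
  mm_carrier :> pointedMetricType R ;
  mm_compact : compact [set: mm_carrier] ;
  mm_measure : {finite_measure set (borel mm_carrier) -> \bar R} }.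

Definition length_metric (R : realType) (X : metricType R) : Prop :=
  forall x y : X, exists gamma : R -> X,
    [/\ gamma 0 = x, gamma (mdist x y) = y &
      {in `[0, mdist x y] &, forall s t, mdist (gamma s) (gamma t) = `|s - t|}].

Definition weak_cvg (R : realType) (T : ptopologicalType)
    (mu_ : nat -> set (borel T) -> \bar R) (mu : set (borel T) -> \bar R) :
    Prop :=
  forall phi : T -> R, continuous phi -> bounded_fun phi ->
    (\int[mu_ n]_(x in [set: borel T]) (phi x)%:E)%E @[n --> \oo] -->
    (\int[mu]_(x in [set: borel T]) (phi x)%:E)%E.

Definition is_net (R : realType) (X : metricType R) (e : R) (A : set X) : Prop :=
  forall x : X, exists2 y, A y & mdist x y <= e.

Definition fukaya_cvg (R : realType) (Xn : nat -> mmSpace R) (X : mmSpace R) :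
    Prop :=
  exists (sigma : nat -> R) (f : forall n, Xn n -> X),
    [/\ (forall n, 0 < sigma n) /\ sigma n @[n --> \oo] --> (0 : R),
        forall n, measurable_fun [set: borel (Xn n)]
                    (f n : borel (Xn n) -> borel X),
        forall n, is_net (sigma n) (range (f n)),
        forall n (x y : Xn n),
          `|mdist (f n x) (f n y) - mdist x y| < sigma n &
        weak_cvg
          (fun n => pushforward (mm_measure (Xn n))
                      (f n : borel (Xn n) -> borel X))
          (mm_measure X)].

(* Spectral theory of an operator A on the real space L^2(mu).  Elements of
   L^2(mu) are represented by functions in [Lfun mu 2%:E], and equality in
   L^2(mu) is equality mu-almost everywhere. *)
Section spectrum.
Context (R : realType) (d : measure_display) (T : measurableType d).
Variables (mu : {measure set T -> \bar R}) (A : (T -> R) -> (T -> R)).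

Let L2 : set (T -> R) := [set u | u \in Lfun mu 2%:E].

(* A - t is a bijection of L^2(mu) whose inverse is bounded (by C) *)
Definition resolvent_set : set R := [set t | exists C : R,
  forall v, L2 v -> exists u,
    [/\ L2 u,
        {ae mu, forall x, A u x - t * u x = v x},
        forall w, L2 w -> {ae mu, forall x, A w x - t * w x = v x} ->
          {ae mu, forall x, w x = u x} &
        ('N[mu]_2%:E[EFin \o u] <= C%:E * 'N[mu]_2%:E[EFin \o v])%E]].

Definition spectrum : set R := ~` resolvent_set.

Definition eigenspace (t : R) : set (T -> R) :=
  [set u | L2 u /\ {ae mu, forall x, A u x = t * u x}].

Definition eigenvalues : set R :=
  [set t | exists2 u, eigenspace t u & ~ {ae mu, forall x, u x = 0}].

Definition lin_independent (n : nat) (u : 'I_n -> T -> R) : Prop :=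
  forall c : 'I_n -> R, {ae mu, forall x, \sum_(i < n) c i * u i x = 0} ->
    forall i, c i = 0.

Definition multiplicity (t : R) : \bar R :=
  ereal_sup [set n%:R%:E | n in [set n : nat | exists u : 'I_n -> T -> R,
    (forall i, eigenspace t (u i)) /\ lin_independent u]].

Definition discrete_spectrum : set R := [set t |
  [/\ isolated spectrum t, eigenvalues t & (multiplicity t < +oo)%E]].

Definition essential_spectrum : set R := spectrum `\` discrete_spectrum.

Definition lambda_inf : \bar R := ereal_inf (EFin @` essential_spectrum).

Definition eigenvalue_count (t : R) : \bar R :=
  \esum_(s in eigenvalues `&` [set s | s <= t]) multiplicity s.

(* The k-th eigenvalue below [lambda_inf] (k >= 1), in nondecreasing order and
   counted with multiplicities, is the least one up to which at least k of them
   are counted; if there is none, the infimum below is +oo and the minimum is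
   [lambda_inf]. *)
Definition lambda_ (k : nat) : \bar R :=
  Order.min lambda_inf (ereal_inf [set t%:E | t in
    [set t | [/\ eigenvalues t, (t%:E < lambda_inf)%E &
                 (k%:R%:E <= eigenvalue_count t)%E]]]).

End spectrum.

(* Where the ball has measure zero, which happens only on a null set since X is
   compact, the value is 0 because 0^-1 = 0. *)
Definition rho_laplacian (R : realType) (X : mmSpace R) (rho : R)
    (u : borel X -> R) : borel X -> R :=
  fun x => (rho ^+ 2 * fine (mm_measure X (ball (x : X) rho)))^-1 *
    \int[mm_measure X]_(y in (ball (x : X) rho : set (borel X))) (u x - u y).

Definition lambda (R : realType) (X : mmSpace R) (rho : R) (k : nat) : \bar R :=
  lambda_ (mm_measure X) (@rho_laplacian R X rho) k.

(* Main.v *)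
(* Write Delta = (1 - A) / rho^2, where A u (x) is the mean of u over the ball
   B_rho(x).  With V(x) = mu(B_rho(x)), A is a symmetric Hilbert-Schmidt operator
   for <u, v> = \int V u v, so the eigenvalues of Delta below rho^-2 are given by
   the positive eigenvalues of A, and the min-max principle applies to them.
   The ratio hypothesis makes thin annuli uniformly small; hence integrals of
   continuous functions over the rho-balls of X_n, transported by f_n, converge
   uniformly to those over the rho-balls of X.
   Upper bound: the first k eigenfunctions A u / alpha of X are continuous, and
   their compositions with f_n are test functions for the min-max principle.
   Lower bound: let r_z be the residual of the indicator of B_rho(z) after
   projection onto finitely many eigenfunctions phi_i of X.  Then
   |r_z|^2 = (A r_z)(z), and A r_z is small in norm and equicontinuous, so r_z is
   small uniformly in z.  Thus \sum_i alpha_i phi_i(x) phi_i(y), composed with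
   f_n, approximates in L^2 the kernel of X_n.  If k eigenvalues of X_n were
   below the k-th one of X by a fixed amount, their eigenvectors would span a
   vector orthogonal to the fewer than k functions phi_i \o f_n with alpha_i
   large, on which the form of the averaging operator of X_n would be too large
   for this approximation. *)
Require Import Defs.
From HB Require Import structures.
From mathcomp Require Import all_boot all_order all_algebra.
From mathcomp Require Import all_classical all_reals all_analysis.
From mathcomp Require Import measurable_realfun ring lra.

Set Implicit Arguments.
Unset Strict Implicit.
Unset Printing Implicit Defensive.

Import Order.TTheory GRing.Theory Num.Theory.
Import numFieldNormedType.Exports.

Local Open Scope classical_set_scope.
Local Open Scope ring_scope.

(** * Symmetric Hilbert-Schmidt operators on semi-inner product spaces *)

(** The maps [f n] go from [X_n] to [X] only: functions on [X] can be pulled back, but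
    eigenfunctions of [X_n] cannot be pushed forward. This asymmetry is why the two bounds differ.
    The upper bound transports eigenfunctions of [X]; the lower bound transports the kernel of [X],
    expanded in functions on [X], and leaves the eigenvectors of [X_n] where they are. No full
    spectral theorem is required. Below [rho ^- 2] the corresponding eigenvalues of [A] are
    positive, and the eigenvalues of [A] accumulate only at 0, so each argument uses the finitely
    many eigenvectors whose squared eigenvalue exceeds a threshold [eps] chosen for that argument.
    Vectors are functions rather than classes modulo null sets. The form is therefore only
    semi-definite, and vanishing of [q (u - v)] stands for equality in L^2. *)

Record semi_inner_product (R : realType) (E : lmodType R) (ip : E -> E -> R) :
    Prop := {
  sipC : forall u v, ip u v = ip v u ;
  sipD : forall u v w, ip (u + v) w = ip u w + ip v w ;
  sipZ : forall a u w, ip (a *: u) w = a * ip u w ;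
  sip_ge0 : forall u, 0 <= ip u u }.

(** Families are indexed by [nat] with only the first [m] entries constrained, so that a family can
    be extended without transport between ordinal types. *)
Definition orthonormal (R : realType) (E : Type) (ip : E -> E -> R)
    (m : nat) (e : nat -> E) : Prop :=
  forall i j, (i < m)%N -> (j < m)%N -> ip (e i) (e j) = (i == j)%:R.

Section semi_inner_product_theory.
Context (R : realType) (E : lmodType R) (ip : E -> E -> R).
Hypothesis ipP : semi_inner_product ip.
Local Notation q u := (ip u u).

Lemma ipDr u v w : ip w (u + v) = ip w u + ip w v.
Proof. by rewrite ![ip w _](sipC ipP) (sipD ipP). Qed.

Lemma ipZr a u w : ip w (a *: u) = a * ip w u.
Proof. by rewrite ![ip w _](sipC ipP) (sipZ ipP). Qed.

Lemma ip0 w : ip 0 w = 0.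
Proof. by rewrite -(scale0r w) (sipZ ipP) mul0r. Qed.

Lemma ip0r w : ip w 0 = 0.
Proof. by rewrite (sipC ipP) ip0. Qed.

Lemma ipN u w : ip (- u) w = - ip u w.
Proof. by rewrite -scaleN1r (sipZ ipP) mulN1r. Qed.

Lemma ipNr u w : ip w (- u) = - ip w u.
Proof. by rewrite ![ip w _](sipC ipP) ipN. Qed.

Lemma ipB u v w : ip (u - v) w = ip u w - ip v w.
Proof. by rewrite (sipD ipP) ipN. Qed.

Lemma ip_suml (I : Type) (r : seq I) (P : pred I) (F : I -> E) w :
  ip (\sum_(i <- r | P i) F i) w = \sum_(i <- r | P i) ip (F i) w.
Proof.
elim/big_rec2 : _ => [|i x y _ <-]; first exact: ip0.
exact: (sipD ipP).
Qed.

Lemma ip_sumr (I : Type) (r : seq I) (P : pred I) (F : I -> E) w :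
  ip w (\sum_(i <- r | P i) F i) = \sum_(i <- r | P i) ip w (F i).
Proof.
by rewrite (sipC ipP) ip_suml; apply: eq_bigr => i _; rewrite (sipC ipP).
Qed.

Definition ipE := (sipD ipP, sipZ ipP, ipDr, ipZr, ip0, ip0r, ipN, ipNr).

Lemma qD u v : q (u + v) = q u + 2 * ip u v + q v.
Proof. by rewrite !ipE (sipC ipP v u); ring. Qed.

Lemma qB u v : q (u - v) = q u - 2 * ip u v + q v.
Proof. by rewrite !ipE (sipC ipP v u); ring. Qed.

Lemma qBC u v : q (u - v) = q (v - u).
Proof. by rewrite !qB (sipC ipP v u); ring. Qed.

Lemma qZ a u : q (a *: u) = a ^+ 2 * q u.
Proof. by rewrite !ipE; ring. Qed.

Lemma cauchy_schwarz u v : ip u v ^+ 2 <= q u * q v.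
Proof.
have qu := sip_ge0 ipP u; have qv := sip_ge0 ipP v.
have [qv0|qv0] := eqVneq (q v) 0.
  rewrite qv0 mulr0; have [->|iuv] := eqVneq (ip u v) 0; first by rewrite expr0n.
  (* When [v] is null, this vector would have square [-1] as soon as [ip u v] is nonzero. *)
  have := sip_ge0 ipP (u - ((q u + 1) / (2 * ip u v)) *: v).
  rewrite qB qZ qv0 ipZr mulr0 addr0.
  have -> : 2 * ((q u + 1) / (2 * ip u v) * ip u v) = q u + 1 by field.
  lra.
have {qv0}qv0 : 0 < q v by rewrite lt_def qv0.
have := sip_ge0 ipP (q v *: u - ip u v *: v).
have -> : q (q v *: u - ip u v *: v) = q v * (q u * q v - ip u v ^+ 2).
  by rewrite qB !qZ !ipE; ring.
by rewrite pmulr_rge0 // subr_ge0.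
Qed.

(** Young's inequality, from positivity of [q (h *: u - v)] divided by [h]. The free weight matters
    in [ed_solve], where the factor of [q u] has to be close to 1. *)
Lemma qD_le h u v : 0 < h -> q (u + v) <= (1 + h) * q u + (1 + h^-1) * q v.
Proof.
move=> h0; have := sip_ge0 ipP (h *: u - v); rewrite qB qZ !ipE => H.
have : 0 <= h^-1 * (h ^+ 2 * q u - 2 * (h * ip u v) + q v).
  by rewrite mulr_ge0 // invr_ge0 ltW.
have -> : h^-1 * (h ^+ 2 * q u - 2 * (h * ip u v) + q v) =
  h * q u - 2 * ip u v + h^-1 * q v by field; rewrite gt_eqF.
rewrite !mulrDl !mul1r (sipC ipP v u); lra.
Qed.

Lemma qD_le2 u v : q (u + v) <= 2 * q u + 2 * q v.
Proof. by have := qD_le u v ltr01; rewrite invr1. Qed.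

Lemma null_ip u v : q u = 0 -> ip u v = 0.
Proof.
move=> qu; have := cauchy_schwarz u v; rewrite qu mul0r => H.
by apply/eqP; rewrite -sqrf_eq0 eq_le H sqr_ge0.
Qed.

Lemma nullD u v : q u = 0 -> q v = 0 -> q (u + v) = 0.
Proof. by move=> qu qv; rewrite qD qu qv null_ip // mulr0 !addr0. Qed.

(** Vectors at distance 0 are interchangeable inside [ip]; with [nullB_q], this replaces a passage
    to the quotient by null vectors. *)
Lemma nullB_ip u v w : q (u - v) = 0 -> ip u w = ip v w.
Proof. by move=> uv; have := null_ip w uv; rewrite ipB => /subr0_eq. Qed.

Lemma nullB_q u v : q (u - v) = 0 -> q u = q v.
Proof. by move=> uv; rewrite (nullB_ip _ uv) (sipC ipP) (nullB_ip _ uv). Qed.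

Lemma q_le0 u : (forall h, 0 < h -> q u <= h) -> q u = 0.
Proof.
move=> H; apply/eqP; rewrite eq_le (sip_ge0 ipP) andbT.
by apply/ler_addgt0Pl => h /H; rewrite addr0.
Qed.

Section orthonormal_family.
Variables (m : nat) (e : nat -> E).
Hypothesis eO : orthonormal ip m e.

Definition oproj (u : E) : E := \sum_(i < m) ip u (e i) *: e i.

Lemma ip_lincomb (c : nat -> R) i : (i < m)%N ->
  ip (\sum_(j < m) c j *: e j) (e i) = c i.
Proof.
move=> im; rewrite ip_suml (bigD1 (Ordinal im)) //= (sipZ ipP) eO // eqxx mulr1.
rewrite big1 ?addr0 // => j ji; rewrite (sipZ ipP) eO // (_ : _ == _ = false).
  by rewrite mulr0.
by apply: contra_neqF ji => /eqP ji; apply: val_inj.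
Qed.

Lemma q_lincomb (c : nat -> R) :
  q (\sum_(j < m) c j *: e j) = \sum_(j < m) c j ^+ 2.
Proof.
rewrite ip_sumr; apply: eq_bigr => j _.
by rewrite ipZr ip_lincomb // expr2.
Qed.

Lemma ip_oproj u i : (i < m)%N -> ip (oproj u) (e i) = ip u (e i).
Proof. exact: (ip_lincomb (fun i => ip u (e i))). Qed.

Lemma ip_oprojC u i : (i < m)%N -> ip (u - oproj u) (e i) = 0.
Proof. by move=> im; rewrite ipB ip_oproj // subrr. Qed.

Lemma ip_perp_lincomb u (c : nat -> R) :
  (forall i, (i < m)%N -> ip u (e i) = 0) ->
  ip u (\sum_(j < m) c j *: e j) = 0.
Proof.
by move=> ue; rewrite ip_sumr big1 // => j _; rewrite ipZr ue // mulr0.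
Qed.

Lemma pythagoras u :
  q u = \sum_(j < m) ip u (e j) ^+ 2 + q (u - oproj u).
Proof.
have := qD (u - oproj u) (oproj u); rewrite subrK => ->.
have -> : ip (u - oproj u) (oproj u) = 0.
  apply: (ip_perp_lincomb (fun i => ip u (e i))); exact: ip_oprojC.
by rewrite mulr0 addr0 addrC (q_lincomb (fun i => ip u (e i))).
Qed.

Lemma bessel u : \sum_(j < m) ip u (e j) ^+ 2 <= q u.
Proof. by rewrite [leRHS]pythagoras lerDl (sip_ge0 ipP). Qed.

Lemma q_oprojC_le u : q (u - oproj u) <= q u.
Proof.
by rewrite [leRHS]pythagoras lerDr; apply: sumr_ge0 => i _; exact: sqr_ge0.
Qed.

End orthonormal_family.

Lemma orthonormal_extend m e u : orthonormal ip m e ->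
  (forall i, (i < m)%N -> ip u (e i) = 0) -> q u = 1 ->
  orthonormal ip m.+1 (fun i => if (i < m)%N then e i else u).
Proof.
move=> eO ue qu i j; rewrite !ltnS => im jm.
case: ltnP im => [im _|mi im]; case: ltnP jm => [jm _|mj jm].
- exact: eO.
- have -> : j = m by apply/eqP; rewrite eqn_leq jm.
  by rewrite (sipC ipP) ue // (ltn_eqF im).
- have -> : i = m by apply/eqP; rewrite eqn_leq im.
  by rewrite ue // (gtn_eqF jm).
- have -> : j = m by apply/eqP; rewrite eqn_leq jm.
  have -> : i = m by apply/eqP; rewrite eqn_leq im.
  by rewrite eqxx.
Qed.

End semi_inner_product_theory.

(* [hs_complete] replaces the completeness of the space: only images under the
   operator of Cauchy sequences are required to converge. *)
Record hilbert_schmidt (R : realType) (E : lmodType R) (ip : E -> E -> R)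
    (A : E -> E) : Prop := {
  hs_linear : forall a u v, A (a *: u + v) = a *: A u + A v ;
  hs_sym : forall u v, ip (A u) v = ip u (A v) ;
  hs_bound : exists C, forall m e, orthonormal ip m e ->
    \sum_(i < m) ip (A (e i)) (A (e i)) <= C ;
  hs_complete : forall u_ : nat -> E,
    (forall h, 0 < h -> exists N, forall i j, (N <= i)%N -> (N <= j)%N ->
      ip (u_ i - u_ j) (u_ i - u_ j) <= h) ->
    exists w, forall h, 0 < h -> exists N, forall i, (N <= i)%N ->
      ip (A (u_ i) - w) (A (u_ i) - w) <= h }.

(** Ultrafilters take the place of subsequences: along one of them all bounded sequences converge at
    once, without diagonal extraction. *)
Lemma ultra_bounded_cvg (R : realType) (F : set_system nat)
    (FU : UltraFilter F) (x : nat -> R) (M : R) :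
  (forall n, `|x n| <= M) -> exists a : R, x @ F --> a.
Proof.
move=> xM.
have : compact `[- M, M] by exact: segment_compact.
move=> /(_ (x @ F) _)[].
  suff : F (x @^-1` `[- M, M]) by [].
  by apply: filterE => n; have := xM n; rewrite /= in_itv /= ler_norml.
move=> a [_ ax]; exists a => B aB /=.
have [//|FC] := in_ultra_setVsetC (x @^-1` B) FU.
by have [y [nBy /nBy]] := ax (~` B) B FC aB.
Qed.

Lemma cvg_sumr (R : realType) (T I : Type) (F : set_system T) (FF : Filter F)
    (r : seq I) (P : pred I) (f : I -> T -> R) (l : I -> R) :
  (forall i, P i -> f i x @[x --> F] --> l i) ->
  \sum_(i <- r | P i) f i x @[x --> F] --> \sum_(i <- r | P i) l i.
Proof.
move=> fl; elim: r => [|i r IH].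
  under eq_fun do rewrite big_nil; rewrite big_nil; exact: cvg_cst.
rewrite big_cons; under eq_fun do rewrite big_cons.
by case: ifPn => // Pi; apply: cvgD => //; exact: fl.
Qed.

Section hilbert_schmidt_theory.
Context (R : realType) (E : lmodType R) (ip : E -> E -> R) (A : E -> E).
Hypothesis ipP : semi_inner_product ip.
Hypothesis AP : hilbert_schmidt ip A.
Local Notation q u := (ip u u).
Local Notation ipE := (ipE ipP).

Lemma hsD u v : A (u + v) = A u + A v.
Proof. by have := hs_linear AP 1 u v; rewrite !scale1r. Qed.

Lemma hs0 : A 0 = 0.
Proof. by apply: (addrI (A 0)); rewrite -hsD !addr0. Qed.

Lemma hsZ a u : A (a *: u) = a *: A u.
Proof. by have := hs_linear AP a u 0; rewrite hs0 !addr0. Qed.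

Lemma hsB u v : A (u - v) = A u - A v.
Proof. by rewrite hsD -scaleN1r hsZ scaleN1r. Qed.

Lemma hs_sum (m : nat) (F : nat -> E) :
  A (\sum_(i < m) F i) = \sum_(i < m) A (F i).
Proof. by elim/big_rec2 : _ => [|i x y _ <-]; [exact: hs0|exact: hsD]. Qed.

Lemma null_hs u : q u = 0 -> q (A u) = 0.
Proof. by move=> qu; rewrite (hs_sym AP) (null_ip ipP). Qed.

Lemma normalize u : q u != 0 -> exists2 a, 0 < a & q (a *: u) = 1.
Proof.
move=> qu; have {}qu : 0 < q u by rewrite lt_def qu (sip_ge0 ipP).
exists (Num.sqrt (q u))^-1; first by rewrite invr_gt0 sqrtr_gt0.
by rewrite qZ // exprVn sqr_sqrtr ?ltW // mulVf // gt_eqF.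
Qed.

(** A unit vector is an orthonormal family of size 1, so the Hilbert-Schmidt constant also bounds
    the operator. *)
Lemma hs_bounded : exists2 C, 0 <= C & forall u, q (A u) <= C * q u.
Proof.
have [C HC] := hs_bound AP; exists C.
  by have := HC 0%N (fun=> 0); rewrite big_ord0; apply => i j.
move=> u; have [qu|qu] := eqVneq (q u) 0; first by rewrite null_hs // qu mulr0.
have [a a0 qau] := normalize qu.
have : q (A (a *: u)) <= C.
  have := HC 1%N (fun=> a *: u); rewrite big_ord1; apply => i j.
  by rewrite !ltnS !leqn0 => /eqP -> /eqP ->; rewrite eqxx.
rewrite -{1}(mulr1 C) -qau hsZ !qZ // mulrCA ler_pM2l //.
by rewrite exprn_gt0.
Qed.

(* Orthonormal families on which [q (A (e i)) > eps] have bounded size, so one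
   of them cannot be extended. *)
Lemma hs_exhaust (K : nat -> (nat -> E) -> Prop) eps : 0 < eps ->
  K 0%N (fun=> 0) ->
  (forall m e, K m e ->
    orthonormal ip m e /\ forall i, (i < m)%N -> eps <= q (A (e i))) ->
  (forall m e, K m e -> (exists u, [/\ forall i, (i < m)%N -> ip u (e i) = 0,
      q u = 1 & eps < q (A u)]) -> exists u, K m.+1
      (fun i => if (i < m)%N then e i else u)) ->
  exists m e, K m e /\ forall u, (forall i, (i < m)%N -> ip u (e i) = 0) ->
    q (A u) <= eps * q u.
Proof.
move=> eps0 K0 Korth Kstep; apply/not_existsP => noK.
have Kall m : exists e, K m e.
  elim: m => [|m [e Ke]]; first by exists (fun=> 0).
  have /forallNP/(_ e)/not_andP[//|/existsNP[u]] := noK m.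
  move/not_implyP => [ue /negP]; rewrite -ltNge => qAu.
  have qu : q u != 0.
    by apply: contraTN qAu => /eqP qu; rewrite null_hs // qu mulr0 ltxx.
  have [a a0 qau] := normalize qu.
  have [] := Kstep m e Ke.
    exists (a *: u); split => //.
    - by move=> i im; rewrite (sipZ ipP) ue // mulr0.
    - rewrite hsZ qZ // -(mulr1 eps) -qau qZ // mulrCA ltr_pM2l //.
      by rewrite exprn_gt0.
  by move=> v Kv; eexists; exact: Kv.
have [C HC] := hs_bound AP.
pose m := (Num.trunc (C / eps)).+1.
have [e /Korth[eO qe]] := Kall m.
have Cm : C < eps *+ m.
  by rewrite -mulr_natr mulrC -ltr_pdivrMr // truncnS_gt.
have : eps *+ m <= C.
  apply: le_trans (HC m e eO).
  by rewrite -[X in _ *+ X]card_ord -sumr_const; apply: ler_sum => i _; apply: qe.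
by rewrite leNgt Cm.
Qed.

(** Compactness of [A] in quantitative form: a maximal family with [eps <= q (A (e i))] leaves only
    directions in which [A] is small. *)
Lemma hs_finite_rank eps : 0 < eps -> exists m e, orthonormal ip m e /\
  forall u, (forall i, (i < m)%N -> ip u (e i) = 0) -> q (A u) <= eps * q u.
Proof.
move=> eps0.
pose K m e := orthonormal ip m e /\ forall i, (i < m)%N -> eps <= q (A (e i)).
have [//|//||m [e [[eO _] He]]] := @hs_exhaust K eps eps0.
- move=> m e [eO qe] [u [ue qu qAu]]; exists u; split.
    exact: orthonormal_extend.
  move=> i; rewrite ltnS => im; case: ltnP => [|_]; [exact: qe|exact: ltW].
- by exists m, e.
Qed.

Lemma ex_harmonic_lt (h : R) : 0 < h -> exists N, forall i, (N <= i)%N ->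
  i.+1%:R^-1 <= h.
Proof.
move=> h0; exists (Num.trunc h^-1) => i Ni.
rewrite -[leRHS]invrK lef_pV2 ?posrE ?invr_gt0 //.
by rewrite (le_trans (ltW (truncnS_gt _))) // ler_nat.
Qed.

(** The coordinates of [u_ n] on the finite family of [hs_finite_rank] converge along [F]; [y] has
    the limits as coordinates, and the part of [u_ n] orthogonal to the family hardly contributes to
    [A (u_ n)]. *)
Lemma hs_ultra_approx (F : set_system nat) (FU : UltraFilter F) (u_ : nat -> E) :
  (forall n, q (u_ n) <= 1) ->
  forall h, 0 < h -> exists y, \forall n \near F, q (A (u_ n) - A y) <= h.
Proof.
move=> u1 h h0; have [C C0 AC] := hs_bounded.
have [m [e [eO eA]]] := @hs_finite_rank (h / 4) (divr_gt0 h0 (ltr0n _ 4)).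
have /choice[a ua] : forall i, exists a : R, (i < m)%N ->
    ip (u_ n) (e i) @[n --> F] --> a.
  move=> i; case: (ltnP i m) => im; last by exists 0.
  have [|a] := @ultra_bounded_cvg _ F FU (fun n => ip (u_ n) (e i)) 1.
    move=> n; rewrite -(@ler_pXn2r _ 2) ?nnegrE // real_normK ?num_real // expr1n.
    apply: le_trans (cauchy_schwarz ipP _ _) _.
    by rewrite eO // eqxx mulr1 u1.
  by exists a.
exists (\sum_(i < m) a i *: e i).
have : \sum_(i < m) (ip (u_ n) (e i) - a i) ^+ 2 @[n --> F] -->
    \sum_(i < m) ((0 : R) ^+ 2).
  apply: cvg_sumr => i _; under eq_fun do rewrite expr2; rewrite expr2.
  have ai : ip (u_ n) (e i) - a i @[n --> F] --> (0 : R).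
    by rewrite -(subrr (a i)); apply: cvgB (ua i _) (cvg_cst _).
  exact: cvgM.
rewrite big1 => [|i _]; last by rewrite expr0n.
move=> /cvgrPdist_le Hc.
have hC : 0 < h / (4 * (C + 1)) by rewrite divr_gt0 // mulr_gt0 //; lra.
apply: filterS (Hc _ hC) => n /=; rewrite sub0r normrN => H.
have {}H : \sum_(i < m) (ip (u_ n) (e i) - a i) ^+ 2 <= h / (4 * (C + 1)).
  exact: le_trans (ler_norm _) H.
rewrite -hsB.
have -> : u_ n - \sum_(i < m) a i *: e i = (oproj ip m e (u_ n) -
    \sum_(i < m) a i *: e i) + (u_ n - oproj ip m e (u_ n)).
  by rewrite [RHS]addrC addrA subrK.
rewrite hsD; apply: le_trans (qD_le2 ipP _ _) _.
have H2 := eA _ (ip_oprojC ipP eO (u_ n)).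
have H3 : q (u_ n - oproj ip m e (u_ n)) <= 1.
  exact: le_trans (q_oprojC_le ipP eO _) (u1 n).
have H1 := AC (oproj ip m e (u_ n) - \sum_(i < m) a i *: e i).
have H4 : q (oproj ip m e (u_ n) - \sum_(i < m) a i *: e i) =
    \sum_(i < m) (ip (u_ n) (e i) - a i) ^+ 2.
  rewrite -(q_lincomb ipP eO (fun i => ip (u_ n) (e i) - a i)).
  rewrite -sumrB; congr (ip _ _); apply: eq_bigr => i _; by rewrite scalerBl.
rewrite H4 in H1.
have H5 : C * (\sum_(i < m) (ip (u_ n) (e i) - a i) ^+ 2) <= h / 4.
  apply: (@le_trans _ _ ((C + 1) * (h / (4 * (C + 1))))).
    by apply: ler_pM => //; [apply: sumr_ge0 => i _; exact: sqr_ge0|lra].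
  by rewrite le_eqVlt; apply/orP; left; apply/eqP; field; lra.
have H6 : h / 4 * q (u_ n - oproj ip m e (u_ n)) <= h / 4 * 1.
  by rewrite ler_wpM2l //; lra.
lra.
Qed.

(** [hs_complete] yields limits only after applying [A]. The [A (y j)] approximate [A (u_ n)] along
    [F], hence form a Cauchy sequence, and one more application of [A] makes it converge; this is
    why [A] occurs twice. *)
Lemma hs_ultra_cvg (F : set_system nat) (FU : UltraFilter F) (u_ : nat -> E) :
  (forall n, q (u_ n) <= 1) ->
  exists w, forall h, 0 < h -> \forall n \near F, q (A (A (u_ n)) - w) <= h.
Proof.
move=> u1; have [C C0 AC] := hs_bounded.
have /choice[y Hy] : forall j, exists y, \forall n \near F,
    q (A (u_ n) - A y) <= j.+1%:R^-1.
  by move=> j; apply: hs_ultra_approx => //; rewrite invr_gt0.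
have [h h0|w Hw] := @hs_complete _ _ _ _ AP (A \o y).
  have [N HN] := @ex_harmonic_lt (h / 4) ltac:(lra).
  exists N => i j Ni Nj /=.
  have [n [Hi Hj]] := filter_ex (filterI (Hy i) (Hy j)).
  have := qD_le2 ipP (A (y i) - A (u_ n)) (A (u_ n) - A (y j)).
  rewrite addrA subrK (qBC ipP (A (y i)) (A (u_ n))) => H.
  move: Hi Hj => /= Hi Hj; have := le_trans Hi (HN _ Ni); have := le_trans Hj (HN _ Nj); lra.
exists w => h h0.
have [N HN] := Hw (h / 4) ltac:(lra).
have hC : 0 < h / (4 * (C + 1)) by rewrite divr_gt0 // mulr_gt0 //; lra.
have [N' HN'] := ex_harmonic_lt hC.
have [Nj N'j] : (N <= maxn N N')%N /\ (N' <= maxn N N')%N.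
  by rewrite leq_maxl leq_maxr.
apply: filterS (Hy (maxn N N')) => n; set j := maxn N N' => /= H1.
have := qD_le2 ipP (A (A (u_ n)) - A (A (y j))) (A (A (y j)) - w).
rewrite addrA subrK => H2.
have H3 := AC (A (u_ n) - A (y j)); rewrite hsB in H3.
have H4 := HN _ Nj.
have H5 : C * q (A (u_ n) - A (y j)) <= h / 4.
  apply: (@le_trans _ _ ((C + 1) * (h / (4 * (C + 1))))).
    apply: ler_pM => //; [exact: sip_ge0 ipP _|lra|].
    exact: le_trans H1 (HN' _ N'j).
  by rewrite le_eqVlt; apply/orP; left; apply/eqP; field; lra.
move: H4 => /=; lra.
Qed.

(** Variational construction for the square of [A], which treats both signs of eigenvalues at once:
    [b] is the supremum of [q (A u)] over unit vectors orthogonal to the [e i], and a maximizing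
    sequence has a limit along an ultrafilter, an eigenvector of the square for [b]. *)
Lemma hs_eigenvector (m : nat) (e : nat -> E) (al : nat -> R) eps : 0 <= eps ->
  (forall i u, (i < m)%N -> ip (A u) (e i) = al i * ip u (e i)) ->
  (exists u, [/\ forall i, (i < m)%N -> ip u (e i) = 0,
      q u = 1 & eps < q (A u)]) ->
  exists v a, [/\ forall i, (i < m)%N -> ip v (e i) = 0,
    q v = 1, eps < a ^+ 2 & q (A v - a *: v) = 0].
Proof.
move=> eps0 Ae [u0 [u0e qu0 epsu0]]; have [C C0 AC] := hs_bounded.
pose perp u := forall i, (i < m)%N -> ip u (e i) = 0.
have perpA u : perp u -> perp (A u).
  by move=> ue i im; rewrite Ae // ue // mulr0.
pose S := [set q (A u) | u in [set u | perp u /\ q u = 1]].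
have Su0 : S (q (A u0)) by exists u0.
have hS : has_sup S.
  split; first by exists (q (A u0)).
  by exists C => _ [u [ue qu] <-]; rewrite -[C]mulr1 -qu.
pose b := sup S.
have bA u : perp u -> q (A u) <= b * q u.
  move=> ue; have [qu|qu] := eqVneq (q u) 0; first by rewrite null_hs // qu mulr0.
  have [a a0 qau] := normalize qu.
  have : q (A (a *: u)) <= b.
    apply: sup_upper_bound => //; exists (a *: u) => //; split => //.
    by move=> i im; rewrite (sipZ ipP) ue // mulr0.
  by rewrite -{1}(mulr1 b) -qau hsZ !(qZ ipP) mulrCA ler_pM2l // exprn_gt0.
have epsb : eps < b by apply: lt_le_trans epsu0 _; exact: sup_upper_bound.
have b0 : 0 < b by exact: le_lt_trans epsb.
have /choice[u_ Hu] : forall n, exists u, [/\ perp u, q u = 1 &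
    b - n.+1%:R^-1 < q (A u)].
  move=> n; have n0 : 0 < n.+1%:R^-1 :> R by rewrite invr_gt0.
  have [_ [u [ue qu] <-] bu] := sup_adherent n0 hS.
  by exists u; split.
have [F [FU Foo]] := @ultraFilterLemma nat \oo _.
have [n|w Hw] := @hs_ultra_cvg F FU u_; first by have [_ -> _] := Hu n.
have Hbu h : 0 < h -> \forall n \near F, q (b *: u_ n - w) <= h.
  move=> h0; have [N HN] := @ex_harmonic_lt (h / (4 * b)) ltac:(by apply: divr_gt0 => //; lra).
  have FN : \forall n \near F, (N <= n)%N by apply: Foo; exact: nbhs_infty_ge.
  apply: filterS2 FN (Hw (h / 4) ltac:(lra)) => n Nn H1.
  have [ue qu qAu] := Hu n.
  have := qD_le2 ipP (b *: u_ n - A (A (u_ n))) (A (A (u_ n)) - w).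
  rewrite addrA subrK => H2.
  (* Expanding, symmetry and [q (A (A (u_ n))) <= b * q (A (u_ n))] leave at most
     [b * (b - q (A (u_ n)))]. *)
  have H3 : q (b *: u_ n - A (A (u_ n))) <= b * n.+1%:R^-1.
    rewrite (qB ipP) (qZ ipP) (sipZ ipP) -(hs_sym AP (u_ n) (A (u_ n))) qu.
    move: qAu; set k := _^-1 => qAu.
    have H3 := bA _ (perpA _ ue).
    have H4 : b * (b - k) <= b * q (A (u_ n)).
      by rewrite ler_wpM2l // ltW.
    lra.
  have H4 : b * n.+1%:R^-1 <= h / 4.
    apply: (@le_trans _ _ (b * (h / (4 * b)))).
      by rewrite ler_wpM2l ?(ltW b0) // HN.
    by rewrite le_eqVlt; apply/orP; left; apply/eqP; field; lra.
  have {H3 H4} := le_trans H3 H4; move: H1 => /=; lra.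
pose u := b^-1 *: w.
(* All that is used of the limit [u]: unit vectors [u'] orthogonal to the family come arbitrarily
   close to it, with [A (A u')] close to [b *: u]. *)
have Hu0 h : 0 < h -> exists u', [/\ perp u', q u' = 1, q (u' - u) <= h &
    q (A (A u') - b *: u) <= h].
  move=> h0.
  have h1 : 0 < h * b ^+ 2 by rewrite mulr_gt0 // exprn_gt0.
  have [n [H1 H2]] := filter_ex (filterI (Hbu _ h1) (Hw _ h0)).
  have [ue qu _] := Hu n; exists (u_ n); split => //.
    have -> : u_ n - u = b^-1 *: (b *: u_ n - w).
      by rewrite scalerBr scalerA mulVf ?scale1r // gt_eqF.
    rewrite (qZ ipP) exprVn mulrC ler_pdivrMr // exprn_gt0 //.
  by rewrite scalerA divff ?scale1r // gt_eqF.
clearbody u.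
have ue : perp u.
  move=> i im; apply/eqP; rewrite -sqrf_eq0 eq_le sqr_ge0 andbT.
  apply/ler_addgt0Pl => h h0; rewrite addr0.
  have ei := sip_ge0 ipP (e i).
  have [|u' [u'e _ H _]] := Hu0 (h / (q (e i) + 1)).
    by rewrite divr_gt0 //; lra.
  have := cauchy_schwarz ipP (u' - u) (e i).
  rewrite (ipB ipP) u'e // sub0r sqrrN => /le_trans; apply.
  apply: (@le_trans _ _ (h / (q (e i) + 1) * (q (e i) + 1))).
    by apply: ler_pM => //; [exact: sip_ge0 ipP _|lra].
  by rewrite divfK //; lra.
have qu : q u != 0.
  apply/eqP => qu; have [u' [_ qu' H _]] := Hu0 (1 / 4) ltac:(lra).
  have := qD_le2 ipP (u' - u) u; rewrite subrK qu' qu; lra.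
have AAu : q (A (A u) - b *: u) = 0.
  apply: (q_le0 ipP) => h h0.
  have [|u' [_ _ H1 H2]] := Hu0 (h / (4 * (C ^+ 2 + 1))).
    by rewrite divr_gt0 // mulr_gt0 // ltr_wpDl // sqr_ge0.
  have := qD_le2 ipP (A (A u) - A (A u')) (A (A u') - b *: u).
  rewrite addrA subrK -!hsB => H3.
  have H4 := AC (A (u - u')); have H5 := AC (u - u').
  rewrite (qBC ipP u') in H1.
  have H6 : C * q (A (u - u')) <= C * (C * q (u - u')) by rewrite ler_wpM2l.
  set k := h / _ in H1 H2.
  have kE : (C ^+ 2 + 1) * k = h / 4.
    by rewrite /k; field; apply: lt0r_neq0; rewrite ltr_wpDl // sqr_ge0.
  have H7 : C * (C * q (u - u')) <= C * (C * k) by rewrite !ler_wpM2l.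
  have C2 := sqr_ge0 C.
  nra.
(* The equation for the square factors as [(A - s) (A + s) u = 0]: either [v = A u + s *: u] is null
   and [u] has eigenvalue [- s], or [v] is an eigenvector for [s]. *)
pose s := Num.sqrt b.
have s2 : s ^+ 2 = b by rewrite sqr_sqrtr // ltW.
pose v := A u + s *: u.
have [v0|v0] := eqVneq (q v) 0.
  have [a a0 qau] := normalize qu.
  exists (a *: u), (- s); split => //.
  - by move=> i im; rewrite (sipZ ipP) ue // mulr0.
  - by rewrite sqrrN s2.
  - by rewrite hsZ scalerA mulrC -scalerA -scalerBr (qZ ipP) scaleNr opprK v0 mulr0.
have [a a0 qav] := normalize v0.
exists (a *: v), s; split => //.
- move=> i im; rewrite (sipZ ipP) (sipD ipP) (sipZ ipP) ue // (perpA _ ue) //.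
  by rewrite mulr0 addr0 mulr0.
- by rewrite s2.
rewrite hsZ scalerA mulrC -scalerA -scalerBr (qZ ipP).
have -> : A v - s *: v = A (A u) - b *: u.
  rewrite /v hsD hsZ scalerDr scalerA -expr2 s2 opprD addrA addrK //.
by rewrite AAu mulr0.
Qed.

End hilbert_schmidt_theory.

(** * Truncated spectral decompositions and the min-max principle *)

Lemma ex_kernel (R : fieldType) (k m : nat) (J : pred 'I_m)
    (f : 'I_k -> 'I_m -> R) : (#|J| < k)%N ->
  exists2 c : 'I_k -> R, exists l, c l != 0 &
    forall i, J i -> \sum_(l < k) c l * f l i = 0.
Proof.
move=> Jk; pose M := \matrix_(l < k, i < #|J|) f l (enum_val i).
(* [M] has [k] rows and rank at most [#|J| < k]. *)
have : kermx M != 0.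
  rewrite -mxrank_eq0 mxrank_ker -lt0n subn_gt0.
  exact: leq_ltn_trans (rank_leq_col _) Jk.
move=> /matrix0Pn[i [l Kl]].
exists (kermx M i); first by exists l.
move=> j Jj; have /matrixP/(_ i (enum_rank_in Jj j)) := mulmx_ker M.
rewrite [LHS]mxE [RHS]mxE => H; rewrite -[RHS]H; apply: eq_bigr => l' _.
by rewrite [M _ _]mxE enum_rankK_in.
Qed.

(** A truncated spectral theorem. Eigenvalues of [A] may be negative, hence the threshold on their
    squares. They need not be sorted or distinct; multiplicities appear as cardinals of sets of
    indices. *)
Record eigen_decomposition (R : realType) (E : lmodType R) (ip : E -> E -> R)
    (A : E -> E) (eps : R) (m : nat) (e : nat -> E) (al : nat -> R) : Prop := {
  ed_orth : orthonormal ip m e ;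
  ed_eig : forall i, (i < m)%N ->
    ip (A (e i) - al i *: e i) (A (e i) - al i *: e i) = 0 ;
  ed_gt : forall i, (i < m)%N -> eps < al i ^+ 2 ;
  ed_perp : forall u, (forall i, (i < m)%N -> ip u (e i) = 0) ->
    ip (A u) (A u) <= eps * ip u u }.

Section eigen_decomposition_theory.
Context (R : realType) (E : lmodType R) (ip : E -> E -> R) (A : E -> E).
Hypothesis ipP : semi_inner_product ip.
Hypothesis AP : hilbert_schmidt ip A.
Local Notation q u := (ip u u).
Local Notation ipE := (ipE ipP).

Lemma ip_eigenvector e al u : q (A e - al *: e) = 0 ->
  ip (A u) e = al * ip u e.
Proof.
move=> /(nullB_ip ipP u); rewrite (sipZ ipP) (hs_sym AP) (sipC ipP) => ->.
by rewrite (sipC ipP).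
Qed.

(** [A] preserves the orthogonal complement of the eigenvectors found so far, so [hs_eigenvector]
    applies there as long as some unit vector has [q (A u)] above [eps]; [hs_exhaust] ends the
    process. *)
Lemma hs_decomposition eps : 0 < eps ->
  exists m e al, eigen_decomposition ip A eps m e al.
Proof.
move=> eps0.
pose K m e := exists al, [/\ orthonormal ip m e,
  forall i, (i < m)%N -> q (A (e i) - al i *: e i) = 0 &
  forall i, (i < m)%N -> eps < al i ^+ 2].
have [|m e [al [eO ee ale]]|m e [al [eO ee ale]] Hu|] :=
    @hs_exhaust _ _ _ _ ipP AP K eps eps0.
- by exists (fun=> 0); split => // i j.
- split => // i im.
  rewrite (nullB_q ipP (ee _ im)) (qZ ipP) eO // eqxx mulr1 ltW //.
  exact: ale.
- have [v [a [ve qv epsa Av]]] := hs_eigenvector ipP AP (ltW eps0)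
    (fun i u im => ip_eigenvector u (ee i im)) Hu.
  exists v, (fun i => if (i < m)%N then al i else a); split.
  + exact: orthonormal_extend.
  + by move=> i _; case: ltnP => // im; exact: ee.
  + by move=> i _; case: ltnP => // im; exact: ale.
- move=> m [e [[al [eO ee ale]] He]].
  by exists m, e, al; split.
Qed.

Section fixed_decomposition.
Variables (eps : R) (m : nat) (e : nat -> E) (al : nat -> R).
Hypothesis eD : eigen_decomposition ip A eps m e al.

Let eO := ed_orth eD.
Let P := oproj ip m e.

Lemma ip_eig i u : (i < m)%N -> ip (A u) (e i) = al i * ip u (e i).
Proof. by move=> im; apply: ip_eigenvector; exact: (ed_eig eD). Qed.

Lemma hs_perp u : (forall i, (i < m)%N -> ip u (e i) = 0) ->
  forall i, (i < m)%N -> ip (A u) (e i) = 0.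
Proof. by move=> ue i im; rewrite ip_eig // ue // mulr0. Qed.

Lemma eig_lincomb (c : nat -> R) :
  q (A (\sum_(i < m) c i *: e i) - \sum_(i < m) (c i * al i) *: e i) = 0.
Proof.
rewrite (hs_sum AP m (fun i => c i *: e i)) -sumrB.
apply: (big_ind (fun z => q z = 0)) => [|u v|i _]; first by rewrite (ip0 ipP).
  exact: nullD.
rewrite (hsZ AP) -scalerA -scalerBr (qZ ipP) (ed_eig eD) ?mulr0 //.
Qed.

(** Components with [al i != t] vanish by symmetry. The remainder [r] after projection is again an
    eigenvector for [t], so [t ^+ 2 * q r <= eps * q r] makes it null. *)
Lemma ed_eigenspace t u : eps < t ^+ 2 -> q (A u - t *: u) = 0 ->
  q (u - \sum_(i < m | al i == t) ip u (e i) *: e i) = 0.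
Proof.
move=> epst Au.
have ue i : (i < m)%N -> al i != t -> ip u (e i) = 0.
  move=> im alt; have := ip_eig u im.
  rewrite (nullB_ip ipP _ Au) (sipZ ipP) => /eqP; rewrite -subr_eq0 -mulrBl.
  by rewrite mulf_eq0 subr_eq0 eq_sym (negbTE alt) => /eqP.
have -> : \sum_(i < m | al i == t) ip u (e i) *: e i = P u.
  rewrite [RHS](bigID (fun i : 'I_m => al i == t)) /= [X in _ + X]big1 ?addr0 //.
  by move=> i alt; rewrite ue // scale0r.
have := ed_perp eD (ip_oprojC ipP eO u).
have -> : q (A (u - oproj ip m e u)) = t ^+ 2 * q (u - oproj ip m e u).
  rewrite -(qZ ipP); apply: (nullB_q ipP).
  have -> : A (u - oproj ip m e u) - t *: (u - oproj ip m e u) =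
      (A u - t *: u) - (A (oproj ip m e u) -
        \sum_(i < m) (ip u (e i) * al i) *: e i).
    have -> : \sum_(i < m) (ip u (e i) * al i) *: e i = t *: oproj ip m e u.
      rewrite scaler_sumr; apply: eq_bigr => i _; rewrite scalerA mulrC.
      by have [->//|alt] := eqVneq (al i) t; rewrite ue // !mulr0.
    rewrite (hsB AP) scalerBr !opprB addrACA [RHS]addrACA; congr (_ + _).
    by rewrite addrC.
  rewrite (qB ipP) Au (eig_lincomb (fun i => ip u (e i))) (null_ip ipP) //.
  by rewrite mulr0 subr0 addr0.
have := sip_ge0 ipP (u - oproj ip m e u); rewrite -/P.
rewrite le_eqVlt => /predU1P[<- //|qu].
by rewrite ler_pM2r // leNgt epst.
Qed.

(** On the complement of the [e i] the map sending [s] to [t^-1 *: (A s - r)] is a contraction, with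
    factor [eps / t ^+ 2] for [q]; its fixed point solves the equation. *)
Lemma ed_solve t : eps < t ^+ 2 -> 0 <= eps ->
  exists2 K, 0 <= K & forall r, (forall i, (i < m)%N -> ip r (e i) = 0) ->
  exists2 u, q (A u - t *: u - r) = 0 & q u <= K * q r.
Proof.
move=> epst eps0; have t20 : 0 < t ^+ 2 by exact: le_lt_trans epst.
have t0 : t != 0 by rewrite -sqrf_eq0 gt_eqF.
pose th := eps / t ^+ 2.
have th0 : 0 <= th by rewrite divr_ge0 // ltW.
have th1 : th < 1 by rewrite ltr_pdivrMr // mul1r.
(* This [h] gives [(1 + h) * th + h <= 1], so that the bound [q (s_ n) <= K * q r] passes from one
   iterate to the next. *)
pose h := (1 - th) / 2; have h0 : 0 < h by rewrite /h; lra.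
pose D := (1 + h^-1) / t ^+ 2.
have D0 : 0 <= D by rewrite divr_ge0 ?(ltW t20) // addr_ge0 // invr_ge0 ltW.
pose K := D / h; have K0 : 0 <= K by rewrite divr_ge0 // ltW.
have [C C0 AC] := hs_bounded ipP AP.
(* The factor 2 is lost in [qD_le2], when the bound on the iterates is carried to the limit. *)
exists (2 * K); first by rewrite mulr_ge0.
move=> r re; have qr := sip_ge0 ipP r.
pose s_ n := iter n (fun s => t^-1 *: (A s - r)) 0.
have se n i : (i < m)%N -> ip (s_ n) (e i) = 0.
  elim: n i => [|n IH] i im /=; first by rewrite (ip0 ipP).
  by rewrite (sipZ ipP) (ipB ipP) hs_perp // re // subr0 mulr0.
have qs n : q (s_ n) <= K * q r.
  elim: n => [|n IH] /=; first by rewrite (ip0 ipP) mulr_ge0.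
  rewrite (qZ ipP) exprVn.
  have H := qD_le ipP (A (s_ n)) (- r) h0; rewrite (ipN ipP) (ipNr ipP) opprK in H.
  have H1 := ed_perp eD (se n).
  have H2 : (1 + h) * q (A (s_ n)) <= (1 + h) * (eps * (K * q r)).
    rewrite ler_pM2l; last lra.
    by apply: le_trans H1 _; rewrite ler_wpM2l.
  rewrite mulrC ler_pdivrMr // (le_trans H) //.
  have thE : eps = th * t ^+ 2 by rewrite divfK // gt_eqF.
  have DE : 1 + h^-1 = K * h * t ^+ 2 by rewrite !divfK // gt_eqF.
  rewrite DE; rewrite thE in H2.
  have Hc : (1 + h) * th + h <= 1 by rewrite /h; nra.
  have H3 : t ^+ 2 * (K * q r) * ((1 + h) * th + h) <= t ^+ 2 * (K * q r) * 1.
    by rewrite ler_wpM2l //; apply: mulr_ge0; [exact: ltW|exact: mulr_ge0].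
  lra.
have qd i l : q (s_ (i + l)%N - s_ i) <= th ^+ i * (K * q r).
  elim: i l => [|i IH] l; first by rewrite subr0 mul1r.
  rewrite addSn /= -scalerBr opprB addrA subrK -(hsB AP) (qZ ipP) exprVn.
  have H : forall j, (j < m)%N -> ip (s_ (i + l)%N - s_ i) (e j) = 0.
    by move=> j jm; rewrite (ipB ipP) !se // subrr.
  rewrite mulrC ler_pdivrMr // (le_trans (ed_perp eD H)) //.
  have thE : eps = th * t ^+ 2 by rewrite divfK // gt_eqF.
  have := ler_wpM2l (ltW t20) (ler_wpM2l th0 (IH l)).
  move: (IH l); rewrite (exprS th); set k := th ^+ i => _ H1.
  have -> : eps * q (s_ (i + l)%N - s_ i) = t ^+ 2 * (th * q (s_ (i + l)%N - s_ i)).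
    by rewrite {1}thE; ring.
  by apply: le_trans H1 _; rewrite le_eqVlt; apply/orP; left; apply/eqP; ring.
have [h' h'0|w Hw] := @hs_complete _ _ _ _ AP s_.
  have : (fun n => th ^+ n * (K * q r)) @ \oo --> 0 * (K * q r).
    by apply: cvgMl; apply: cvg_expr; rewrite ger0_norm.
  rewrite mul0r => /cvgrPdist_le/(_ _ h'0)[N _ HN].
  have Hij i j : (N <= i)%N -> (i <= j)%N -> q (s_ j - s_ i) <= h'.
    move=> Ni ij; rewrite -(subnKC ij); apply: le_trans (qd _ _) _.
    have := HN i Ni; rewrite /= sub0r normrN => /(le_trans (ler_norm _)).
    exact.
  exists N => i j Ni Nj; have [ij|/ltnW ji] := leqP i j.
    by rewrite (qBC ipP) Hij.
  exact: Hij.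
(* Only the images [A (s_ n)] are known to have a limit [w]; the limit of the iterates follows from
   the recursion, where each is determined by the image of the previous one. *)
pose u := t^-1 *: (w - r).
have su h' : 0 < h' -> exists n, q (s_ n - u) <= h' /\ q (A (s_ n) - w) <= h'.
  move=> h'0; have h20 : 0 < h' * t ^+ 2 by rewrite mulr_gt0.
  have [N1 HN1] := Hw _ h20; have [N2 HN2] := Hw _ h'0.
  exists (maxn N1 N2).+1; split; last first.
    by apply: HN2; rewrite leqW // leq_maxr.
  rewrite /= -scalerBr opprB addrA subrK (qZ ipP) exprVn mulrC ler_pdivrMr //.
  by apply: HN1; rewrite leq_maxl.
exists u.
  have -> : A u - t *: u - r = A u - w.
    by rewrite scalerA divff // scale1r opprB addrA addrAC addrK.
  apply: (q_le0 ipP) => h' h'0.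
  have [|n [H1 H2]] := su (h' / (2 * (C + 1))).
    by rewrite divr_gt0 // mulr_gt0 //; lra.
  have := qD_le2 ipP (A u - A (s_ n)) (A (s_ n) - w).
  rewrite addrA subrK -(hsB AP) => H3; have H4 := AC (u - s_ n).
  rewrite (qBC ipP) in H1.
  move: H1 H2; set k := _ / _ => H1 H2.
  have kE : (C + 1) * k = h' / 2 by rewrite /k; field; lra.
  have H5 : C * q (u - s_ n) <= C * k by rewrite ler_wpM2l.
  lra.
apply/ler_addgt0Pl => h' h'0.
have [n [H1 _]] := su (h' / 2) ltac:(lra).
have := qD_le2 ipP (u - s_ n) (s_ n); rewrite subrK (qBC ipP u).
have := qs n; lra.
Qed.

(** The complement of the [e i] is handled by [ed_solve], their span by dividing each coordinate by
    [al i - t]. *)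
Lemma ed_resolvent t : 0 <= eps -> eps < t ^+ 2 ->
  (forall i, (i < m)%N -> al i != t) ->
  exists2 C, 0 <= C & forall v, exists2 u,
    q (A u - t *: u - v) = 0 & q u <= C * q v.
Proof.
move=> eps0 epst alt; have [K K0 HK] := ed_solve epst eps0.
pose G := \sum_(i < m) (al i - t) ^- 2.
have G0 : 0 <= G by apply: sumr_ge0 => i _; rewrite invr_ge0 sqr_ge0.
exists (2 * K + 2 * G); first by rewrite addr_ge0 // mulr_ge0.
move=> v; have [u' u'P qu'] := HK _ (ip_oprojC ipP eO v).
pose c i := ip v (e i) / (al i - t).
pose z := \sum_(i < m) c i *: e i.
exists (u' + z).
  have -> : A (u' + z) - t *: (u' + z) - v =
      (A u' - t *: u' - (v - oproj ip m e v)) +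
      (A z - \sum_(i < m) (c i * al i) *: e i).
    have -> : \sum_(i < m) (c i * al i) *: e i = t *: z + oproj ip m e v.
      rewrite scaler_sumr -big_split /=; apply: eq_bigr => i _.
      rewrite scalerA -scalerDl; congr (_ *: _); rewrite /c; field.
      by rewrite subr_eq0 alt.
    rewrite (hsD AP) scalerDr !opprD opprK addrACA (addrA (A z)).
    by rewrite [RHS]addrACA addrK.
  by apply: (nullD ipP) => //; exact: eig_lincomb.
have qz : q z <= G * q v.
  rewrite (q_lincomb ipP eO) mulr_suml; apply: ler_sum => i _.
  rewrite expr_div_n mulrC ler_wpM2l //; first by rewrite invr_ge0 sqr_ge0.
  apply: le_trans (bessel ipP eO v); rewrite (bigD1 i) //= lerDl.
  by apply: sumr_ge0 => j _; exact: sqr_ge0.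
have H := qD_le2 ipP u' z.
have H1 : K * q (v - oproj ip m e v) <= K * q v.
  by rewrite ler_wpM2l // (q_oprojC_le ipP).
rewrite mulrDl; lra.
Qed.

(** The form splits into coordinates on the [e i] and a remainder [r]. The coordinates that survive
    have [al i < a], and Cauchy-Schwarz with [ed_perp] gives [ip r (A r) < a * q r] unless [r] is
    null; the last hypothesis then forces every part to vanish. *)
Lemma ed_minmax a w : 0 < a -> eps < a ^+ 2 ->
  (forall i, (i < m)%N -> a <= al i -> ip w (e i) = 0) ->
  a * q w <= ip (A w) w -> q w = 0.
Proof.
move=> a0 epsa we aw.
have qr := sip_ge0 ipP (w - oproj ip m e w).
set r := w - _ in qr.
have re : forall i, (i < m)%N -> ip r (e i) = 0 by exact: (ip_oprojC ipP eO w).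
have Aww : ip (A w) w = \sum_(i < m) al i * ip w (e i) ^+ 2 + ip r (A r).
  have -> : ip (A w) w = ip (A w) (oproj ip m e w) + ip (A w) r.
    by rewrite -(ipDr ipP) addrC subrK.
  congr (_ + _).
    rewrite (ip_sumr ipP); apply: eq_bigr => i _.
    by rewrite (ipZr ipP) ip_eig // expr2 mulrCA.
  rewrite (hs_sym AP) -{1}(subrK (oproj ip m e w) w) (sipD ipP) -/r.
  rewrite [X in _ + X](sipC ipP).
  rewrite (ip_perp_lincomb ipP (fun i => ip w (e i))) ?addr0 //.
  exact: hs_perp.
have Hr : ip r (A r) <= a * q r.
  rewrite leNgt; apply/negP => H.
  have := cauchy_schwarz ipP r (A r); have := ed_perp eD re.
  have ar0 : 0 <= a * q r by rewrite mulr_ge0 // ltW.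
  have H2 : (a * q r) ^+ 2 < ip r (A r) ^+ 2.
    by rewrite ltr_pXn2r // nnegrE // (le_trans ar0 (ltW H)).
  move=> H3 H4; have H5 : q r * q (A r) <= q r * (eps * q r) by rewrite ler_wpM2l.
  have : q r * (eps * q r) <= (a * q r) ^+ 2.
    rewrite exprMn (_ : q r * _ = eps * q r ^+ 2); last by ring.
    by rewrite ler_wpM2r ?sqr_ge0 // ltW.
  lra.
have qw := pythagoras ipP eO w; rewrite -/r in qw.
have Hi (i : 'I_m) : al i * ip w (e i) ^+ 2 <= a * ip w (e i) ^+ 2.
  have [ai|/ltW ai] := leP a (al i); last by rewrite ler_wpM2r // sqr_ge0.
  by rewrite we // expr0n !mulr0.
have Hs : \sum_(i < m) al i * ip w (e i) ^+ 2 <=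
    \sum_(i < m) a * ip w (e i) ^+ 2 by exact: ler_sum.
rewrite -mulr_sumr in Hs.
have Er : ip r (A r) = a * q r by rewrite Aww qw mulrDr in aw; lra.
have qr0 : q r = 0.
  apply/eqP; rewrite eq_le qr andbT leNgt; apply/negP => qr0.
  have := cauchy_schwarz ipP r (A r); have := ed_perp eD re; rewrite Er => H1 H2.
  have : (a * q r) ^+ 2 <= q r * (eps * q r).
    by apply: (le_trans H2); rewrite ler_wpM2l.
  rewrite exprMn (_ : q r * _ = eps * q r ^+ 2); last by ring.
  rewrite ler_pM2r ?exprn_gt0 //.
  by rewrite leNgt epsa.
rewrite qw qr0 addr0 big1 // => i _.
(* Equality holds in the sum of the inequalities [Hi], hence in each of them. *)
have Es : \sum_(i < m) (a * ip w (e i) ^+ 2 - al i * ip w (e i) ^+ 2) = 0.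
  rewrite sumrB -mulr_sumr; apply/eqP; rewrite subr_eq0; apply/eqP.
  by rewrite Aww qw mulrDr in aw; lra.
have [ai|ai] := leP a (al i); first by rewrite we // expr0n.
have /eqP := Es; rewrite psumr_eq0 => [/allP/(_ i)|j _]; last first.
  by rewrite subr_ge0.
rewrite mem_index_enum => /(_ isT)/=; rewrite -mulrBl mulf_eq0.
by rewrite subr_eq0 gt_eqF //= => /eqP.
Qed.

(** If fewer than [k] of the [e i] had [a <= al i], some nontrivial combination of the [u l] would
    be orthogonal to all of these, against [ed_minmax]. *)
Lemma ed_count_ge (k : nat) (u : 'I_k -> E) a : 0 < a -> eps < a ^+ 2 ->
  (forall c : 'I_k -> R, a * q (\sum_(l < k) c l *: u l) <=
    ip (A (\sum_(l < k) c l *: u l)) (\sum_(l < k) c l *: u l)) ->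
  (forall c : 'I_k -> R, q (\sum_(l < k) c l *: u l) = 0 -> forall l, c l = 0) ->
  (k <= #|[pred i : 'I_m | (a <= al i)%R]|)%N.
Proof.
move=> a0 epsa ua uI; rewrite leqNgt; apply/negP => km.
have [c [l cl] cE] := ex_kernel (fun l i => ip (u l) (e i)) km.
suff q0 : q (\sum_(l < k) c l *: u l) = 0.
  by move: cl; rewrite (uI c q0) eqxx.
apply: (ed_minmax a0 epsa _ (ua c)) => i im ai.
rewrite (ip_suml ipP) -[RHS](cE (Ordinal im)) //.
by apply: eq_bigr => l' _; rewrite (sipZ ipP).
Qed.

End fixed_decomposition.
End eigen_decomposition_theory.

(** * The averaging operator on L^2 *)

Section square_integrable.
Context d (T : measurableType d) (R : realType).
Variable mu : {finite_measure set T -> \bar R}.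
Local Notation L2 := (LfunType mu (lee1n 2)).

Lemma Lfun2P (f : T -> R) : f \in Lfun mu 2%:E <->
  measurable_fun setT f /\ mu.-integrable setT (fun x => (f x ^+ 2)%:E).
Proof.
split=> [fL|[mf fi]].
  split; last exact: Lfun2_integrable_sqr.
  by move: fL; rewrite inE => /andP[+ _]; rewrite inE.
rewrite inE/=; apply/andP; split; rewrite inE//=.
rewrite /finite_norm unlock poweR_lty //.
have /integrableP[_] := fi; apply: le_lt_trans.
apply: ge0_le_integral => //=.
- apply/measurable_EFinP; apply: (@measurableT_comp _ _ _ _ _ _ (@powR R ^~ 2)) => //.
  exact: measurableT_comp.
- apply/measurable_EFinP; apply: measurableT_comp => //.
  exact: measurable_funX.
- by move=> x _; rewrite lee_fin normrX powR_mulrn.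
Qed.

Lemma Lnorm2E (f : T -> R) : f \in Lfun mu 2%:E ->
  ('N[mu]_2%:E[EFin \o f] = (Num.sqrt (\int[mu]_x (f x ^+ 2)))%:E)%E.
Proof.
move=> /Lfun2P[mf fi]; rewrite unlock.
have -> : (\int[mu]_x `|(EFin \o f) x| `^ 2 = (\int[mu]_x (f x ^+ 2))%:E)%E.
  rewrite /Rintegral fineK; last exact: integrable_fin_num.
  apply: eq_integral => x _ /=.
  by rewrite -[RHS]/((f x ^+ 2)%:E) -real_normK ?num_real // -powR_mulrn.
by rewrite poweR_EFin -powR12_sqrt // Rintegral_ge0 // => x _; exact: sqr_ge0.
Qed.

(** On a finite measure space such functions are integrable and multiply L^2 into itself, so this
    one condition settles most integrability questions below. *)
Definition bounded_measurable (f : T -> R) : Prop :=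
  measurable_fun setT f /\ exists M, forall x, `|f x| <= M.

Lemma bounded_measurable_mul f g :
  bounded_measurable f -> bounded_measurable g -> bounded_measurable (f \* g).
Proof.
move=> [mf [M fM]] [mg [N gN]]; split; first exact: measurable_funM.
by exists (M * N) => x; rewrite /= normrM ler_pM.
Qed.

Lemma bounded_measurable_cst c : bounded_measurable (cst c).
Proof. by split => //; exists `|c|. Qed.

Lemma bounded_measurable_indic (D : set T) : measurable D ->
  bounded_measurable (\1_D : T -> R).
Proof.
move=> mD; split; first exact: measurable_indic.
by exists 1 => x; rewrite indicE; case: (x \in D); rewrite ?normr1 ?normr0.
Qed.

Lemma Lfun2_bounded_mul f u : bounded_measurable f -> u \in Lfun mu 2%:E ->
  (f \* u) \in Lfun mu 2%:E.
Proof.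
move=> [mf [M fM]] /Lfun2P[mu' ui]; apply/Lfun2P; split.
  exact: measurable_funM.
have Mi := integrableZl (measurableT) (M ^+ 2) ui.
apply: le_integrable Mi => //.
  by apply/measurable_EFinP; apply: measurable_funX; exact: measurable_funM.
move=> x _ /=; rewrite lee_fin exprMn !ger0_norm; try by rewrite mulr_ge0 ?sqr_ge0.
rewrite ler_wpM2r ?sqr_ge0 // -(real_normK (num_real (f x))).
by rewrite ler_pXn2r // nnegrE // (le_trans _ (fM x)).
Qed.

Lemma Lfun2_bounded f : bounded_measurable f -> f \in Lfun mu 2%:E.
Proof.
move=> bf; rewrite (_ : f = f \* cst 1).
  by apply: Lfun2_bounded_mul => //; exact: Lfun_cst.
by apply/funext => x; rewrite /= mulr1.
Qed.

Definition toL2 (f : T -> R) (fL : f \in Lfun mu 2%:E) : L2 := Lfun_Sub (lee1n 2) fL.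

Lemma L2P (u : L2) : (u : T -> R) \in Lfun mu 2%:E.
Proof. exact: LfunP. Qed.

Lemma L2_measurable (u : L2) : measurable_fun setT u.
Proof. by have /Lfun2P[] := L2P u. Qed.

Lemma L2_integrable (u : L2) : mu.-integrable setT (fun x => (u x)%:E).
Proof.
apply/Lfun1_integrable; apply: Lfun_subset12 (L2P u); exact: fin_num_measure.
Qed.

Lemma L2_mul_integrable (u v : L2) :
  mu.-integrable setT (fun x => (u x * v x)%:E).
Proof. by apply/Lfun1_integrable; apply: Lfun2_mul_Lfun1; exact: L2P. Qed.

Lemma L2_wmul_integrable w (u v : L2) : bounded_measurable w ->
  mu.-integrable setT (fun x => (w x * (u x * v x))%:E).
Proof.
move=> bw; pose wu := toL2 (Lfun2_bounded_mul bw (L2P u)).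
have := L2_mul_integrable wu v; congr (_.-integrable _ _).
by apply/funext => x /=; rewrite mulrA.
Qed.

Lemma bounded_integrable w : bounded_measurable w ->
  mu.-integrable setT (fun x => (w x)%:E).
Proof. by move=> /Lfun2_bounded wL; exact: L2_integrable (toL2 wL). Qed.

Lemma L2_sumE (I : Type) (r : seq I) (P : pred I) (F : I -> L2) x :
  (\sum_(i <- r | P i) F i) x = \sum_(i <- r | P i) F i x.
Proof. by elim/big_rec2 : _ => [//|i y z _ <-]. Qed.

Lemma integrable_sumr (I : Type) (r : seq I) (P : pred I) (F : I -> T -> R) :
  (forall i, P i -> mu.-integrable setT (EFin \o F i)) ->
  mu.-integrable setT (EFin \o (fun x => \sum_(i <- r | P i) F i x)).
Proof.
move=> Fi; rewrite (_ : _ \o _ = fun x => (\sum_(i <- r | P i) (F i x)%:E)%E).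
  exact: integrable_sum.
by apply/funext => x; rewrite /= sumEFin.
Qed.

Lemma Rintegral_sum (I : Type) (r : seq I) (P : pred I) (F : I -> T -> R) :
  (forall i, P i -> mu.-integrable setT (EFin \o F i)) ->
  \int[mu]_x \sum_(i <- r | P i) F i x = \sum_(i <- r | P i) \int[mu]_x F i x.
Proof.
move=> Fi; elim: r => [|i r IH].
  rewrite big_nil; under eq_Rintegral do rewrite big_nil.
  by rewrite Rintegral_cst // mul0r.
rewrite big_cons -IH; under eq_Rintegral do rewrite big_cons.
case: ifPn => // Pi; rewrite RintegralD //; first exact: Fi.
exact: integrable_sumr.
Qed.

(** The main weight is the volume of the balls: it cancels the normalization of the mean and makes
    averaging symmetric. *)
Definition ipw (w : T -> R) (u v : L2) : R := \int[mu]_x (w x * (u x * v x)).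

Lemma ipw_semi_inner_product w : bounded_measurable w -> (forall x, 0 <= w x) ->
  semi_inner_product (ipw w).
Proof.
move=> bw w0; split.
- by move=> u v; apply: eq_Rintegral => x _; rewrite [u x * _]mulrC.
- move=> u v z; rewrite /ipw -RintegralD //; try exact: L2_wmul_integrable.
  by apply: eq_Rintegral => x _; rewrite -mulrDr -mulrDl.
- move=> a u v; rewrite /ipw -RintegralZl //; last exact: L2_wmul_integrable.
  by apply: eq_Rintegral => x _; rewrite -[(a *: u) x]/(a * u x); ring.
- move=> u; apply: Rintegral_ge0 => x _.
  by rewrite mulr_ge0 // -expr2 sqr_ge0.
Qed.

Lemma L2_cauchy_schwarz (u v : L2) :
  (\int[mu]_x (u x * v x)) ^+ 2 <=
  \int[mu]_x (u x ^+ 2) * \int[mu]_x (v x ^+ 2).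
Proof.
have ip1 (f g : L2) : ipw (cst 1) f g = \int[mu]_x (f x * g x).
  by apply: eq_Rintegral => x _; rewrite mul1r.
have := cauchy_schwarz (ipw_semi_inner_product (bounded_measurable_cst 1)
  (fun=> ler01)) u v.
by rewrite !ip1.
Qed.

(** The bridge between null vectors of the abstract theory and the almost-everywhere equalities in
    the definition of the spectrum; it rests on the strict positivity of the weight. *)
Lemma ipw_null w (u : L2) : bounded_measurable w -> (forall x, 0 < w x) ->
  ipw w u u = 0 <-> {ae mu, forall x, u x = 0}.
Proof.
move=> bw w0.
have wi := L2_wmul_integrable u u bw.
have mwu : measurable_fun setT (fun x => (w x * (u x * u x))%:E).
  by case/integrableP : wi.
have : (\int[mu]_x `|(w x * (u x * u x))%:E| = (ipw w u u)%:E)%E.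
  rewrite /ipw /Rintegral fineK; last exact: integrable_fin_num.
  apply: eq_integral => x _; rewrite gee0_abs // lee_fin; apply: mulr_ge0.
    exact: ltW.
  by rewrite -expr2 sqr_ge0.
have := ae_eq_integral_abs mu measurableT mwu.
move=> [H1 H2] E; split => [u0|u0].
  have := H1 ltac:(by rewrite E u0).
  apply: filterS => x /(_ I) H; have {H} : w x * (u x * u x) = 0 by case: H.
  move=> /eqP; rewrite mulf_eq0 gt_eqF //= mulf_eq0 orbb.
  by move/eqP.
suff : (ipw w u u)%:E = 0%E by case.
rewrite -E; apply: H2.
by move: u0; apply: filterS => x -> _; rewrite !mulr0.
Qed.

Lemma ipw_ae w (u v : L2) : bounded_measurable w -> (forall x, 0 < w x) ->
  ipw w (u - v) (u - v) = 0 <-> {ae mu, forall x, u x = v x}.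
Proof.
move=> bw w0; rewrite ipw_null //.
split; apply: filterS => x; first by move/subr0_eq.
by move=> uv; rewrite -[LHS]/(u x - v x) uv subrr.
Qed.

Lemma ipw_le a b w w' (u : L2) : bounded_measurable w -> bounded_measurable w' ->
  (forall x, a * w x <= b * w' x) -> a * ipw w u u <= b * ipw w' u u.
Proof.
move=> bw bw' ww'; rewrite /ipw -!RintegralZl //; try exact: L2_wmul_integrable.
apply: le_Rintegral => //.
- exact: (integrableZl measurableT a (L2_wmul_integrable u u bw)).
- exact: (integrableZl measurableT b (L2_wmul_integrable u u bw')).
- by move=> x _; rewrite !(mulrA _ _ (_ * _)) ler_wpM2r // -expr2 sqr_ge0.
Qed.

End square_integrable.

(** * Integrals over the neighbourhoods of a symmetric measurable relation *)

Section neighbourhood_integral.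
Context d (T : measurableType d) (R : realType).
Variables (mu : {finite_measure set T -> \bar R}) (B : T -> set T).
Local Notation L2 := (LfunType mu (lee1n 2)).

(** [B] is kept abstract so that the same results serve the balls of [X] and of every [X_n]. *)
Definition nbh_integral (f : T -> R) (x : T) : R := \int[mu]_(y in B x) f y.

Definition nbh_volume (x : T) : R := fine (mu (B x)).

Local Notation J := nbh_integral.
Local Notation vol := nbh_volume.

Hypothesis mB : measurable [set z : T * T | B z.1 z.2].
Hypothesis Bsym : forall x y, B x y -> B y x.

Lemma measurable_nbh x : measurable (B x).
Proof.
have := measurable_xsection x mB; congr (measurable _).
by apply/seteqP; split => y /=; rewrite /xsection /= ?inE.
Qed.

Lemma nbh_integralE f x : J f x = \int[mu]_y (\1_(B x) y * f y).
Proof.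
rewrite /J Rintegral_mkcond; apply: eq_Rintegral => y _.
by rewrite /patch indicE; case: ifPn; rewrite ?mul1r ?mul0r.
Qed.

Lemma nbh_volumeE x : vol x = J (cst 1) x.
Proof. by rewrite /J Rintegral_cst ?mul1r //; exact: measurable_nbh. Qed.

Lemma nbh_integrable f x : mu.-integrable setT (EFin \o f) ->
  mu.-integrable setT (fun y => (\1_(B x) y * f y)%:E).
Proof.
move=> fi; apply: le_integrable (fi) => //.
  apply/measurable_EFinP; apply: measurable_funM; last first.
    by apply/measurable_EFinP; case/integrableP : fi.
  by apply: measurable_indic; exact: measurable_nbh.
move=> y _ /=; rewrite lee_fin normrM indicE.
by case: (_ \in _); rewrite ?normr1 ?normr0 ?mul1r ?mul0r.
Qed.

Lemma nbh_integral_linear a f g : mu.-integrable setT (EFin \o f) ->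
  mu.-integrable setT (EFin \o g) ->
  forall x, J (fun y => a * f y + g y) x = a * J f x + J g x.
Proof.
move=> fi gi x; rewrite !nbh_integralE -RintegralZl //; last exact: nbh_integrable.
rewrite -RintegralD //; last 2 first.
- exact: (integrableZl measurableT a (nbh_integrable x fi)).
- exact: nbh_integrable.
by apply: eq_Rintegral => y _; ring.
Qed.

Lemma nbh_integral_le_norm f x : mu.-integrable setT (EFin \o f) ->
  `|J f x| <= \int[mu]_y `|f y|.
Proof.
move=> fi; rewrite nbh_integralE.
apply: (le_trans (le_normr_Rintegral measurableT (nbh_integrable x fi))).
apply: le_Rintegral => //.
- exact: integrable_norm (nbh_integrable x fi).
- exact: integrable_norm.
- move=> y _; rewrite normrM indicE.
  by case: (_ \in _); rewrite ?normr1 ?normr0 ?mul1r ?mul0r.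
Qed.

Let kernel_measurable (f g : T -> R) : measurable_fun setT f ->
  measurable_fun setT g -> measurable_fun setT
    (fun z : T * T => (\1_(B z.1) z.2 * (g z.1 * f z.2))%:E).
Proof.
move=> mf mg; apply/measurable_EFinP; apply: measurable_funM.
  rewrite (_ : (fun _ => _) = \1_[set z : T * T | B z.1 z.2]).
    exact: measurable_indic.
  apply/funext => z; rewrite !indicE.
  suff -> : (z.2 \in B z.1) = (z \in [set z : T * T | B z.1 z.2]) by [].
  by apply/idP/idP; rewrite !inE.
by apply: measurable_funM; apply: measurableT_comp.
Qed.

(** Tonelli: the indicator is at most 1, so the double integral is at most the product of the
    integrals of [|f|] and [|g|]. *)
Let kernel_integrable (f g : T -> R) : mu.-integrable setT (EFin \o f) ->
  mu.-integrable setT (EFin \o g) -> (mu \x mu)%E.-integrable setT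
    (fun z : T * T => (\1_(B z.1) z.2 * (g z.1 * f z.2))%:E).
Proof.
move=> fi gi.
have mf : measurable_fun setT f by apply/measurable_EFinP; case/integrableP : fi.
have mg : measurable_fun setT g by apply/measurable_EFinP; case/integrableP : gi.
apply/integrable12ltyP; first exact: kernel_measurable.
have /integrableP[_ fi'] := fi; have /integrableP[_ gi'] := gi.
have fin : (\int[mu]_y `|(f y)%:E| \is a fin_num)%E.
  by rewrite ge0_fin_numE // integral_ge0.
have : (\int[mu]_x `|(g x)%:E| * \int[mu]_y `|(f y)%:E| < +oo)%E.
  rewrite lte_mul_pinfty // ?integral_ge0 // ge0_fin_numE // integral_ge0 //.
apply: le_lt_trans.
rewrite -ge0_integralZr //; last 2 first.
- by apply: measurableT_comp => //; exact/measurable_EFinP.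
- by rewrite integral_ge0.
apply: ge0_le_integral => //.
- by move=> x _; rewrite integral_ge0.
- apply: (@measurable_fun_fubini_tonelli_F _ _ _ _ _ mu
    (fun z : T * T => `|(\1_(B z.1) z.2 * (g z.1 * f z.2))%:E|%E)) => //.
  by apply: measurableT_comp => //; exact: kernel_measurable.
- apply: emeasurable_funM => //.
  by apply: measurableT_comp => //; exact/measurable_EFinP.
move=> x _; rewrite -ge0_integralZl //; last first.
  by apply: measurableT_comp => //; exact/measurable_EFinP.
apply: ge0_le_integral => //.
- apply: measurableT_comp => //; apply/measurable_EFinP.
  apply: measurable_funM; first by apply: measurable_indic; exact: measurable_nbh.
  by apply: measurable_funM => //=; exact: measurable_cst.
- apply: emeasurable_funM => //.
  by apply: measurableT_comp => //; exact/measurable_EFinP.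
move=> y _; rewrite -abseM -EFinM lee_fin !normrM indicE.
by case: (_ \in _); rewrite ?normr1 ?normr0 ?mul1r ?mul0r // mulr_ge0.
Qed.

Lemma nbh_integral_measurable f : mu.-integrable setT (EFin \o f) ->
  measurable_fun setT (J f).
Proof.
move=> fi; have ci : mu.-integrable setT (EFin \o (cst 1 : T -> R)).
  exact: finite_measure_integrable_cst.
have mF := measurable_fubini_F (kernel_integrable fi ci).
have := measurableT_comp (fine_measurable (@measurableT _ (\bar R))) mF.
congr (measurable_fun _ _); apply/funext => x /=.
by rewrite nbh_integralE; apply: eq_Rintegral => y _ /=; rewrite mul1r.
Qed.

Lemma nbh_integral_bounded f : mu.-integrable setT (EFin \o f) ->
  bounded_measurable (J f).
Proof.
move=> fi; split; first exact: nbh_integral_measurable.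
by exists (\int[mu]_y `|f y|) => x; exact: nbh_integral_le_norm.
Qed.

Lemma nbh_volume_bounded : bounded_measurable vol.
Proof.
rewrite (_ : vol = J (cst 1)); last by apply/funext => x; exact: nbh_volumeE.
by apply: nbh_integral_bounded; exact: finite_measure_integrable_cst.
Qed.

(** Fubini for the kernel [\1_(B x) y], which is symmetric in [x] and [y]. *)
Lemma nbh_integral_sym (f g : T -> R) : mu.-integrable setT (EFin \o f) ->
  mu.-integrable setT (EFin \o g) ->
  \int[mu]_x (J f x * g x) = \int[mu]_x (f x * J g x).
Proof.
move=> fi gi; have ki := kernel_integrable fi gi.
have := integral12_prod_meas1 ki; rewrite -(integral21_prod_meas1 ki).
rewrite /fubini_F /fubini_G => /(congr1 fine) H.
transitivity (fine (\int[mu]_x \int[mu]_y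
    ((\1_(B (x, y).1) (x, y).2 * (g (x, y).1 * f (x, y).2))%:E))%E).
  congr fine; apply: eq_integral => x _ /=.
  rewrite nbh_integralE mulrC -RintegralZl //; last exact: nbh_integrable.
  rewrite /Rintegral fineK; last first.
    apply: integrable_fin_num => //.
    exact: (integrableZl measurableT (g x) (nbh_integrable x fi)).
  by apply: eq_integral => y _; congr EFin; ring.
rewrite H; congr fine; apply: eq_integral => y _ /=.
rewrite nbh_integralE -RintegralZl //; last exact: nbh_integrable.
rewrite /Rintegral fineK; last first.
  apply: integrable_fin_num => //.
  exact: (integrableZl measurableT (f y) (nbh_integrable y gi)).
apply: eq_integral => x _; congr EFin.
rewrite (_ : \1_(B x) y = \1_(B y) x); first by ring.
rewrite !indicE; suff -> : (y \in B x) = (x \in B y) by [].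
by apply/idP/idP; rewrite !inE; exact: Bsym.
Qed.

End neighbourhood_integral.

Section averaging_operator.
Context d (T : measurableType d) (R : realType).
Variables (mu : {finite_measure set T -> \bar R}) (B : T -> set T).
Local Notation L2 := (LfunType mu (lee1n 2)).
Local Notation J := (nbh_integral mu B).
Local Notation vol := (nbh_volume mu B).
Hypothesis mB : measurable [set z : T * T | B z.1 z.2].
Hypothesis Bsym : forall x y, B x y -> B y x.
Variable c : R.
Hypothesis c0 : 0 < c.
Hypothesis vol_ge : forall x, c <= vol x.

Local Notation ip := (@ipw _ _ _ mu vol).

Lemma vol_gt0 x : 0 < vol x.
Proof. exact: lt_le_trans (vol_ge x). Qed.

Lemma vol_le x : vol x <= fine (mu setT).
Proof.
apply: fine_le; rewrite ?fin_num_measure //; first exact: measurable_nbh.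
by apply: le_measure => //; rewrite inE //; exact: measurable_nbh.
Qed.

Lemma vol_bounded : bounded_measurable vol.
Proof. exact: nbh_volume_bounded. Qed.

Lemma vol_sip : semi_inner_product ip.
Proof.
by apply: ipw_semi_inner_product vol_bounded _ => x; rewrite ltW // vol_gt0.
Qed.

Lemma inv_vol_bounded : bounded_measurable (fun x => (vol x)^-1).
Proof.
split.
  have := measurableT_comp (@measurable_powR R (-1)) vol_bounded.1.
  congr (measurable_fun _ _); apply/funext => x /=.
  by rewrite powR_inv1 // ltW // vol_gt0.
exists c^-1 => x; rewrite normfV gtr0_norm ?vol_gt0 // lef_pV2 ?posrE //.
exact: vol_gt0.
Qed.

Definition avg (u : T -> R) (x : T) : R := (vol x)^-1 * J u x.

Lemma avg_bounded (u : L2) : bounded_measurable (avg u).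
Proof.
apply: bounded_measurable_mul inv_vol_bounded _.
by apply: nbh_integral_bounded => //; exact: L2_integrable.
Qed.

Definition avg_op (u : L2) : L2 := toL2 (Lfun2_bounded mu (avg_bounded u)).

Lemma avg_opE u x : avg_op u x = (vol x)^-1 * J u x.
Proof. by []. Qed.

Lemma vol_avg_op u x : vol x * avg_op u x = J u x.
Proof. by rewrite avg_opE mulrA mulfV ?mul1r // gt_eqF // vol_gt0. Qed.

Let kernel_bounded x : bounded_measurable (fun y => (vol x)^-1 * \1_(B x) y).
Proof.
apply: bounded_measurable_mul (bounded_measurable_cst _ _) _.
by apply: bounded_measurable_indic; exact: measurable_nbh.
Qed.

(** The vector representing evaluation of [avg_op] at [x], see [ip_avg_kernel]. One inverse volume
    normalizes the mean, the other cancels the weight of [ip]. *)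
Definition avg_kernel x : L2 :=
  toL2 (Lfun2_bounded mu (bounded_measurable_mul inv_vol_bounded (kernel_bounded x))).

Lemma ip_avg_kernel x (u : L2) : ip (avg_kernel x) u = avg_op u x.
Proof.
rewrite avg_opE nbh_integralE // -RintegralZl //; last first.
  by apply: nbh_integrable => //; exact: L2_integrable.
apply: eq_Rintegral => y _ /=; field.
by rewrite !gt_eqF // vol_gt0.
Qed.

Lemma ipE_avg (u v : L2) : ip (avg_op u) v = \int[mu]_x (J u x * v x).
Proof.
by apply: eq_Rintegral => x _; rewrite mulrA vol_avg_op.
Qed.

Lemma q_avg_kernel x : ip (avg_kernel x) (avg_kernel x) <= c ^- 2.
Proof.
rewrite ip_avg_kernel avg_opE nbh_integralE //.
have H : \int[mu]_y (\1_(B x) y * avg_kernel x y) <= c^-1.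
  have bk : bounded_measurable (fun y => \1_(B x) y * avg_kernel x y).
    apply: bounded_measurable_mul.
      by apply: bounded_measurable_indic; exact: measurable_nbh.
    apply: bounded_measurable_mul inv_vol_bounded _; exact: kernel_bounded.
  have bk' : bounded_measurable (fun y => (c^-1 * (vol x)^-1) * (\1_(B x) y * 1)).
    apply: bounded_measurable_mul (bounded_measurable_cst _ _) _.
    apply: bounded_measurable_mul (bounded_measurable_cst _ _).
    by apply: bounded_measurable_indic; exact: measurable_nbh.
  apply: (@le_trans _ _ (\int[mu]_y ((c^-1 * (vol x)^-1) * (\1_(B x) y * 1)))).
    apply: le_Rintegral => //; try exact: bounded_integrable.
    move=> y _; rewrite /= mulr1; set i := \1_(B x) y.
    have ii : i * i = i.
      by rewrite /i indicE; case: (_ \in _); rewrite ?mulr1 ?mulr0.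
    set a := (vol y)^-1; set b := (vol x)^-1.
    have -> : i * (a * (b * i)) = a * (b * (i * i)) by ring.
    rewrite ii -mulrA ler_wpM2r //.
      by apply: mulr_ge0; rewrite ?ler0n // invr_ge0 ltW // vol_gt0.
    by rewrite lef_pV2 ?posrE // vol_gt0.
  rewrite RintegralZl //; last first.
    by apply: nbh_integrable => //; exact: finite_measure_integrable_cst.
  rewrite -(nbh_integralE mu B (cst 1)) -nbh_volumeE // -mulrA mulVf ?mulr1 //.
  by rewrite gt_eqF // vol_gt0.
rewrite -exprVn expr2; apply: ler_pM => //.
- by rewrite invr_ge0 ltW // vol_gt0.
- apply: Rintegral_ge0 => y _ /=.
  by do ![apply: mulr_ge0]; rewrite ?ler0n // invr_ge0 ltW // vol_gt0.
- by rewrite lef_pV2 ?posrE // vol_gt0.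
Qed.

(** Cauchy-Schwarz against [avg_kernel x]: averaging turns mean-square bounds into uniform ones. *)
Lemma avg_op_le (u : L2) x : avg_op u x ^+ 2 <= c ^- 2 * ip u u.
Proof.
rewrite -ip_avg_kernel; apply: le_trans (cauchy_schwarz vol_sip _ _) _.
by rewrite ler_wpM2r ?(sip_ge0 vol_sip) // q_avg_kernel.
Qed.

Local Notation M := (fine (mu setT)).

Lemma q_le_sup (u : L2) D : (forall x, u x ^+ 2 <= D) -> ip u u <= M ^+ 2 * D.
Proof.
move=> uD; rewrite expr2 -mulrA [_ * D]mulrC.
have -> : M * (D * M) = \int[mu]_(x in setT) (M * D).
  by rewrite Rintegral_cst // mulrA.
apply: le_Rintegral => //.
- exact: L2_wmul_integrable vol_bounded.
- exact: finite_measure_integrable_cst.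
- move=> x _; rewrite -expr2 ler_pM //; first by rewrite ltW // vol_gt0.
    exact: sqr_ge0.
  exact: vol_le.
Qed.

Lemma avg_op_hilbert_schmidt : hilbert_schmidt ip avg_op.
Proof.
have lin a u v : avg_op (a *: u + v) = a *: avg_op u + avg_op v.
  apply/LfuneqP => x; rewrite avg_opE.
  rewrite (_ : J _ x = a * J u x + J v x); last first.
    by rewrite -nbh_integral_linear //; exact: L2_integrable.
  by rewrite -[RHS]/(a * avg_op u x + avg_op v x) !avg_opE; ring.
split=> //.
- move=> u v; rewrite ipE_avg nbh_integral_sym //; try exact: L2_integrable.
  by apply: eq_Rintegral => x _; rewrite mulrCA vol_avg_op.
(* At each point, Bessel's inequality for [avg_kernel x] bounds the sum of the squares of
   [avg_op (e i) x] by [c ^- 2]; this is integrated with a weight at most [M] over total mass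
   [M]. *)
- exists (M ^+ 2 * c ^- 2) => m e eO.
  pose F i := fun x => vol x * (avg_op (e i) x * avg_op (e i) x).
  have -> : \sum_(i < m) ip (avg_op (e i)) (avg_op (e i)) =
      \int[mu]_x \sum_(i < m) F i x.
    by rewrite Rintegral_sum // => i _; exact: L2_wmul_integrable vol_bounded.
  have -> : M ^+ 2 * c ^- 2 = \int[mu]_(x in setT) (M * c ^- 2).
    by rewrite Rintegral_cst //; ring.
  apply: le_Rintegral => //.
  + by apply: integrable_sumr => i _; exact: L2_wmul_integrable vol_bounded.
  + exact: finite_measure_integrable_cst.
  + move=> x _; rewrite /F -mulr_sumr ler_pM //.
    * by rewrite ltW // vol_gt0.
    * by apply: sumr_ge0 => i _; rewrite -expr2 sqr_ge0.
    * exact: vol_le.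
    * apply: le_trans (q_avg_kernel x).
      apply: le_trans (bessel vol_sip eO (avg_kernel x)).
      by apply: ler_sum => i _; rewrite ip_avg_kernel expr2.
(* By [avg_op_le] the images are uniformly Cauchy, so their pointwise limit is measurable and
   bounded and serves as the limit in L^2. *)
- move=> u_ uC.
  have lip x i j : (avg_op (u_ i) x - avg_op (u_ j) x) ^+ 2 <=
      c ^- 2 * ip (u_ i - u_ j) (u_ i - u_ j).
    apply: le_trans (avg_op_le _ x).
    have -> : u_ i - u_ j = -1 *: u_ j + u_ i by rewrite scaleN1r addrC.
    by rewrite lin scaleN1r [- _ + _]addrC.
  have unif h : 0 < h -> exists N, forall x i j, (N <= i)%N -> (N <= j)%N ->
      `|avg_op (u_ i) x - avg_op (u_ j) x| <= h.
    move=> h0; have [|N HN] := uC ((c * h) ^+ 2).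
      by rewrite exprn_gt0 // mulr_gt0.
    exists N => x i j Ni Nj.
    rewrite -(@ler_pXn2r _ 2) ?nnegrE ?(ltW h0) // real_normK ?num_real //.
    apply: le_trans (lip x i j) _; have := HN _ _ Ni Nj.
    by rewrite exprMn => H; rewrite mulrC ler_pdivrMr ?exprn_gt0 // mulrC.
  have cvgx x : cvgn (fun j => avg_op (u_ j) x).
    apply: cauchy_cvg; apply: cauchy_exP => h h0.
    have [N HN] := unif (h / 2) (divr_gt0 h0 (ltr0n _ 2)).
    exists (avg_op (u_ N) x); exists N => // j /= Nj.
    rewrite -ball_normE /=; apply: le_lt_trans (HN x N j (leqnn _) Nj) _.
    by rewrite ltr_pdivrMr // ltr_pMr // ltr1n.
  pose w x := lim (avg_op (u_ j) x @[j --> \oo]).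
  have wlim h : 0 < h -> exists N, forall x j, (N <= j)%N ->
      `|avg_op (u_ j) x - w x| <= h.
    move=> h0; have [N HN] := unif h h0; exists N => x j Nj.
    have cv : `|avg_op (u_ j) x - avg_op (u_ i) x| @[i --> \oo] -->
        `|avg_op (u_ j) x - w x|.
      by apply: cvg_norm; apply: cvgB; [exact: cvg_cst|exact: cvgx].
    rewrite -(cvg_lim _ cv) //; apply: limr_le.
      by apply/cvg_ex; eexists; exact: cv.
    by exists N => // i /= Ni; exact: HN.
  have bw : bounded_measurable w.
    split.
      apply: (measurable_fun_cvg (h := fun j => avg_op (u_ j))).
        by move=> j; exact: L2_measurable.
      by move=> x _; exact: cvgx.
    have [N HN] := wlim 1 ltr01.
    have [_ [D HD]] := avg_bounded (u_ N).
    exists (1 + D) => x.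
    have := HN x N (leqnn _); have := HD x; rewrite -/(avg_op (u_ N) x) => H1 H2.
    rewrite -(subrK (avg_op (u_ N) x) (w x)).
    by apply: le_trans (ler_normD _ _) _; rewrite distrC lerD.
  pose W : L2 := toL2 (Lfun2_bounded mu bw).
  exists W => h h0.
  have M0 : 0 <= M by exact: fine_ge0.
  have [|N HN] := wlim (Num.sqrt (h / (M ^+ 2 + 1))).
    by rewrite sqrtr_gt0 divr_gt0 // ltr_wpDl // sqr_ge0.
  exists N => j Nj.
  apply: le_trans (q_le_sup (D := h / (M ^+ 2 + 1)) _) _.
    move=> x; rewrite -[(avg_op (u_ j) - W) x]/(avg_op (u_ j) x - w x).
    rewrite -real_normK ?num_real //; have := HN x j Nj.
    rewrite -(@ler_pXn2r _ 2) ?nnegrE ?sqrtr_ge0 // sqr_sqrtr //.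
    by rewrite divr_ge0 ?ltW // ltr_wpDl // sqr_ge0.
  rewrite mulrA ler_pdivrMr; last by rewrite ltr_wpDl // sqr_ge0.
  by rewrite mulrC ler_pM2l // lerDl.
Qed.

End averaging_operator.

(** * The spectrum of the Laplacian below [rho ^- 2] *)

Lemma sum_card_fiber (m : nat) (U : eqType) (f : 'I_m -> U) (P : pred 'I_m)
    (S : seq U) : uniq S -> (forall i, P i -> f i \in S) ->
  (\sum_(s <- S) #|[pred i | P i && (f i == s)]| = #|P|)%N.
Proof.
move=> uS PS; rewrite -sum1_card.
under eq_bigr do rewrite -sum1_card big_mkcondr /=.
rewrite exchange_big /=; apply: eq_bigr => i Pi.
rewrite (bigD1_seq (f i)) ?PS //= eqxx big1 // => s sfi.
by rewrite eq_sym (negbTE sfi).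
Qed.

(* [Delta = (1 - A) / rho^2] for the averaging operator [A], so [t] is an
   eigenvalue of the former iff this is one of the latter. *)
Definition avg_eigenvalue (R : realType) (rho t : R) : R := 1 - rho ^+ 2 * t.

Section neighbourhood_laplacian.
Context d (T : measurableType d) (R : realType).
Variables (mu : {finite_measure set T -> \bar R}) (B : T -> set T).
Local Notation L2 := (LfunType mu (lee1n 2)).
Local Notation J := (nbh_integral mu B).
Local Notation vol := (nbh_volume mu B).
Hypothesis mB : measurable [set z : T * T | B z.1 z.2].
Hypothesis Bsym : forall x y, B x y -> B y x.
Variable c : R.
Hypothesis c0 : 0 < c.
Hypothesis vol_ge : forall x, c <= vol x.
Variable rho : R.
Hypothesis rho0 : 0 < rho.

Local Notation ip := (@ipw _ _ _ mu vol).
Local Notation q u := (ip u u).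
Local Notation A := (avg_op mB c0 vol_ge).
Local Notation M := (fine (mu setT)).

Let ipP : semi_inner_product ip := vol_sip mB c0 vol_ge.
Let AP : hilbert_schmidt ip A := avg_op_hilbert_schmidt mB Bsym c0 vol_ge.
Let volB : bounded_measurable vol := vol_bounded mu mB.
Let vol0 : forall x, 0 < vol x := vol_gt0 c0 vol_ge.

(** For [B := mm_ball rho] this is convertible to [rho_laplacian], so the results below apply
    directly to [lambda]. *)
Definition nbh_laplacian (u : T -> R) (x : T) : R :=
  (rho ^+ 2 * vol x)^-1 * \int[mu]_(y in B x) (u x - u y).

Local Notation lap := nbh_laplacian.
Local Notation tau := (avg_eigenvalue rho).

Let rho2 : 0 < rho ^+ 2. Proof. exact: exprn_gt0. Qed.

Lemma nbh_laplacianE (u : L2) x : lap u x = rho ^- 2 * (u x - A u x).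
Proof.
have ui := L2_integrable u.
have ci a : mu.-integrable setT (EFin \o (cst a : T -> R)).
  exact: finite_measure_integrable_cst.
rewrite /lap -/(J (fun y => u x - u y) x).
rewrite (_ : (fun y => _) = (fun y => -1 * u y + cst (u x) y)); last first.
  by apply/funext => y; rewrite mulN1r addrC.
rewrite nbh_integral_linear // -(vol_avg_op mB c0 vol_ge).
rewrite /J Rintegral_cst; last exact: measurable_nbh.
rewrite -/(vol x); field.
by rewrite !gt_eqF.
Qed.

(** The operator identity [Delta - t = - rho ^- 2 * (A - tau t)], by which solvability and
    eigenvectors pass between the two operators. *)
Lemma lap_ae t (u v : L2) : {ae mu, forall x, lap u x - t * u x = v x} <->
  q (A u - tau t *: u - (- rho ^+ 2) *: v) = 0.
Proof.
rewrite ipw_ae //; split; apply: filterS => x.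
  move=> H; rewrite -[RHS]/(- rho ^+ 2 * v x) -H nbh_laplacianE.
  rewrite -[LHS]/(A u x - tau t * u x) /avg_eigenvalue.
  by field; rewrite gt_eqF.
rewrite -[X in X = _ -> _]/(A u x - tau t * u x).
rewrite -[X in _ = X -> _]/(- rho ^+ 2 * v x) /avg_eigenvalue nbh_laplacianE => H.
rewrite -[RHS](mulKf (_ : - rho ^+ 2 != 0)) ?oppr_eq0 ?gt_eqF //.
rewrite -H; field; by rewrite gt_eqF.
Qed.

Lemma lap_eigenspace t (u : L2) :
  Defs.eigenspace mu lap t u <-> q (A u - tau t *: u) = 0.
Proof.
have -> : q (A u - tau t *: u) = q (A u - tau t *: u - (- rho ^+ 2) *: 0).
  by rewrite scaler0 subr0.
rewrite -lap_ae /Defs.eigenspace /=; split=> [[_]|H].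
  by apply: filterS => x ->; rewrite subrr.
by split; [exact: L2P|apply: filterS H => x /subr0_eq].
Qed.

Lemma q_le_norm (u : L2) : q u <= M * \int[mu]_x (u x ^+ 2).
Proof.
have := @ipw_le _ _ _ mu 1 M vol (cst 1) u volB (bounded_measurable_cst _ _).
rewrite mul1r /ipw; under [X in _ * X]eq_Rintegral do rewrite mul1r -expr2.
by apply => x; rewrite mul1r mulr1; exact: vol_le.
Qed.

Lemma norm_le_q (u : L2) : \int[mu]_x (u x ^+ 2) <= c^-1 * q u.
Proof.
have := @ipw_le _ _ _ mu 1 c^-1 (cst 1) vol u (bounded_measurable_cst _ _) volB.
rewrite mul1r /ipw; under [X in X <= _]eq_Rintegral do rewrite mul1r -expr2.
apply => x; rewrite mul1r -(mulVf (_ : c != 0)) ?gt_eqF //.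
by rewrite ler_wpM2l // invr_ge0 ltW.
Qed.

Section fixed_decomposition.
Variables (eps : R) (m : nat) (e : nat -> L2) (al : nat -> R).
Hypothesis eps0 : 0 < eps.
Hypothesis eD : eigen_decomposition ip A eps m e al.

Lemma lap_resolvent t : eps < tau t ^+ 2 ->
  (forall i, (i < m)%N -> al i != tau t) -> resolvent_set mu lap t.
Proof.
move=> epst alt; have [C C0 HC] := ed_resolvent ipP AP eD (ltW eps0) epst alt.
(* [C] comes from [ed_resolvent] and the power of [rho] from the factor of [v] in [lap_ae]; [M] and
   [c^-1] compare [q] with the unweighted norm. *)
exists (Num.sqrt (c^-1 * (C * (rho ^+ 2) ^+ 2 * M))) => v vL.
pose v' : L2 := toL2 vL.
have [u uP qu] := HC ((- rho ^+ 2) *: v'); exists u; split.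
- exact: L2P.
- exact/(lap_ae t u v').
- move=> w wL; pose w' : L2 := toL2 wL.
  move=> /(lap_ae t w' v') wP; apply/(ipw_ae w' u volB vol0).
  have : q (A (w' - u) - tau t *: (w' - u)) = 0.
    have -> : A (w' - u) - tau t *: (w' - u) =
        (A w' - tau t *: w' - (- rho ^+ 2) *: v') -
        (A u - tau t *: u - (- rho ^+ 2) *: v').
      rewrite (hsB AP) scalerBr; move: (A w') (A u) (_ *: v') => a b z.
      have -> : a - tau t *: w' - z - (b - tau t *: u - z) =
          (a - tau t *: w') - (b - tau t *: u) by rewrite opprB addrA subrK.
      by rewrite !opprD !opprK addrACA.
    by rewrite (qB ipP) wP uP (null_ip ipP) // mulr0 subr0 addr0.
  move=> /(ed_eigenspace ipP AP eD epst); rewrite big1 ?subr0 // => i /eqP ti.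
  by have := alt i (ltn_ord i); rewrite ti eqxx.
- rewrite !Lnorm2E //; last exact: L2P.
  rewrite -EFinM lee_fin -sqrtrM; last first.
    have M0 : 0 <= M by exact: fine_ge0.
    apply: mulr_ge0; first by rewrite invr_ge0 ltW.
    by apply: mulr_ge0 => //; apply: mulr_ge0 => //; exact: sqr_ge0.
  rewrite ler_wsqrtr //; apply: le_trans (norm_le_q u) _.
  rewrite -(mulrA c^-1) ler_wpM2l ?invr_ge0 ?(ltW c0) //; apply: le_trans qu _.
  rewrite (qZ ipP) sqrrN.
  rewrite (_ : _ * M * _ = C * (rho ^+ 2 ^+ 2 * (M * \int[mu]_x (v x ^+ 2)))).
    by rewrite ler_wpM2l // ler_wpM2l ?sqr_ge0 //; exact: q_le_norm v'.
  by rewrite !mulrA.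
Qed.

Lemma lap_eigenvalue t : eps < tau t ^+ 2 ->
  eigenvalues mu lap t <-> exists2 i, (i < m)%N & al i = tau t.
Proof.
move=> epst; split=> [[u ut u0]|[i im ai]]; last first.
  exists (e i); first by apply/lap_eigenspace; rewrite -ai (ed_eig eD).
  move=> /(ipw_null _ volB vol0); rewrite (ed_orth eD) // eqxx => /eqP.
  by rewrite oner_eq0.
apply: contrapT => noi; apply: u0.
have uL : u \in Lfun mu 2%:E by case: ut.
pose u' : L2 := toL2 uL; apply/(ipw_null u' volB vol0).
have /(ed_eigenspace ipP AP eD epst) : q (A u' - tau t *: u') = 0.
  exact/lap_eigenspace.
rewrite big1 ?subr0 // => i /eqP ti; exfalso; apply: noi.
by exists i.
Qed.

(** The [e i] with [al i = tau t] are independent eigenvectors. With more of them than that, some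
    nontrivial combination would be orthogonal to these [e i], hence null by [ed_eigenspace]. *)
Lemma lap_multiplicity t : eps < tau t ^+ 2 ->
  multiplicity mu lap t = (#|[pred i : 'I_m | al i == tau t]|%:R)%:E.
Proof.
move=> epst; set N := #|_|; apply/eqP; rewrite eq_le; apply/andP; split.
  apply: ge_ereal_sup => _ /= [n [u [ut uI]] <-]; rewrite lee_fin ler_nat.
  rewrite leqNgt; apply/negP => Nn.
  have uL i : u i \in Lfun mu 2%:E by case: (ut i).
  pose u' i : L2 := toL2 (uL i).
  have [k [l kl] kE] := ex_kernel (fun l (i : 'I_m) => ip (u' l) (e i)) Nn.
  suff : q (\sum_(i < n) k i *: u' i) = 0.
    move=> /(ipw_null _ volB vol0) H; move: kl; rewrite (uI k) ?eqxx //.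
    by apply: filterS H => x; rewrite L2_sumE.
  have Aw : q (A (\sum_(i < n) k i *: u' i) -
      tau t *: (\sum_(i < n) k i *: u' i)) = 0.
    apply: (big_ind (fun w => q (A w - tau t *: w) = 0)) => [|v w qv qw|i _].
    - by rewrite (hs0 AP) scaler0 subr0 (ip0 ipP).
    - by rewrite (hsD AP) scalerDr opprD addrACA; exact: nullD.
    - rewrite (hsZ AP) scalerA mulrC -scalerA -scalerBr (qZ ipP).
      by have /(lap_eigenspace t (u' i)) -> := ut i; rewrite mulr0.
  have := ed_eigenspace ipP AP eD epst Aw.
  rewrite [X in _ - X]big1 ?subr0 // => i /eqP ti; rewrite (ip_suml ipP).
  rewrite (eq_bigr (fun l => k l * ip (u' l) (e i))) => [|j _]; last first.
    by rewrite (sipZ ipP).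
  by rewrite kE ?scale0r //= ti.
apply: ereal_sup_ubound => /=; exists N => //.
exists (fun j => e (enum_val j : 'I_m)); split => [j|k kE i].
  have := enum_valP j; rewrite inE => /eqP aj.
  apply/lap_eigenspace; have := ed_eig eD (ltn_ord (enum_val j)).
  by rewrite aj.
have /(ipw_null (\sum_(j < N) k j *: e (enum_val j : 'I_m)) volB vol0) :
    {ae mu, forall x, (\sum_(j < N) k j *: e (enum_val j : 'I_m)) x = 0}.
  by apply: filterS kE => x <-; rewrite L2_sumE.
move=> /(null_ip ipP (e (enum_val i : 'I_m))).
rewrite (ip_suml ipP) (bigD1 i) //= (sipZ ipP) (ed_orth eD) // eqxx mulr1.
rewrite big1 ?addr0 // => j ji.
rewrite (sipZ ipP) (ed_orth eD) // (_ : _ == _ = false) ?mulr0 //.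
by apply: contra_neqF ji => /eqP/val_inj/enum_val_inj.
Qed.

(** Near [t], continuity of [tau] keeps [tau s ^+ 2] above [eps] and [tau s] away from the finitely
    many [al i] other than [tau t]; injectivity of [tau] excludes [tau t] itself for [s != t], so
    such an [s] is in the resolvent set. *)
Lemma lap_isolated t : eps < tau t ^+ 2 -> spectrum mu lap t ->
  discrete_spectrum mu lap t.
Proof.
move=> epst ts.
have [i im ai] : exists2 i, (i < m)%N & al i = tau t.
  apply: contrapT => noi; apply: ts; apply: lap_resolvent => // i im.
  by apply/eqP => ai; apply: noi; exists i.
split; first last.
- by rewrite lap_multiplicity // ltry.
- by apply/lap_eigenvalue => //; exists i.
split; first by rewrite inE.
have tauc : tau s @[s --> t] --> tau t.
  apply: cvgB; first exact: cvg_cst.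
  by apply: cvgMr; exact: cvg_id.
exists [set s | eps < tau s ^+ 2 /\ forall i : 'I_m, al i != tau t -> al i != tau s].
  apply: filterI.
    have : tau s * tau s @[s --> t] --> tau t * tau t by exact: cvgM.
    move=> /cvgr_gt/(_ eps); rewrite -expr2 => /(_ epst).
    by apply: filterS => s; rewrite expr2.
  have near_al (j : 'I_m) : \forall s \near t, al j != tau t -> al j != tau s.
    have [->|alj] := eqVneq (al j) (tau t); first by apply: (@filterE _ (nbhs t)) => s /eqP.
    have H : al j - tau s @[s --> t] --> al j - tau t.
      by apply: cvgB; [exact: cvg_cst|exact: tauc].
    have a0 : al j - tau t != 0 by rewrite subr_eq0.
    by apply: filterS (cvgr_neq0 _ H a0) => s; rewrite subr_eq0 => + _.
  exact: filter_forall near_al.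
apply/seteqP; split => [s [[epss als] ss]|_ ->] /=.
  apply: contrapT => st; apply: ss; apply: lap_resolvent => // j jm.
  have [alj|alj] := eqVneq (al j) (tau t); last exact: (als (Ordinal jm)).
  rewrite alj; apply/eqP => tt; apply: st.
  have := gt_eqF rho2; move: tt; rewrite /avg_eigenvalue => tt r0.
  by apply: (mulfI (negbT r0)); lra.
by split.
Qed.

(** Multiplicities are sizes of fibres of [f], and the fibres over eigenvalues at most [t] partition
    the counted indices. The inequality is reversed because [tau] is decreasing. *)
Lemma lap_eigenvalue_count t : 0 < tau t -> eps < tau t ^+ 2 ->
  eigenvalue_count mu lap t = (#|[pred i : 'I_m | (tau t <= al i)%R]|%:R)%:E.
Proof.
move=> taut epst; pose f (i : 'I_m) := (1 - al i) / rho ^+ 2.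
have tauf i : tau (f i) = al i by rewrite /avg_eigenvalue /f; field; rewrite gt_eqF.
have ltau s s' : (tau s <= tau s') = (s' <= s).
  by rewrite /avg_eigenvalue lerD2l lerN2 ler_pM2l.
have epss s : s <= t -> eps < tau s ^+ 2.
  rewrite -ltau => ts; apply: (lt_le_trans epst).
  by rewrite ler_pXn2r ?nnegrE ?(ltW taut) // (le_trans (ltW taut)).
pose S := undup [seq f i | i <- enum [pred i : 'I_m | tau t <= al i]].
have SE : eigenvalues mu lap `&` [set s | s <= t] = [set` S].
  apply/seteqP; split => s /=; rewrite mem_undup.
    move=> [es st]; move: es => /(lap_eigenvalue (epss _ st))[i im ai].
    apply/mapP; exists (Ordinal im); first by rewrite mem_enum inE /= ai ltau.
    by rewrite /f /= ai /avg_eigenvalue; field; rewrite gt_eqF.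
  move=> /mapP[i]; rewrite mem_enum inE => ti ->.
  have fit : f i <= t by rewrite -ltau tauf.
  by split => //; apply/lap_eigenvalue; [exact: epss|exists i; rewrite ?tauf].
rewrite /eigenvalue_count SE esum_fset; last 2 first.
- exact: finite_seq.
- move=> s; rewrite -SE inE => -[_ /epss es]; rewrite lap_multiplicity //.
rewrite -fsbig_seq ?undup_uniq //.
rewrite (eq_big_seq (fun s => (#|[pred i : 'I_m | (tau t <= al i) &&
    (f i == s)]|%:R)%:E)); last first.
  move=> s sS; have [_ st] : (eigenvalues mu lap `&` [set s | s <= t]) s.
    by rewrite SE.
  rewrite lap_multiplicity ?epss //; congr (_%:R%:E); apply: eq_card => i.
  rewrite !inE; apply/eqP/andP => [ai|[ai /eqP <-]]; last by rewrite tauf.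
  rewrite ai ltau st; split => //; apply/eqP; rewrite /f ai /avg_eigenvalue.
  by field; rewrite gt_eqF.
rewrite sumEFin -natr_sum sum_card_fiber ?undup_uniq // => i ti.
by rewrite mem_undup; apply: map_f; rewrite mem_enum.
Qed.

End fixed_decomposition.

(** A spectral value [t < rho ^- 2] has [tau t > 0], and a decomposition with threshold
    [tau t ^+ 2 / 2] shows that it is discrete. *)
Lemma lap_lambda_inf : ((rho ^- 2)%:E <= lambda_inf mu lap)%E.
Proof.
apply: le_ereal_inf_tmp => _ /= [t [ts tnd] <-]; rewrite lee_fin leNgt.
apply/negP => trho; apply: tnd.
have taut : 0 < tau t by rewrite /avg_eigenvalue subr_gt0 mulrC -ltr_pdivlMr // div1r.
have tau2 : 0 < tau t ^+ 2 by rewrite exprn_gt0.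
have [m [e [al eD]]] := hs_decomposition ipP AP (divr_gt0 tau2 (ltr0n _ 2)).
apply: (lap_isolated _ eD) => //; first by rewrite divr_gt0.
by rewrite ltr_pdivrMr // ltr_pMr // ltr1n.
Qed.

Lemma le_lambda (eps : R) (m : nat) (e : nat -> L2) (al : nat -> R) k s :
  0 < eps -> eigen_decomposition ip A eps m e al ->
  (1 <= k)%N -> 0 < tau s -> eps < tau s ^+ 2 ->
  (k <= #|[pred i : 'I_m | (tau s <= al i)%R]|)%N ->
  (lambda_ mu lap k <= s%:E)%E.
Proof.
move=> eps0 eD k1 taus epss km.
have /card_gt0P[i0] : (0 < #|[pred i : 'I_m | (tau s <= al i)%R]|)%N.
  exact: leq_trans km.
rewrite inE => si0.
(* [lambda_] ranges over eigenvalues, and [s] need not be one. It is replaced by the largest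
   eigenvalue [t <= s], given by the least [al j] above [tau s], up to which the same indices are
   counted. *)
pose j := [arg min_(i < i0 | tau s <= al i) al i]%O.
have [sj jmin] : tau s <= al j /\ forall i : 'I_m, tau s <= al i -> al j <= al i.
  by rewrite /j; case: arg_minP => // i si imin.
pose t := (1 - al j) / rho ^+ 2.
have tauE : tau t = al j by rewrite /avg_eigenvalue /t; field; rewrite gt_eqF.
have alj0 : 0 < al j by exact: lt_le_trans sj.
have epsj : eps < tau t ^+ 2.
  by rewrite tauE (lt_le_trans epss) // ler_pXn2r // nnegrE ltW.
have ts : t <= s.
  have : tau s <= tau t by rewrite tauE.
  by rewrite /avg_eigenvalue lerD2l lerN2 ler_pM2l.
have trho : t < rho ^- 2.
  by rewrite /t ltr_pdivrMr // mulVf ?gt_eqF // gtrBl.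
rewrite /lambda_ ge_min; apply/orP; right.
apply: (@le_trans _ _ t%:E); last by rewrite lee_fin.
apply: ereal_inf_lbound; exists t => //=; split.
- by apply/(lap_eigenvalue eD epsj); exists j; rewrite ?tauE.
- by apply: lt_le_trans lap_lambda_inf; rewrite lte_fin.
- rewrite (lap_eigenvalue_count eD) //; last by rewrite tauE.
  rewrite lee_fin ler_nat (leq_trans km) //; apply: subset_leq_card.
  by apply/fintype.subsetP => i; rewrite !inE tauE; exact: jmin.
Qed.

Lemma le_lambda_minmax k s (u : 'I_k -> L2) : (1 <= k)%N -> s < rho ^- 2 ->
  (forall x : 'I_k -> R, tau s * q (\sum_(l < k) x l *: u l) <=
    ip (A (\sum_(l < k) x l *: u l)) (\sum_(l < k) x l *: u l)) ->
  (forall x : 'I_k -> R, q (\sum_(l < k) x l *: u l) = 0 -> forall l, x l = 0) ->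
  (lambda_ mu lap k <= s%:E)%E.
Proof.
move=> k1 srho us ui.
have taus : 0 < tau s by rewrite /avg_eigenvalue subr_gt0 mulrC -ltr_pdivlMr // div1r.
have tau2 : 0 < tau s ^+ 2 by rewrite exprn_gt0.
have eps0 : 0 < tau s ^+ 2 / 2 by rewrite divr_gt0.
have epss : tau s ^+ 2 / 2 < tau s ^+ 2.
  by rewrite ltr_pdivrMr // ltr_pMr // ltr1n.
have [m [e [al eD]]] := hs_decomposition ipP AP eps0.
apply: (le_lambda eps0 eD) => //.
exact: (ed_count_ge ipP AP eD taus epss us ui).
Qed.

(** As [lambda_inf] is at least [rho ^- 2], the strict inequality provides an eigenvalue [t < s] up
    to which at least [k] are counted; [k] of the corresponding eigenvectors are selected. *)
Lemma lambda_lt k s : s < rho ^- 2 -> (lambda_ mu lap k < s%:E)%E ->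
  exists (u : 'I_k -> L2) (al : 'I_k -> R), forall i,
  [/\ forall j, ip (u i) (u j) = (i == j)%:R, q (A (u i) - al i *: u i) = 0 &
      tau s <= al i].
Proof.
move=> srho; rewrite /lambda_ gt_min => /orP[|].
  by rewrite ltNge (le_trans _ lap_lambda_inf) // lee_fin ltW.
move=> /ereal_inf_lt[_ [t [et _ tk] <-]]; rewrite lte_fin => ts.
have ltau : tau s < tau t by rewrite /avg_eigenvalue ltrD2l ltrN2 ltr_pM2l.
have taus : 0 < tau s by rewrite /avg_eigenvalue subr_gt0 mulrC -ltr_pdivlMr // div1r.
have taut : 0 < tau t by exact: lt_trans ltau.
have eps0 : 0 < tau s ^+ 2 by rewrite exprn_gt0.
have epst : tau s ^+ 2 < tau t ^+ 2 by rewrite ltr_pXn2r ?nnegrE ?ltW.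
have [m [e [al eD]]] := hs_decomposition ipP AP eps0.
move: tk; rewrite (lap_eigenvalue_count eD) // lee_fin ler_nat => km.
pose f (i : 'I_k) : 'I_m := enum_val (widen_ord km i).
exists (fun i => e (f i)), (fun i => al (f i)) => i; split.
- move=> j; rewrite (ed_orth eD) // (_ : (_ == _) = (i == j)) //.
  apply/eqP/eqP => [H|-> //]; apply: val_inj.
  have : f i = f j by exact: val_inj.
  by move=> /enum_val_inj/(congr1 (@nat_of_ord _)).
- exact: (ed_eig eD).
- by have := enum_valP (widen_ord km i); rewrite inE; apply: le_trans; exact: ltW.
Qed.

End neighbourhood_laplacian.

(** * Balls in metric measure spaces *)

Section metric_measure_space.
Context (R : realType) (X : mmSpace R).
Local Notation mu := (mm_measure X).
Local Notation M := (fine (mu setT)).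

Definition mm_ball (r : R) (x : borel X) : set (borel X) := ball (x : X) r.

Lemma mm_ballE r (x y : X) : mm_ball r x y = (mdist x y < r).
Proof. by rewrite /mm_ball ballEmdist. Qed.

Lemma mm_ball_sym r (x y : borel X) : mm_ball r x y -> mm_ball r y x.
Proof. by move=> /ball_sym. Qed.

Lemma open_mm_ball (x : X) r : open (ball x r).
Proof.
rewrite openE => y; rewrite ballEmdist /= => xy.
apply/nbhs_ballP; exists (r - mdist x y) => /=; first by rewrite subr_gt0.
move=> z; rewrite !ballEmdist /= => yz.
by apply: le_lt_trans (metric_triangle x y z) _; rewrite -ltrBrDl.
Qed.

Lemma measurable_mm_ball r x : measurable (mm_ball r x).
Proof. by apply: sub_sigma_algebra; exact: open_mm_ball. Qed.

Lemma finite_net e : 0 < e ->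
  exists s : seq X, forall x, exists2 z, z \in s & mdist z x < e.
Proof.
move=> e0; have := @mm_compact R X; rewrite compact_cover.
move=> /(_ X setT (fun z => ball z e))[].
- by move=> z _; exact: open_mm_ball.
- by move=> x _; exists x => //; exact: ballxx.
move=> D _ XD; exists (finmap.enum_fset D) => x.
have [z zD] := XD x I; rewrite ballEmdist => zx.
by exists z.
Qed.

(** The relation is a countable union of products of balls, hence lies in the product sigma-algebra:
    if [x] and [y] are closer than [rho], a point of a fine enough net near [x] still leaves room
    for [y]. *)
Lemma measurable_mm_ball_rel rho :
  measurable [set z : borel X * borel X | mm_ball rho z.1 z.2].
Proof.
have n0 n : 0 < n.+1%:R^-1 :> R by rewrite invr_gt0.
have /choice[s_ Hs] : forall n, exists s : seq X, forall x, exists2 z, z \in s &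
    mdist z x < n.+1%:R^-1 by move=> n; exact: finite_net.
rewrite (_ : [set _ | _] = \bigcup_n \bigcup_(z in [set` s_ n])
    (mm_ball n.+1%:R^-1 z `*` mm_ball (rho - n.+1%:R^-1) z)).
  apply: bigcup_measurable => n _; apply: fin_bigcup_measurable => // z _.
  by apply: measurableX; exact: measurable_mm_ball.
apply/seteqP; split => [[x y]|[x y] [n _ [z zs []]]] /=; last first.
  rewrite !mm_ballE => zx zy; apply: le_lt_trans (metric_triangle x z y) _.
  by rewrite metric_sym -(subrK n.+1%:R^-1 rho) addrC ltrD.
rewrite mm_ballE => xy.
have [|n Hn] := @ex_harmonic_lt R ((rho - mdist x y) / 2).
  by rewrite divr_gt0 // subr_gt0.
have [z zs zx] := Hs n x; exists n => //; exists z => //; split => /=.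
  by rewrite mm_ballE.
rewrite mm_ballE; have := metric_triangle z x y; have := Hn n (leqnn n).
move: zx; set k := _^-1; lra.
Qed.

Lemma unif_continuous_mm (phi : X -> R) :
  (forall e, 0 < e -> exists2 h, 0 < h & forall x y, mdist x y < h ->
    `|phi x - phi y| <= e) -> continuous phi.
Proof.
move=> Hphi x; apply/cvgrPdist_le => e e0; have [h h0 Hh] := Hphi e e0.
apply/nbhs_ballP; exists h => // y; rewrite ballEmdist; exact: Hh.
Qed.

Lemma mm_continuous_measurable (phi : X -> R) : continuous phi ->
  measurable_fun [set: borel X] (phi : borel X -> R).
Proof.
move=> cphi; apply: (measurability _ (RGenOpens.measurableE R)).
move=> /= _ [_ [a [b ->]] <-]; rewrite setTI.
apply: sub_sigma_algebra; apply: open_comp; last exact: interval_open.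
by move=> x _; exact: cphi.
Qed.

Lemma mm_continuous_bounded (phi : X -> R) : continuous phi ->
  exists N, forall x, `|phi x| <= N.
Proof.
move=> cphi.
have /compact_bounded[N [_ HN]] : compact (phi @` [set: X]).
  apply: continuous_compact; last exact: mm_compact.
  by apply: continuous_subspaceT.
by exists (N + 1) => x; apply: HN; [rewrite ltrDl|exists x].
Qed.

Lemma mm_bounded_measurable (phi : X -> R) : continuous phi ->
  bounded_measurable (phi : borel X -> R).
Proof.
by move=> cphi; split; [exact: mm_continuous_measurable|exact: mm_continuous_bounded].
Qed.

Lemma dist_mdist_le (z z' y : X) : `|mdist z y - mdist z' y| <= mdist z z'.
Proof.
rewrite ler_norml; have := metric_triangle z z' y.
have := metric_triangle z' z y; rewrite (metric_sym z' z); lra.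
Qed.

(** Half-open, so that it is exactly a difference of two open balls. *)
Definition annulus (r h : R) (z : borel X) : set (borel X) :=
  [set y | (r - h <= mdist (z : X) y < r + h)%R].

Lemma annulusE r h z : annulus r h z = mm_ball (r + h) z `\` mm_ball (r - h) z.
Proof.
apply/seteqP; split => y /=; rewrite !mm_ballE.
  by move=> /andP[zy1 zy2]; split => //; apply/negP; rewrite -leNgt.
by move=> [zy1 /negP]; rewrite -leNgt => zy2; apply/andP.
Qed.

Lemma measurable_annulus r h z : measurable (annulus r h z).
Proof. by rewrite annulusE; apply: measurableD; exact: measurable_mm_ball. Qed.

Section doubling.
Variable Lambda : R.
Hypothesis Lambda0 : 0 < Lambda.
Hypothesis mm_ball_gt0 : forall (x : X) r, 0 < r -> (0 < mu (ball x r))%E.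
Hypothesis mm_ball_ratio : forall (x : X) (r1 r2 : R), 0 < r2 -> r2 <= r1 ->
  fine (mu (ball x r1)) / fine (mu (ball x r2)) <= (r1 / r2) `^ Lambda.

Lemma mm_ball_fine_gt0 x r : 0 < r -> 0 < fine (mu (mm_ball r x)).
Proof.
move=> r0; rewrite fine_gt0 // mm_ball_gt0 //=.
by rewrite -ge0_fin_numE // fin_num_measure //; exact: measurable_mm_ball.
Qed.

(** By the ratio hypothesis the outer ball exceeds the inner one by a factor at most [1 + b], so the
    annulus has measure at most [b * M], whatever its centre. *)
Lemma annulus_small rho eta : 0 < rho -> 0 < eta ->
  exists h, [/\ 0 < h, h < rho & forall z, fine (mu (annulus rho h z)) <= eta].
Proof.
move=> rho0 eta0; have M0 : 0 <= M by exact: fine_ge0.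
pose b := eta / (M + 1); have b0 : 0 < b by rewrite divr_gt0 //; lra.
pose p := (1 + b) `^ Lambda^-1.
have p1 : 1 < p.
  have -> : 1 = 1 `^ Lambda^-1 :> R by rewrite powR1.
  by rewrite gt0_ltr_powR ?invr_gt0 // ?nnegrE //; lra.
(* The solution [h] of [(rho + h) / (rho - h) = p], where [p] to the power [Lambda] is [1 + b]. *)
exists (rho * (p - 1) / (p + 1)).
have hrho : rho * (p - 1) / (p + 1) < rho.
  by rewrite ltr_pdivrMr ?ltr_pM2l //; lra.
split => // [|z]; first by rewrite divr_gt0 // ?mulr_gt0 //; lra.
set h := rho * _ / _ in hrho *.
have h0 : 0 < h by rewrite /h divr_gt0 // ?mulr_gt0 //; lra.
have rh0 : 0 < rho - h by lra.
have := @mm_ball_ratio z (rho + h) (rho - h) rh0 ltac:(lra).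
have -> : (rho + h) / (rho - h) = p.
  have p10 : p + 1 != 0 by apply: lt0r_neq0; lra.
  have -> : rho + h = 2 * rho * p / (p + 1) by rewrite /h; field.
  have -> : rho - h = 2 * rho / (p + 1) by rewrite /h; field.
  by field; rewrite p10 gt_eqF.
have -> : p `^ Lambda = 1 + b.
  by rewrite -powRrM mulVf ?gt_eqF // powRr1 //; lra.
have B0 := mm_ball_fine_gt0 z rh0.
rewrite ler_pdivrMr // => H.
have BM : fine (mu (mm_ball (rho - h) z)) <= M.
  apply: fine_le; rewrite ?fin_num_measure //; first exact: measurable_mm_ball.
  by apply: le_measure => //; rewrite inE //; exact: measurable_mm_ball.
rewrite annulusE measureD //; try exact: measurable_mm_ball; last first.
  by rewrite -ge0_fin_numE // fin_num_measure //; exact: measurable_mm_ball.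
rewrite (_ : _ `&` _ = mm_ball (rho - h) z); last first.
  apply/setIidPr => y; rewrite !mm_ballE => zy; apply: lt_trans zy _; lra.
rewrite fineB ?fin_num_measure //; try exact: measurable_mm_ball.
have : b * fine (mu (mm_ball (rho - h) z)) <= b * (M + 1).
  by rewrite ler_wpM2l ?(ltW b0) //; lra.
rewrite {2}/b divfK; last by apply: lt0r_neq0; lra.
rewrite /mm_ball in H *; lra.
Qed.

(** Every ball of radius [r] contains the ball of radius [r / 2] around some point of a fixed finite
    net. *)
Lemma mm_ball_lower r : 0 < r ->
  exists2 c, 0 < c & forall x, c <= fine (mu (mm_ball r x)).
Proof.
move=> r0; have r20 : 0 < r / 2 by lra.
have [s Hs] := finite_net r20.
exists (\big[Num.min/1]_(z <- s) fine (mu (mm_ball (r / 2) z))).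
  by apply: lt_bigmin => // z _; exact: mm_ball_fine_gt0.
move=> x; have [z zs zx] := Hs x.
apply: (@le_trans _ _ (fine (mu (mm_ball (r / 2) z)))).
  exact: (ge_bigmin_seq 1 z xpredT).
apply: fine_le; rewrite ?fin_num_measure //; try exact: measurable_mm_ball.
apply: le_measure; rewrite ?inE; try exact: measurable_mm_ball.
move=> y; rewrite !mm_ballE => zy.
apply: le_lt_trans (metric_triangle x z y) _; rewrite (metric_sym x); lra.
Qed.

End doubling.

Local Notation L2 := (LfunType mu (lee1n 2)).
Variable rho : R.
Hypothesis rho0 : 0 < rho.
Local Notation J := (nbh_integral mu (mm_ball rho)).
Local Notation vol := (nbh_volume mu (mm_ball rho)).

(** The indicators of two balls whose centres are within [h] differ only on the annulus;
    Cauchy-Schwarz does the rest. *)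
Lemma mm_integral_diff (u : L2) h z z' : mdist (z : X) z' <= h ->
  (J u z - J u z') ^+ 2 <=
  fine (mu (annulus rho h z)) * \int[mu]_y (u y ^+ 2).
Proof.
move=> zz'; pose k := (\1_(mm_ball rho z) \- \1_(mm_ball rho z')) : borel X -> R.
have mk : measurable_fun setT k.
  by apply: measurable_funB; apply: measurable_indic; exact: measurable_mm_ball.
have k2 y : k y ^+ 2 <= \1_(annulus rho h z) y.
  have iB x : (y \in mm_ball rho x) = (mdist (x : X) y < rho).
    by apply/idP/idP; rewrite inE mm_ballE.
  have iA : (y \in annulus rho h z) = (rho - h <= mdist (z : X) y < rho + h).
    by apply/idP/idP; rewrite inE.
  have := dist_mdist_le z z' y; rewrite /k /= !indicE iA !iB ler_norml => H.
  case: ltP => B1; case: ltP => B2; rewrite ?subrr ?expr0n ?ler0n //=.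
  - by rewrite subr0 expr1n (_ : _ && _) //; lra.
  - by rewrite sub0r sqrrN expr1n (_ : _ && _) //; lra.
have bk : bounded_measurable k.
  split => //; exists 1 => y.
  rewrite -(@ler_pXn2r _ 2) ?nnegrE // real_normK ?num_real // expr1n.
  by apply: le_trans (k2 y) _; rewrite indicE; case: (_ \in _).
pose K : L2 := toL2 (Lfun2_bounded mu bk).
have -> : J u z - J u z' = \int[mu]_y (K y * u y).
  rewrite !nbh_integralE -RintegralB //; last 2 first.
  - by apply: nbh_integrable; [exact: measurable_mm_ball_rel|exact: L2_integrable].
  - by apply: nbh_integrable; [exact: measurable_mm_ball_rel|exact: L2_integrable].
  by apply: eq_Rintegral => y _; rewrite -mulrBl.
apply: le_trans (L2_cauchy_schwarz _ _) _.
rewrite ler_wpM2r //; first by apply: Rintegral_ge0 => y _; exact: sqr_ge0.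
have -> : fine (mu (annulus rho h z)) = \int[mu]_y (\1_(annulus rho h z) y).
  rewrite /Rintegral integral_indic ?setIT //; exact: measurable_annulus.
apply: le_Rintegral => //.
- by apply: bounded_integrable; exact: (bounded_measurable_mul bk bk).
- by apply: bounded_integrable; apply: bounded_measurable_indic; exact: measurable_annulus.
Qed.

End metric_measure_space.

Lemma near_all_seq (U : eqType) (T : Type) (F : set_system T) (FF : Filter F)
    (s : seq U) (P : U -> T -> Prop) :
  (forall z, z \in s -> \forall n \near F, P z n) ->
  \forall n \near F, forall z, z \in s -> P z n.
Proof.
elim: s => [|a s IH] H; first exact: filterE.
have Ha := H a (mem_head _ _).
have Hs : \forall n \near F, forall z, z \in s -> P z n.
  by apply: IH => z zs; apply: H; rewrite inE zs orbT.
apply: filterS2 Ha Hs => n Pa Ps z; rewrite inE => /predU1P[-> //|]; exact: Ps.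
Qed.

(** * Ball integrals under weak convergence *)

Section integral_bounds.
Context d (T : measurableType d) (R : realType).
Variable mu : {finite_measure set T -> \bar R}.

Lemma bounded_measurableB (k1 k2 : T -> R) : bounded_measurable k1 ->
  bounded_measurable k2 -> bounded_measurable (fun x => k1 x - k2 x).
Proof.
move=> [m1 [C1 H1]] [m2 [C2 H2]]; split; first exact: measurable_funB.
by exists (C1 + C2) => x; apply: le_trans (ler_normB _ _) (lerD _ _).
Qed.

Lemma Rintegral_dist_le (k1 k2 g : T -> R) : bounded_measurable k1 ->
  bounded_measurable k2 -> bounded_measurable g ->
  (forall x, `|k1 x - k2 x| <= g x) ->
  `|\int[mu]_x k1 x - \int[mu]_x k2 x| <= \int[mu]_x g x.
Proof.
move=> b1 b2 bg kg; rewrite -RintegralB //; try exact: bounded_integrable.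
have bi := bounded_integrable mu (bounded_measurableB b1 b2).
apply: le_trans (le_normr_Rintegral measurableT bi) _.
apply: le_Rintegral => //; first exact: integrable_norm.
exact: bounded_integrable.
Qed.

Lemma Rintegral_dist_le_cst (k1 k2 : T -> R) C : bounded_measurable k1 ->
  bounded_measurable k2 -> (forall x, `|k1 x - k2 x| <= C) ->
  `|\int[mu]_x k1 x - \int[mu]_x k2 x| <= C * fine (mu setT).
Proof.
move=> b1 b2 kC; rewrite -(Rintegral_cst mu measurableT C).
by apply: Rintegral_dist_le => //; exact: bounded_measurable_cst.
Qed.

End integral_bounds.

Section cutoff.
Context (R : realType).

(** Equal to 1 up to [a], to 0 from [a + h] on, and affine in between. *)
Definition cutoff (h a t : R) : R := Num.min 1 (Num.max 0 ((a + h - t) / h)).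

Lemma cutoff_ge0 h a t : 0 <= cutoff h a t.
Proof. by rewrite /cutoff le_min ler01 le_max lexx. Qed.

Lemma cutoff_le1 h a t : cutoff h a t <= 1.
Proof. by rewrite /cutoff ge_min lexx. Qed.

Lemma cutoff1 h a t : 0 < h -> t <= a -> cutoff h a t = 1.
Proof.
move=> h0 ta; have H : 1 <= (a + h - t) / h by rewrite ler_pdivlMr //; lra.
by rewrite /cutoff; apply/min_idPl; rewrite le_max H orbT.
Qed.

Lemma cutoff0 h a t : 0 < h -> a + h <= t -> cutoff h a t = 0.
Proof.
move=> h0 ta; have H : (a + h - t) / h <= 0 by rewrite pmulr_lle0 ?invr_gt0 //; lra.
by rewrite /cutoff (max_idPl H); apply/min_idPr.
Qed.

Lemma cutoff_homo h a b t : 0 < h -> a <= b -> cutoff h a t <= cutoff h b t.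
Proof.
move=> h0 ab; have H : (a + h - t) / h <= (b + h - t) / h.
  by rewrite ler_pM2r ?invr_gt0 //; lra.
rewrite /cutoff le_min ge_min lexx /= ge_min; apply/orP; right.
by rewrite ge_max !le_max lexx H orbT.
Qed.

Lemma cutoff_lipschitz h a t t' : 0 < h ->
  `|cutoff h a t - cutoff h a t'| <= `|t - t'| / h.
Proof.
move=> h0; have -> : `|t - t'| / h = `|(a + h - t) / h - (a + h - t') / h|.
  rewrite -mulrBl normrM (gtr0_norm (_ : 0 < h^-1)) ?invr_gt0 //.
  by rewrite distrC; congr (`|_| * _); lra.
rewrite /cutoff; move: (_ / h) (_ / h) => u v.
have H1 := ler_norm (u - v); have H2 := ler_norm (v - u).
rewrite distrC in H1; move: H1 H2; move: `|v - u| => N H1 H2.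
rewrite ler_norml !minEle !maxEle.
by case: (leP 0 u) => ?; case: (leP 0 v) => ?; rewrite ?ler10 /=;
  case: (leP 1 u) => ?; case: (leP 1 v) => ?; rewrite ?ler10 /=; lra.
Qed.

(* The error of replacing a sharp ball by the cutoff, when the distances are
   only known up to [h]. *)
Lemma cutoff_indic (h r s t : R) : 0 < h -> `|t - s| < h ->
  `|(s < r)%R%:R - cutoff h r t| <= cutoff h (r + h) t - cutoff h (r - 2 * h) t.
Proof.
move=> h0; rewrite ltr_norml => /andP[ts1 ts2].
have ge0 : 0 <= cutoff h (r + h) t - cutoff h (r - 2 * h) t.
  by rewrite subr_ge0 cutoff_homo //; lra.
have [tr|tr] := leP t (r - h).
  rewrite (cutoff1 (a := r)) //; last lra.
  by rewrite (_ : s < r) ?subrr ?normr0 //; lra.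
have [tr'|tr'] := leP (r + h) t.
  rewrite (cutoff0 (a := r)) // subr0.
  by rewrite (_ : s < r = false) ?normr0 //; apply/negbTE; rewrite -leNgt; lra.
rewrite (cutoff1 (a := r + h)) //; last lra.
rewrite (cutoff0 (a := r - 2 * h)) //; last lra.
have := cutoff_ge0 h r t; have := cutoff_le1 h r t.
by rewrite subr0 ler_norml; case: (s < r); rewrite /=; lra.
Qed.

Lemma cutoff_annulus h r t : 0 < h ->
  cutoff h (r + h) t - cutoff h (r - 2 * h) t <=
  (r - 2 * h <= t < r + 2 * h)%R%:R.
Proof.
move=> h0; have := cutoff_ge0 h (r - 2 * h) t; have := cutoff_le1 h (r + h) t.
have [tr|tr] := ltP t (r - 2 * h).
  by rewrite !cutoff1 //=; lra.
have [tr'|tr'] := ltP t (r + 2 * h) => /=; first lra.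
by rewrite (cutoff0 (a := r + h)) //; lra.
Qed.

End cutoff.

Section cutoff_integrals.
Context (R : realType) (X : mmSpace R).

Lemma cutoff_mdist_continuous h a (z : X) : 0 < h ->
  continuous (fun y : X => cutoff h a (mdist z y)).
Proof.
move=> h0; apply: unif_continuous_mm => e e0; exists (e * h).
  exact: mulr_gt0.
move=> x y xy; apply: le_trans (cutoff_lipschitz _ _ _ h0) _.
rewrite ler_pdivrMr // ltW //; apply: le_lt_trans xy.
by rewrite (metric_sym z x) (metric_sym z y) dist_mdist_le.
Qed.

End cutoff_integrals.

Section weak_convergence.
Context (R : realType) (Xn : nat -> mmSpace R) (X : mmSpace R).
Variables (sigma : nat -> R) (f : forall n, Xn n -> X).
Arguments f : clear implicits.
Hypothesis sigma_cvg : sigma n @[n --> \oo] --> (0 : R).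
Hypothesis mf : forall n, measurable_fun [set: borel (Xn n)]
  (f n : borel (Xn n) -> borel X).
Hypothesis f_dist : forall n (x y : Xn n),
  `|mdist (f n x) (f n y) - mdist x y| < sigma n.
Hypothesis f_weak : weak_cvg
  (fun n => pushforward (mm_measure (Xn n)) (f n : borel (Xn n) -> borel X))
  (mm_measure X).

Local Notation mu := (mm_measure X).
Local Notation M := (fine (mu setT)).
Local Notation mun n := (mm_measure (Xn n)).

Lemma comp_bounded_measurable n (phi : borel X -> R) : bounded_measurable phi ->
  bounded_measurable (fun x : borel (Xn n) => phi (f n x)).
Proof.
move=> [mphi [C HC]]; split; last by exists C => x.
exact: (measurableT_comp mphi (@mf n)).
Qed.

Lemma continuous_comp_bounded n (phi : X -> R) : continuous phi ->
  bounded_measurable (fun x : borel (Xn n) => phi (f n x)).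
Proof.
by move=> cphi; apply: comp_bounded_measurable; exact: mm_bounded_measurable.
Qed.

Lemma weak_Rintegral_cvg (phi : X -> R) : continuous phi ->
  \int[mun n]_x phi (f n x) @[n --> \oo] --> \int[mu]_x phi x.
Proof.
move=> cphi; have [C HC] := mm_continuous_bounded cphi.
have bphi : bounded_fun phi.
  by exists C; split; rewrite ?num_real // => N CN x _; apply: le_trans (HC x) (ltW CN).
have H := f_weak cphi bphi.
apply: fine_cvg; rewrite fineK; last first.
  apply: integrable_fin_num => //; apply: bounded_integrable.
  exact: mm_bounded_measurable.
apply: cvg_trans H; apply: near_eq_cvg; apply: nearW => n.
rewrite integral_pushforward //.
- apply/measurable_EFinP; exact: mm_continuous_measurable.
- by apply: bounded_integrable; exact: continuous_comp_bounded.
Qed.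

Lemma near_mass_le : \forall n \near \oo, fine (mun n setT) <= M + 1.
Proof.
have := @weak_Rintegral_cvg (cst 1) (@cst_continuous _ _ _).
move=> /cvgrPdist_le/(_ _ ltr01); apply: filterS => n.
rewrite /= !Rintegral_cst // !mul1r ler_norml; lra.
Qed.

(** Weak convergence gives the estimate for each [z] of a finite net; the Lipschitz dependence on
    [z] makes it uniform. *)
Lemma cutoff_integral_cvg (psi : X -> R) h a eta : continuous psi -> 0 < h ->
  0 < eta -> \forall n \near \oo, forall z : X,
  `|\int[mun n]_y (cutoff h a (mdist z (f n y)) * psi (f n y)) -
    \int[mu]_y (cutoff h a (mdist z y) * psi y)| <= eta.
Proof.
move=> cpsi h0 eta0; have [N HN] := mm_continuous_bounded cpsi.
have N0 : 0 <= N by exact: le_trans (normr_ge0 _) (HN point).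
have M0 : 0 <= M by exact: fine_ge0.
(* Moving [z] by [D] changes the integrals by at most [D / h * N * (M + 1) <= eta / 4], where
   [M + 1] bounds the mass of [X_n] for large [n]. *)
pose D := h * eta / (4 * (N + 1) * (M + 1)).
have D0 : 0 < D by rewrite divr_gt0 // mulr_gt0 //; lra.
have [s Hs] := finite_net X D0.
have cH z : continuous (fun y : X => cutoff h a (mdist z y) * psi y).
  by move=> y; apply: cvgM; [exact: cutoff_mdist_continuous|exact: cpsi].
have bX z := mm_bounded_measurable (cH z).
have bn n z := continuous_comp_bounded n (cH z).
have near_s : \forall n \near \oo, forall z, z \in s ->
    `|\int[mun n]_y (cutoff h a (mdist z (f n y)) * psi (f n y)) -
      \int[mu]_y (cutoff h a (mdist z y) * psi y)| <= eta / 4.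
  apply: near_all_seq => z _.
  have := weak_Rintegral_cvg (cH z); move=> /cvgrPdist_le/(_ (eta / 4)) H.
  have {}H := H ltac:(lra); apply: filterS H => n /=.
  by rewrite distrC.
apply: filterS2 near_s near_mass_le => n Hsn Hn z.
have [z0 z0s z0z] := Hs z.
have lip y : `|cutoff h a (mdist z y) * psi y - cutoff h a (mdist z0 y) * psi y|
    <= D / h * N.
  rewrite -mulrBl normrM ler_pM //.
  apply: le_trans (cutoff_lipschitz _ _ _ h0) _.
  rewrite ler_wpM2r ?invr_ge0 ?(ltW h0) //.
  by rewrite distrC (le_trans (dist_mdist_le _ _ _)) // ltW.
have H1 := Rintegral_dist_le_cst (mun n) (bn n z) (bn n z0) (fun y => lip (f n y)).
have H2 := Rintegral_dist_le_cst mu (bX z) (bX z0) lip.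
have H3 := Hsn _ z0s.
have E : D / h * N * (M + 1) <= eta / 4.
  rewrite /D (_ : _ * N * _ = eta / 4 * (N / (N + 1))); last first.
    by field; rewrite !lt0r_neq0 //; lra.
  by rewrite ler_piMr //; [lra|rewrite ler_pdivrMr //; lra].
have DN : 0 <= D / h * N by rewrite mulr_ge0 // divr_ge0 // ltW.
have E1 : D / h * N * fine (mun n setT) <= D / h * N * (M + 1).
  by rewrite ler_wpM2l.
have E2 : D / h * N * M <= D / h * N * (M + 1) by rewrite ler_wpM2l //; lra.
move: H1 H2 H3; rewrite !ler_norml; lra.
Qed.

Section neighbourhood_convergence.
Variable rho : R.
Hypothesis small_annuli : forall eta, 0 < eta -> exists h,
  [/\ 0 < h, h < rho & forall z, fine (mu (annulus rho h z)) <= eta].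

(** Indicators are not continuous, and balls of [X_n] are not preimages of balls of [X]. Both
    integrals are therefore compared with one continuous cutoff. The error [g] is again a difference
    of cutoffs, so its integral over [X_n] is controlled by that over [X], hence by a thin
    annulus. *)
Lemma nbh_integral_comp_cvg (psi : X -> R) eta : continuous psi -> 0 < eta ->
  \forall n \near \oo, forall x : Xn n,
  `|nbh_integral (mun n) (mm_ball rho) (fun y => psi (f n y)) x -
    nbh_integral mu (mm_ball rho) psi (f n x)| <= eta.
Proof.
move=> cpsi eta0; have [N HN] := mm_continuous_bounded cpsi.
have N0 : 0 <= N by exact: le_trans (normr_ge0 _) (HN point).
pose eta' := eta / (8 * (N + 1)).
have eta'0 : 0 < eta' by rewrite divr_gt0 //; lra.
have [h2 [h20 h2rho Hann]] := small_annuli eta'0.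
(* The cutoff error is supported where the distance is within [2 * h] of [rho], see
   [cutoff_annulus]. *)
pose h := h2 / 2; have h0 : 0 < h by rewrite /h; lra.
have c1 : continuous (cst 1 : X -> R) by exact: cst_continuous.
have U0 := cutoff_integral_cvg rho cpsi h0 eta'0.
have U1 := cutoff_integral_cvg (rho + h) c1 h0 eta'0.
have U2 := cutoff_integral_cvg (rho - 2 * h) c1 h0 eta'0.
have Us : \forall n \near \oo, sigma n <= h.
  by apply: filterS (cvgr_le _ sigma_cvg _ h0).
apply: filterS2 (filterI U0 (filterI U1 U2)) Us => n [{}U0 [{}U1 {}U2]] sh x.
pose z := f n x.
have iB (Y : mmSpace R) (x' y : borel Y) : \1_(mm_ball rho x') y =
    (mdist (x' : Y) y < rho)%R%:R :> R.
  rewrite indicE (_ : (y \in _) = (mdist (x' : Y) y < rho)) //.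
  by apply/idP/idP; rewrite inE mm_ballE.
have bB (Y : mmSpace R) (x' : borel Y) : bounded_measurable (\1_(mm_ball rho x') : borel Y -> R).
  by apply: bounded_measurable_indic; exact: measurable_mm_ball.
have bc a : bounded_measurable (fun y : borel X => cutoff h a (mdist z y)).
  by apply: mm_bounded_measurable; exact: cutoff_mdist_continuous.
have bpsi := mm_bounded_measurable cpsi.
pose g (y : borel X) := N * (cutoff h (rho + h) (mdist z y) -
  cutoff h (rho - 2 * h) (mdist z y)).
have bg : bounded_measurable g.
  apply: bounded_measurable_mul; first exact: bounded_measurable_cst.
  by apply: bounded_measurableB.
have bound (t s : R) (y : X) : `|t - s| < h -> t = mdist z y ->
    `|(s < rho)%R%:R * psi y - cutoff h rho t * psi y| <= g y.
  move=> ts tE; rewrite -mulrBl normrM mulrC ler_pM //.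
  by rewrite /g -tE; exact: cutoff_indic.
have H1 : `|\int[mun n]_y (\1_(mm_ball rho x) y * psi (f n y)) -
    \int[mun n]_y (cutoff h rho (mdist z (f n y)) * psi (f n y))| <=
    \int[mun n]_y g (f n y).
  apply: Rintegral_dist_le.
  - by apply: bounded_measurable_mul (bB _ _) _; exact: comp_bounded_measurable.
  - apply: bounded_measurable_mul; last exact: comp_bounded_measurable.
    exact: (comp_bounded_measurable n (bc rho)).
  - exact: (comp_bounded_measurable n bg).
  - move=> y; rewrite iB; apply: (bound (mdist z (f n y))) => //.
    by apply: lt_le_trans sh; exact: f_dist.
have H2 : `|\int[mu]_y (\1_(mm_ball rho (z : borel X)) y * psi y) -
    \int[mu]_y (cutoff h rho (mdist z y) * psi y)| <= \int[mu]_y g y.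
  apply: Rintegral_dist_le => //.
  - exact: bounded_measurable_mul (bB _ _) bpsi.
  - exact: bounded_measurable_mul (bc rho) bpsi.
  - by move=> y; rewrite iB; apply: (bound (mdist z y)) => //; rewrite subrr normr0.
have gE : \int[mu]_y g y = N * (\int[mu]_y (cutoff h (rho + h) (mdist z y) * cst 1 y) -
    \int[mu]_y (cutoff h (rho - 2 * h) (mdist z y) * cst 1 y)).
  under [X in _ * (X - _)]eq_Rintegral do rewrite mulr1.
  under [X in _ * (_ - X)]eq_Rintegral do rewrite mulr1.
  rewrite -RintegralB //; try exact: bounded_integrable.
  by rewrite -RintegralZl //; apply: bounded_integrable; exact: bounded_measurableB.
have gnE : \int[mun n]_y g (f n y) = N *
    (\int[mun n]_y (cutoff h (rho + h) (mdist z (f n y)) * cst 1 (f n y)) -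
    \int[mun n]_y (cutoff h (rho - 2 * h) (mdist z (f n y)) * cst 1 (f n y))).
  under [X in _ * (X - _)]eq_Rintegral do rewrite mulr1.
  under [X in _ * (_ - X)]eq_Rintegral do rewrite mulr1.
  have bn a := bounded_integrable (mun n) (comp_bounded_measurable n (bc a)).
  rewrite -RintegralB //; try exact: bn.
  rewrite -RintegralZl //; apply: bounded_integrable.
  by apply: bounded_measurableB; exact: (comp_bounded_measurable n (bc _)).
have Hg : \int[mu]_y (cutoff h (rho + h) (mdist z y) * cst 1 y) -
    \int[mu]_y (cutoff h (rho - 2 * h) (mdist z y) * cst 1 y) <= eta'.
  under [X in X - _ <= _]eq_Rintegral do rewrite mulr1.
  under [X in _ - X <= _]eq_Rintegral do rewrite mulr1.
  rewrite -RintegralB //; try exact: bounded_integrable.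
  apply: le_trans (Hann z).
  have -> : fine (mu (annulus rho h2 z)) = \int[mu]_y (\1_(annulus rho h2 z) y).
    by rewrite /Rintegral integral_indic ?setIT //; exact: measurable_annulus.
  apply: le_Rintegral => //.
  - by apply: bounded_integrable; exact: bounded_measurableB.
  - apply: bounded_integrable; apply: bounded_measurable_indic.
    exact: measurable_annulus.
  move=> y _; apply: le_trans (cutoff_annulus rho _ h0) _.
  rewrite indicE (_ : (y \in _) = (rho - h2 <= mdist z y < rho + h2)).
    by rewrite /h (_ : 2 * (h2 / 2) = h2) //; field.
  by apply/idP/idP; rewrite inE.
rewrite !nbh_integralE.
have := U0 z; have := U1 z; have := U2 z.
move: H1 H2; rewrite gE gnE; move: Hg.
set a1 := \int[mu]_y (cutoff h (rho + h) (mdist z y) * _).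
set a2 := \int[mu]_y (cutoff h (rho - 2 * h) (mdist z y) * _).
set b1 := \int[mun n]_y (cutoff h (rho + h) (mdist z (f n y)) * _).
set b2 := \int[mun n]_y (cutoff h (rho - 2 * h) (mdist z (f n y)) * _).
move=> Hg H1 H2; rewrite !ler_norml => /andP[? ?] /andP[? ?] ?.
have E1 : N * (a1 - a2) <= N * eta' by rewrite ler_wpM2l.
have E2 : N * (b1 - b2) <= N * (3 * eta') by rewrite ler_wpM2l //; lra.
have E3 : (N + 1) * eta' = eta / 8 by rewrite /eta'; field; apply: lt0r_neq0; lra.
move: H1 H2; rewrite !ler_norml -/z; lra.
Qed.

Lemma nbh_volume_comp_cvg eta : 0 < eta ->
  \forall n \near \oo, forall x : Xn n,
  `|nbh_volume (mun n) (mm_ball rho) x - nbh_volume mu (mm_ball rho) (f n x)| <= eta.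
Proof.
move=> eta0; have c1 : continuous (cst 1 : X -> R) by exact: cst_continuous.
apply: filterS (nbh_integral_comp_cvg c1 eta0) => n H x.
by rewrite !nbh_volumeE; [exact: H|exact: measurable_mm_ball_rel..].
Qed.

End neighbourhood_convergence.
End weak_convergence.

Lemma quadratic_form_bound (R : realType) (m : nat) (E : 'I_m -> 'I_m -> R)
    (b : 'I_m -> R) (h : R) : (forall i j, `|E i j| <= h) ->
  `|\sum_(i < m) \sum_(j < m) b i * b j * E i j| <=
  h * m%:R * \sum_(i < m) b i ^+ 2.
Proof.
move=> Eh; apply: le_trans (ler_norm_sum _ _ _) _.
apply: (@le_trans _ _ (\sum_(i < m) \sum_(j < m) h / 2 * (b i ^+ 2 + b j ^+ 2))).
  apply: ler_sum => i _; apply: le_trans (ler_norm_sum _ _ _) _.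
  apply: ler_sum => j _.
  have h0 : 0 <= h by exact: le_trans (normr_ge0 _) (Eh i j).
  rewrite normrM.
  have H : `|b i * b j| <= (b i ^+ 2 + b j ^+ 2) / 2.
    have := sqr_ge0 (b i - b j); have := sqr_ge0 (b i + b j).
    rewrite ler_norml; nra.
  apply: (@le_trans _ _ ((b i ^+ 2 + b j ^+ 2) / 2 * h)).
    by apply: ler_pM.
  by rewrite le_eqVlt; apply/orP; left; apply/eqP; field.
under eq_bigr => i _ do rewrite -mulr_sumr big_split /= sumr_const card_ord.
rewrite -mulr_sumr big_split /= sumr_const card_ord.
under [X in _ * (X + _)]eq_bigr do rewrite -mulr_natr.
rewrite -mulr_suml -mulr_natr le_eqVlt; apply/orP; left; apply/eqP; by field.
Qed.

(** Bessel's inequality for an almost orthonormal family, by expanding the square of [u] minus its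
    approximate projection; the defect of the Gram matrix costs the term [h * m%:R]. *)
Lemma near_bessel (R : realType) (E : lmodType R) (ip : E -> E -> R)
    (ipP : semi_inner_product ip) (m : nat) (g : 'I_m -> E) (h : R) (u : E) :
  (forall i j, `|ip (g i) (g j) - (i == j)%:R| <= h) ->
  (1 - h * m%:R) * \sum_(i < m) ip (g i) u ^+ 2 <= ip u u.
Proof.
move=> gh; pose b i := ip (g i) u.
have := sip_ge0 ipP (u - \sum_(i < m) b i *: g i).
rewrite (qB ipP) (ip_sumr ipP) (ip_suml ipP).
have -> : \sum_(i < m) ip u (b i *: g i) = \sum_(i < m) b i ^+ 2.
  by apply: eq_bigr => i _; rewrite (ipZr ipP) (sipC ipP).
have -> : \sum_(i < m) ip (b i *: g i) (\sum_(j < m) b j *: g j) =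
    \sum_(i < m) b i ^+ 2 +
    \sum_(i < m) \sum_(j < m) b i * b j * (ip (g i) (g j) - (i == j)%:R).
  rewrite -big_split /=; apply: eq_bigr => i _.
  rewrite (ip_sumr ipP).
  under [X in _ = _ + X]eq_bigr do rewrite mulrBr.
  have -> : \sum_(j < m) (b i * b j * ip (g i) (g j) - b i * b j * (i == j)%:R) =
      \sum_(j < m) b i * b j * ip (g i) (g j) - b i ^+ 2.
    rewrite sumrB; congr (_ - _); rewrite (bigD1 i) //= eqxx mulr1 expr2.
    by rewrite big1 ?addr0 // => j ji; rewrite eq_sym (negbTE ji) mulr0.
  rewrite addrC subrK; apply: eq_bigr => j _.
  by rewrite (sipZ ipP) (ipZr ipP) mulrA.
have := quadratic_form_bound b gh; rewrite ler_norml /b; lra.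
Qed.

(** * Approximation of the kernel by eigenfunctions *)

Section smooth_decomposition.
Context (R : realType) (E : lmodType R) (ip : E -> E -> R) (A : E -> E).
Hypothesis ipP : semi_inner_product ip.
Hypothesis AP : hilbert_schmidt ip A.

(* Replacing eigenvectors by their images makes them regular. *)
Lemma ed_smooth eps m e al : 0 <= eps -> eigen_decomposition ip A eps m e al ->
  (forall i, (i < m)%N -> ip ((al i)^-1 *: A (e i) - e i)
    ((al i)^-1 *: A (e i) - e i) = 0) /\
  eigen_decomposition ip A eps m (fun i => (al i)^-1 *: A (e i)) al.
Proof.
move=> eps0 eD.
have al0 i : (i < m)%N -> al i != 0.
  move=> im; rewrite -sqrf_eq0 gt_eqF //.
  exact: le_lt_trans eps0 (ed_gt eD im).
have N i : (i < m)%N -> ip ((al i)^-1 *: A (e i) - e i)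
    ((al i)^-1 *: A (e i) - e i) = 0.
  move=> im; have -> : (al i)^-1 *: A (e i) - e i =
      (al i)^-1 *: (A (e i) - al i *: e i).
    by rewrite scalerBr scalerA mulVf ?al0 // scale1r.
  by rewrite (qZ ipP) (ed_eig eD) // mulr0.
split=> //; split.
- move=> i j im jm; rewrite (nullB_ip ipP _ (N i im)) (sipC ipP).
  by rewrite (nullB_ip ipP _ (N j jm)) (sipC ipP) (ed_orth eD).
- move=> i im; set e' := _ *: _.
  have -> : A e' - al i *: e' = (A (e' - e i) - al i *: (e' - e i)) +
      (A (e i) - al i *: e i).
    rewrite (hsB AP) scalerBr; move: (A e') (A (e i)) (_ *: e') (_ *: e i).
    move=> v1 v2 v3 v4; have -> : v1 - v2 - (v3 - v4) = v1 - v3 - (v2 - v4).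
      by rewrite !opprD !opprK addrACA.
    by rewrite subrK.
  apply: (nullD ipP); last exact: (ed_eig eD).
  rewrite -scaleNr; apply: (nullD ipP).
    by apply: (null_hs ipP AP); exact: N.
  by rewrite (qZ ipP) N // mulr0.
- exact: ed_gt eD.
- move=> u ue; apply: (ed_perp eD) => i im.
  by rewrite (sipC ipP) -(nullB_ip ipP _ (N i im)) (sipC ipP) ue.
Qed.

End smooth_decomposition.

Section no_large_eigenspace.
Context d (T : measurableType d) (R : realType).
Variables (mu : {finite_measure set T -> \bar R}) (B : T -> set T).
Local Notation L2 := (LfunType mu (lee1n 2)).
Local Notation J := (nbh_integral mu B).
Local Notation vol := (nbh_volume mu B).
Local Notation M := (fine (mu setT)).
Hypothesis mB : measurable [set z : T * T | B z.1 z.2].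
Hypothesis Bsym : forall x y, B x y -> B y x.
Variable c : R.
Hypothesis c0 : 0 < c.
Hypothesis vol_ge : forall x, c <= vol x.
Local Notation A := (avg_op mB c0 vol_ge).
Local Notation ip := (@ipw _ _ _ mu vol).

Let ipP : semi_inner_product ip := vol_sip mB c0 vol_ge.

(* If the kernel of [J] is approximated by [\sum_i al i * phi i x * phi i y],
   then a space on which [J] is at least [a * vol] contains a vector orthogonal
   to the [phi i] with [a' <= al i]; on that vector [J] is too small. *)
Lemma approx_kernel_eigenspace (m k : nat) (al : 'I_m -> R)
    (g : 'I_m -> L2) (w : T -> R) (bw : bounded_measurable w)
    (D h h' kap a a' : R) (U : 'I_k -> L2) (be : 'I_k -> R) :
  (forall x, 0 <= w x) ->
  (forall x, \int[mu]_y ((\1_(B x) y - \sum_(i < m)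
    al i * (w x * g i x) * (w y * g i y)) ^+ 2) <= D) ->
  (forall i, bounded_measurable (g i)) ->
  (forall i j, `|ipw w (g i) (g j) - (i == j)%:R| <= h) -> h * m%:R < 1 ->
  (forall x, w x <= (1 + h') * vol x) ->
  (forall i j, ip (U i) (U j) = (i == j)%:R) ->
  (forall i, ip (A (U i) - be i *: U i) (A (U i) - be i *: U i) = 0) ->
  (forall i, a <= be i) ->
  (#|[pred i | (a' <= al i)%R]| < k)%N -> 0 <= a' ->
  0 <= kap -> M * D <= kap ^+ 2 ->
  a <= kap / c + a' * (1 + h') / (1 - h * m%:R).
Proof.
move=> w0 HD bg gG hm wV UO UE be_a mk a'0 kap0 MD.
have wP := ipw_semi_inner_product mu bw w0.
have [x [l xl] xE] := ex_kernel (fun l i => ipw w (g i) (U l)) mk.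
pose u : L2 := \sum_(l < k) x l *: U l.
pose b i := ipw w (g i) u.
have b0 i : a' <= al i -> b i = 0.
  move=> ai; rewrite /b (ip_sumr wP) -[RHS](xE i) //.
  by apply: eq_bigr => l' _; rewrite (ipZr wP).
have ipUu i : ip (U i) u = x i.
  rewrite (ip_sumr ipP) (bigD1 i) //= (ipZr ipP) UO eqxx mulr1 big1 ?addr0 //.
  by move=> j ji; rewrite (ipZr ipP) UO eq_sym (negbTE ji) mulr0.
have qu : ip u u = \sum_(l < k) x l ^+ 2.
  rewrite {1}/u (ip_suml ipP); apply: eq_bigr => i _.
  by rewrite (sipZ ipP) ipUu expr2.
have qu0 : 0 < ip u u.
  rewrite qu (bigD1 l) //= ltr_pwDl ?exprn_even_gt0 //=.
  by apply: sumr_ge0 => i _; exact: sqr_ge0.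
have AP := avg_op_hilbert_schmidt mB Bsym c0 vol_ge.
have Au : ip (A u) u = \sum_(l < k) be l * x l ^+ 2.
  have -> : A u = \sum_(l < k) x l *: A (U l).
    rewrite /u; elim/big_rec2 : _ => [|i y z _ <-]; first exact: hs0 AP.
    by rewrite (hs_linear AP).
  rewrite (ip_suml ipP); apply: eq_bigr => i _.
  by rewrite (sipZ ipP) (nullB_ip ipP _ (UE i)) (sipZ ipP) ipUu; ring.
have au : a * ip u u <= ip (A u) u.
  rewrite Au qu mulr_sumr; apply: ler_sum => i _.
  by rewrite ler_wpM2r ?sqr_ge0.
pose I2 := \int[mu]_y (u y ^+ 2).
have I20 : 0 <= I2 by apply: Rintegral_ge0 => y _; exact: sqr_ge0.
have I2c : I2 <= c^-1 * ip u u by exact: norm_le_q.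
pose G x y := \sum_(i < m) al i * (w x * g i x) * (w y * g i y).
have bwg i : bounded_measurable (fun y => w y * g i y).
  exact: bounded_measurable_mul.
have bG z : bounded_measurable (fun y => \1_(B z) y - G z y).
  split.
    apply: measurable_funB; first by apply: measurable_indic; exact: measurable_nbh.
    apply: measurable_sum => i; apply: measurable_funM => //.
    exact: (bwg i).1.
  have /choice[C HC] : forall i, exists C, forall y, `|w y * g i y| <= C.
    by move=> i; exact: (bwg i).2.
  exists (1 + \sum_(i < m) `|al i * (w z * g i z)| * C i) => y.
  apply: le_trans (ler_normB _ _) _; apply: lerD.
    by rewrite indicE; case: (_ \in _); rewrite ?normr1 ?normr0.
  apply: le_trans (ler_norm_sum _ _ _) _; apply: ler_sum => i _.
  by rewrite normrM ler_wpM2l.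
have bE i : \int[mu]_y ((w y * g i y) * u y) = b i.
  by apply: eq_Rintegral => y _; rewrite mulrA.
(* The error of the finite-rank approximation of [J u]; Cauchy-Schwarz on each row of the kernel
   gives [Q z ^+ 2 <= D * I2]. *)
pose Q x := J u x - \sum_(i < m) al i * (w x * g i x) * b i.
have QE z : Q z = \int[mu]_y ((\1_(B z) y - G z y) * u y).
  have i1 : mu.-integrable setT (EFin \o (fun y => \1_(B z) y * u y)).
    by apply: nbh_integrable => //; exact: L2_integrable.
  have i2 i : mu.-integrable setT (EFin \o (fun y =>
      al i * (w z * g i z) * (w y * g i y * u y))).
    apply: (integrableZl measurableT (al i * (w z * g i z)) (f := fun y => (w y * g i y * u y)%:E)).
    exact: (L2_mul_integrable (toL2 (Lfun2_bounded mu (bwg i))) u).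
  transitivity (\int[mu]_y (\1_(B z) y * u y -
      \sum_(i < m) al i * (w z * g i z) * (w y * g i y * u y))).
    rewrite RintegralB //; last by apply: integrable_sumr => i _; exact: i2.
    rewrite /Q nbh_integralE; congr (_ - _).
    rewrite Rintegral_sum //; apply: eq_bigr => i _.
    rewrite RintegralZl ?bE //.
    exact: (L2_mul_integrable (toL2 (Lfun2_bounded mu (bwg i))) u).
  apply: eq_Rintegral => y _; rewrite mulrBl mulr_suml; congr (_ - _).
  by apply: eq_bigr => i _; ring.
have QD z : Q z ^+ 2 <= D * I2.
  rewrite QE; pose Kz : L2 := toL2 (Lfun2_bounded mu (bG z)).
  apply: le_trans (L2_cauchy_schwarz Kz u) _.
  by rewrite ler_wpM2r //; exact: HD.
have bJ : bounded_measurable (J u).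
  by apply: nbh_integral_bounded => //; exact: L2_integrable.
have bQ : bounded_measurable Q.
  split.
    apply: measurable_funB; first exact: bJ.1.
    apply: measurable_sum => i; apply: measurable_funM => //.
    by apply: measurable_funM => //; exact: (bwg i).1.
  exists (Num.sqrt (D * I2)) => z.
  rewrite -(@ler_pXn2r _ 2) ?nnegrE ?sqrtr_ge0 // real_normK ?num_real //.
  by rewrite sqr_sqrtr //; apply: le_trans (QD z); exact: sqr_ge0.
pose Q2 : L2 := toL2 (Lfun2_bounded mu bQ).
have Au2 : ip (A u) u = \int[mu]_z (Q2 z * u z) + \sum_(i < m) al i * b i ^+ 2.
  rewrite ipE_avg.
  have i2 i : mu.-integrable setT (EFin \o (fun z =>
      al i * b i * (w z * g i z * u z))).
    apply: (integrableZl measurableT (al i * b i) (f := fun y => (w y * g i y * u y)%:E)).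
    exact: (L2_mul_integrable (toL2 (Lfun2_bounded mu (bwg i))) u).
  transitivity (\int[mu]_z (Q2 z * u z +
      \sum_(i < m) al i * b i * (w z * g i z * u z))).
    apply: eq_Rintegral => z _; rewrite -[Q2 z]/(Q z) /Q mulrBl mulr_suml.
    rewrite -[LHS]addr0 -addrA; congr (_ + _).
    apply/esym/eqP; rewrite addrC subr_eq0; apply/eqP; apply: eq_bigr => i _.
    by ring.
  rewrite RintegralD //; last 2 first.
  - exact: L2_mul_integrable.
  - by apply: integrable_sumr => i _; exact: i2.
  congr (_ + _); rewrite Rintegral_sum //; apply: eq_bigr => i _.
  rewrite RintegralZl ?bE; [by rewrite expr2 mulrA|by []|].
  exact: (L2_mul_integrable (toL2 (Lfun2_bounded mu (bwg i))) u).
have H1 : \int[mu]_z (Q2 z * u z) <= kap * I2.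
  have := L2_cauchy_schwarz Q2 u; rewrite -/I2 => H.
  have HQ : \int[mu]_z (Q2 z ^+ 2) <= kap ^+ 2 * I2.
    apply: (@le_trans _ _ (\int[mu]_(z in setT) (D * I2))).
      apply: le_Rintegral => //.
      - by apply: bounded_integrable; exact: (bounded_measurable_mul bQ bQ).
      - exact: finite_measure_integrable_cst.
    by rewrite Rintegral_cst // mulrAC [D * _]mulrC ler_wpM2r.
  have {}H : (\int[mu]_z (Q2 z * u z)) ^+ 2 <= (kap * I2) ^+ 2.
    apply: le_trans H _; rewrite exprMn [in leRHS]expr2 [I2 ^+ 2]expr2 mulrA.
    by rewrite ler_wpM2r // -expr2.
  have k0 : 0 <= kap * I2 by exact: mulr_ge0.
  rewrite leNgt; apply/negP => lt.
  by move: H; rewrite leNgt ltr_pXn2r ?lt // nnegrE // (le_trans k0) // ltW.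
have H2 : \sum_(i < m) al i * b i ^+ 2 <= a' * \sum_(i < m) b i ^+ 2.
  rewrite mulr_sumr; apply: ler_sum => i _.
  have [ai|/ltW ai] := leP a' (al i); first by rewrite b0 // expr0n !mulr0.
  by rewrite ler_wpM2r // sqr_ge0.
have H3 := near_bessel wP u gG; rewrite -/b in H3.
have H4 : ipw w u u <= (1 + h') * ip u u.
  rewrite -[leLHS]mul1r; apply: ipw_le => //; first exact: vol_bounded.
  by move=> z; rewrite mul1r.
have hm0 : 0 < 1 - h * m%:R by rewrite subr_gt0.
have H5 : \sum_(i < m) b i ^+ 2 <= (1 + h') / (1 - h * m%:R) * ip u u.
  by rewrite mulrAC ler_pdivlMr // mulrC (le_trans H3).
have H6 : a' * \sum_(i < m) b i ^+ 2 <=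
    a' * ((1 + h') / (1 - h * m%:R) * ip u u) by rewrite ler_wpM2l.
have H7 : kap * I2 <= kap * (c^-1 * ip u u) by rewrite ler_wpM2l.
rewrite -(ler_pM2r qu0) mulrDl -!mulrA; rewrite Au2 in au.
rewrite -!mulrA in H6 H7 *.
apply: (le_trans au); apply: lerD; first exact: le_trans H1 H7.
exact: le_trans H2 H6.
Qed.

End no_large_eigenspace.

Section kernel_residual.
Context d (T : measurableType d) (R : realType).
Variables (mu : {finite_measure set T -> \bar R}) (B : T -> set T).
Local Notation L2 := (LfunType mu (lee1n 2)).
Local Notation J := (nbh_integral mu B).
Local Notation vol := (nbh_volume mu B).
Local Notation M := (fine (mu setT)).
Hypothesis mB : measurable [set z : T * T | B z.1 z.2].
Hypothesis Bsym : forall x y, B x y -> B y x.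
Variable c : R.
Hypothesis c0 : 0 < c.
Hypothesis vol_ge : forall x, c <= vol x.
Local Notation A := (avg_op mB c0 vol_ge).
Local Notation ip := (@ipw _ _ _ mu vol).

Let ipP : semi_inner_product ip := vol_sip mB c0 vol_ge.
Let vol0 : forall x, 0 < vol x := vol_gt0 c0 vol_ge.

Section fixed_decomposition.
Variables (eps : R) (m : nat) (e : nat -> L2) (al : nat -> R).
Hypothesis eD : eigen_decomposition ip A eps m e al.

(** The projected vector is the indicator of [B z] divided by both volumes, the one that represents
    evaluation of [A] at [z]. *)
Definition kernel_residual (z : T) : L2 :=
  avg_kernel mB c0 vol_ge z - oproj ip m e (avg_kernel mB c0 vol_ge z).

Local Notation r := kernel_residual.

Lemma kernel_residual_perp z i : (i < m)%N -> ip (r z) (e i) = 0.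
Proof. exact: (ip_oprojC ipP (ed_orth eD)). Qed.

(** The projection is orthogonal to [r z], and pairing with [avg_kernel] evaluates [A] at [z]. *)
Lemma q_kernel_residual z : ip (r z) (r z) = A (r z) z.
Proof.
rewrite -ip_avg_kernel {1}/r (ipB ipP) [X in _ - X](sipC ipP).
have -> : ip (r z) (oproj ip m e (avg_kernel mB c0 vol_ge z)) = 0.
  apply: (ip_perp_lincomb ipP (fun i => ip (avg_kernel mB c0 vol_ge z) (e i))).
  exact: kernel_residual_perp.
by rewrite subr0.
Qed.

(** The eigen-equation is needed at every point, not almost everywhere, because the coefficient of
    [e i] in the projection is the value [A (e i) z] at the fixed point [z]. *)
Lemma kernel_residualE z y : (forall i x, (i < m)%N -> A (e i) x = al i * e i x) ->
  \1_(B z) y - \sum_(i < m) al i * (vol z * e i z) * (vol y * e i y) =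
  vol z * (vol y * r z y).
Proof.
move=> eE.
have -> : r z y = (vol y)^-1 * ((vol z)^-1 * \1_(B z) y) -
    \sum_(i < m) al i * e i z * e i y.
  rewrite /r -[LHS]/(avg_kernel mB c0 vol_ge z y -
    (oproj ip m e (avg_kernel mB c0 vol_ge z)) y).
  congr (_ - _); rewrite L2_sumE; apply: eq_bigr => i _.
  rewrite -[LHS]/(ip (avg_kernel mB c0 vol_ge z) (e i) * e i y).
  by rewrite ip_avg_kernel eE.
rewrite !mulrBr; congr (_ - _).
  by field; rewrite !gt_eqF.
by rewrite !mulr_sumr; apply: eq_bigr => i _; ring.
Qed.

Lemma kernel_residual_integral z :
  (forall i x, (i < m)%N -> A (e i) x = al i * e i x) ->
  \int[mu]_y ((\1_(B z) y - \sum_(i < m)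
    al i * (vol z * e i z) * (vol y * e i y)) ^+ 2) <=
  M ^+ 3 * ip (r z) (r z).
Proof.
move=> eE; under eq_Rintegral do rewrite kernel_residualE //.
have bv := vol_bounded mu mB.
rewrite -RintegralZl //; last exact: L2_wmul_integrable.
pose vr : L2 := toL2 (Lfun2_bounded_mul bv (L2P (r z))).
apply: le_Rintegral => //.
- rewrite (_ : _ \o _ = (fun y => (vol z ^+ 2)%:E * (vr y * vr y)%:E)%E); last first.
    apply/funext => y; have vE : vr y = vol y * r z y by [].
    by rewrite /comp -EFinM vE; congr EFin; ring.
  by apply: integrableZl => //; exact: L2_mul_integrable.
- exact: (integrableZl measurableT (M ^+ 3) (L2_wmul_integrable (r z) (r z) bv)).
move=> y _; have Vz := vol_le mu mB z; have Vy := vol_le mu mB y.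
have Hz : vol z ^+ 2 <= M ^+ 2.
  by rewrite ler_pXn2r ?nnegrE ?(ltW (vol0 z)) // (le_trans (ltW (vol0 z))).
have -> : (vol z * (vol y * r z y)) ^+ 2 =
    vol z ^+ 2 * (vol y * (vol y * (r z y * r z y))) by ring.
have -> : M ^+ 3 * (vol y * (r z y * r z y)) =
    M ^+ 2 * (M * (vol y * (r z y * r z y))) by ring.
have V0 := ltW (vol0 y); have r2 : 0 <= r z y * r z y by rewrite -expr2 sqr_ge0.
apply: ler_pM => //; first by rewrite sqr_ge0.
  by do 2 apply: mulr_ge0 => //.
by apply: ler_wpM2r => //; exact: mulr_ge0.
Qed.

Lemma integral_sqr_nbh_integral (u : L2) :
  \int[mu]_x (J u x ^+ 2) <= M * ip (A u) (A u).
Proof.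
have bv := vol_bounded mu mB.
have bJ : bounded_measurable (J u).
  by apply: nbh_integral_bounded => //; exact: L2_integrable.
rewrite -RintegralZl //; last exact: L2_wmul_integrable.
apply: le_Rintegral => //.
- by apply: bounded_integrable; exact: (bounded_measurable_mul bJ bJ).
- exact: (integrableZl measurableT M (L2_wmul_integrable (A u) (A u) bv)).
move=> y _; rewrite -(vol_avg_op mB c0 vol_ge).
have -> : (vol y * A u y) ^+ 2 = vol y * (vol y * (A u y * A u y)) by ring.
rewrite ler_wpM2r ?(vol_le mu mB) //; apply: mulr_ge0; first exact: ltW.
by rewrite -expr2 sqr_ge0.
Qed.

End fixed_decomposition.
End kernel_residual.

Section metric_kernel_residual.
Context (R : realType) (X : mmSpace R).
Local Notation mu := (mm_measure X).
Local Notation M := (fine (mu setT)).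
Local Notation L2 := (LfunType mu (lee1n 2)).
Variables (rho c : R).
Local Notation J := (nbh_integral mu (mm_ball rho)).
Local Notation vol := (nbh_volume mu (mm_ball rho)).
Hypothesis rho0 : 0 < rho.
Hypothesis c0 : 0 < c.
Hypothesis vol_ge : forall x : borel X, c <= vol x.
Hypothesis small_annuli : forall eta, 0 < eta -> exists h,
  [/\ 0 < h, h < rho & forall z, fine (mu (annulus rho h z)) <= eta].
Hypothesis ball_lower : forall r, 0 < r ->
  exists2 b, 0 < b & forall x, b <= fine (mu (mm_ball r x)).
Local Notation mB := (@measurable_mm_ball_rel R X rho).
Local Notation A := (avg_op mB c0 vol_ge).
Local Notation ip := (@ipw _ _ _ mu vol).

Let ipP : semi_inner_product ip := vol_sip mB c0 vol_ge.

Lemma nbh_integral_continuous (u : L2) : continuous (J u : X -> R).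
Proof.
apply: unif_continuous_mm => e e0; pose I2 := \int[mu]_y (u y ^+ 2).
have I20 : 0 <= I2 by apply: Rintegral_ge0 => y _; exact: sqr_ge0.
have [|h [h0 hrho Hh]] := @small_annuli (e ^+ 2 / (I2 + 1)).
  by rewrite divr_gt0 ?exprn_gt0 //; lra.
exists h => // x y /ltW xy.
rewrite -(@ler_pXn2r _ 2) ?nnegrE ?(ltW e0) // real_normK ?num_real //.
apply: le_trans (mm_integral_diff rho u xy) _; rewrite -/I2.
apply: (@le_trans _ _ (e ^+ 2 / (I2 + 1) * (I2 + 1))).
  by apply: ler_pM => //; [exact: fine_ge0|lra].
by rewrite divfK // lt0r_neq0 //; lra.
Qed.

Lemma nbh_volume_continuous : continuous (vol : X -> R).
Proof.
have bc : bounded_measurable (cst 1 : borel X -> R) by exact: bounded_measurable_cst.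
rewrite (_ : vol = J (toL2 (Lfun2_bounded mu bc))).
  exact: nbh_integral_continuous.
by apply/funext => x; rewrite nbh_volumeE //; exact: mB.
Qed.

Lemma avg_op_continuous (u : L2) : continuous (A u : X -> R).
Proof.
move=> x; apply: cvgM; last exact: nbh_integral_continuous.
apply: cvgV; last exact: nbh_volume_continuous.
by rewrite gt_eqF // (lt_le_trans c0).
Qed.

(* The residual [r] satisfies [q r = A r z], and [A r] is small in the mean and
   equicontinuous, hence small at [z]. *)
Lemma kernel_residual_small eta : 0 < eta -> exists2 eps0, 0 < eps0 &
  forall eps m e al, 0 < eps -> eps <= eps0 ->
  eigen_decomposition ip A eps m e al -> forall z,
  ip (kernel_residual mB c0 vol_ge m e z) (kernel_residual mB c0 vol_ge m e z)
    <= eta.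
Proof.
move=> eta0; have M0 : 0 <= M by exact: fine_ge0.
have c30 : 0 < c ^+ 3 by rewrite exprn_gt0.
have c20 : 0 < c ^+ 2 by rewrite exprn_gt0.
(* Makes [2 * om * I2] at most [c ^+ 2 * eta / 2 * q r], which under [eta < q r] is less than half
   of the lower bound [jq]. *)
pose om := eta * c ^+ 3 / 4; have om0 : 0 < om by rewrite divr_gt0 // mulr_gt0.
have [h [h0 hrho Hh]] := small_annuli om0.
have [ch ch0 Hch] := ball_lower h0.
(* Below this threshold the bound [M * eps * q r] on the integral of [J r ^+ 2] contradicts the
   lower bound [c ^+ 2 * eta / 4 * ch * q r] coming from the ball around [z]. *)
exists (eta * c ^+ 2 * ch / (4 * (M + 1))).
  by rewrite divr_gt0 ?mulr_gt0 //; lra.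
move=> eps m e al eps0 epsle eD z.
set r := kernel_residual _ _ _ _ _ z.
rewrite leNgt; apply/negP => etaq.
have q0 : 0 < ip r r by exact: lt_trans etaq.
pose I2 := \int[mu]_y (r y ^+ 2).
have I20 : 0 <= I2 by apply: Rintegral_ge0 => y _; exact: sqr_ge0.
have I2c : I2 <= c^-1 * ip r r by exact: (norm_le_q mB c0 vol_ge r).
pose j := J r z ^+ 2.
have jq : c ^+ 2 * ip r r ^+ 2 <= j.
  rewrite /j -(vol_avg_op mB c0 vol_ge) -(q_kernel_residual eD) exprMn.
  rewrite ler_wpM2r ?sqr_ge0 // ler_pXn2r ?nnegrE ?(ltW c0) //.
  exact: le_trans (ltW c0) (vol_ge z).
have bJ : bounded_measurable (J r).
  by apply: nbh_integral_bounded; [exact: mB|exact: L2_integrable].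
have i2 : mu.-integrable setT (EFin \o (fun y => J r y ^+ 2)).
  by apply: bounded_integrable; exact: (bounded_measurable_mul bJ bJ).
have b1 : bounded_measurable (\1_(mm_ball h z) : borel X -> R).
  by apply: bounded_measurable_indic; exact: measurable_mm_ball.
pose vb := fine (mu (mm_ball h z)).
have vbE : \int[mu]_y \1_(mm_ball h z) y = vb.
  by rewrite /Rintegral integral_indic ?setIT //; exact: measurable_mm_ball.
have i1 := bounded_integrable mu b1.
(* For [y] within [h] of [z], [J r z ^+ 2] is at most [2 * J r y ^+ 2] plus twice the squared
   oscillation, which is at most [om * I2]; this is integrated over that ball. *)
have H : (j - 2 * om * I2) * vb <= 2 * \int[mu]_y (J r y ^+ 2).
  rewrite -vbE -(RintegralZl (j - 2 * om * I2) measurableT i1).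
  rewrite -(RintegralZl 2 measurableT i2).
  apply: le_Rintegral => //.
  - exact: (integrableZl measurableT (j - 2 * om * I2) i1).
  - exact: (integrableZl measurableT 2 i2).
  move=> y _; rewrite indicE; case: (boolP (y \in _)) => [|_]; last first.
    by rewrite /= mulr0; apply: mulr_ge0 => //; exact: sqr_ge0.
  rewrite inE mm_ballE => /ltW zy; rewrite /= mulr1.
  have := mm_integral_diff rho r zy; rewrite -/I2 => H.
  have H2 : fine (mu (annulus rho h z)) * I2 <= om * I2 by rewrite ler_wpM2r.
  have := sqr_ge0 (J r z - J r y - J r y); rewrite /j; nra.
have HA := integral_sqr_nbh_integral mB c0 vol_ge r.
have Heps := ed_perp eD (kernel_residual_perp eD z); rewrite -/r in Heps.
have H1 : M * ip (A r) (A r) <= M * (eps * ip r r) by rewrite ler_wpM2l.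
have H2 : ip r r * (c ^+ 2 * eta / 2) < j - 2 * om * I2.
  have E : 2 * om * I2 <= 2 * om * (c^-1 * ip r r).
    by rewrite ler_wpM2l // mulr_ge0 // ltW.
  have E2 : 2 * om * (c^-1 * ip r r) = ip r r * (c ^+ 2 * eta / 2).
    by rewrite /om; field; rewrite gt_eqF.
  have E3 : c ^+ 2 * ip r r * eta < c ^+ 2 * ip r r * ip r r.
    by rewrite ltr_pM2l // mulr_gt0.
  lra.
have H3 : ip r r * (c ^+ 2 * eta / 2) * ch <= (j - 2 * om * I2) * vb.
  apply: ler_pM => //; [|exact: ltW|exact: ltW|exact: Hch].
  by rewrite mulr_ge0 ?(ltW q0) // divr_ge0 // mulr_ge0 // ltW.
have H4 : ip r r * (c ^+ 2 * eta / 2 * ch) < ip r r * (c ^+ 2 * eta / 2 * ch).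
  have E : eps * (4 * (M + 1)) <= eta * c ^+ 2 * ch.
    by rewrite -ler_pdivlMr //; lra.
  have : ip r r * (eps * (4 * M)) < ip r r * (eta * c ^+ 2 * ch).
    by rewrite ltr_pM2l // (lt_le_trans _ E) // ltr_pM2l //; lra.
  lra.
by rewrite ltxx in H4.
Qed.

End metric_kernel_residual.

Lemma quadratic_form_near_diag (R : realType) (m : nat) (Q : 'I_m -> 'I_m -> R)
    (a b : 'I_m -> R) (h : R) :
  (forall i j, `|Q i j - a i * (i == j)%:R| <= h) ->
  `|\sum_(i < m) \sum_(j < m) b i * b j * Q i j - \sum_(i < m) a i * b i ^+ 2|
  <= h * m%:R * \sum_(i < m) b i ^+ 2.
Proof.
move=> Qh; have := quadratic_form_bound b Qh.
congr (_ <= _); congr (`|_|); rewrite -sumrB; apply: eq_bigr => i _.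
under eq_bigr do rewrite mulrBr; rewrite sumrB; congr (_ - _).
rewrite (bigD1 i) //= eqxx mulr1 big1 ?addr0; first by ring.
by move=> j ji; rewrite eq_sym (negbTE ji) !mulr0.
Qed.

Lemma ereal_cvg_squeeze (R : realType) (u : nat -> \bar R) (l : \bar R) :
  (forall s : R, (l < s%:E)%E -> \forall n \near \oo, (u n <= s%:E)%E) ->
  (forall s : R, (s%:E < l)%E -> \forall n \near \oo, (s%:E <= u n)%E) ->
  u n @[n --> \oo] --> l.
Proof.
case: l => [r||] Hu Hl.
- have H (e : R) : 0 < e ->
      \forall n \near \oo, ((r - e)%:E <= u n /\ u n <= (r + e)%:E)%E.
    move=> e0; have H1 := Hu (r + e) ltac:(by rewrite lte_fin; lra).
    have H2 := Hl (r - e) ltac:(by rewrite lte_fin; lra).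
    by apply: filterS2 H1 H2 => n.
  apply/fine_cvgP; split.
    apply: filterS (H 1 ltr01) => n [].
    by case: (u n) => [//||]; rewrite ?leye_eq ?leeNy_eq.
  apply/cvgrPdist_le => e e0; apply: filterS (H e e0) => n [] /=.
  case: (u n) => [x||]; rewrite ?leye_eq ?leeNy_eq // !lee_fin => H1 H2.
  by rewrite ler_norml /=; lra.
- apply/cvgeyPge => s; exact: Hl (ltry s).
- apply/cvgeNyPle => s; exact: Hu (ltNyr s).
Qed.

(** Reduces the square integral to volumes, ball integrals and moments of the [phi i], the
    quantities whose convergence is known. *)
Lemma nbh_square_expand d (T : measurableType d) (R : realType)
    (mu : {finite_measure set T -> \bar R}) (B : T -> set T)
    (mB : measurable [set z : T * T | B z.1 z.2])
    (m : nat) (c : 'I_m -> R) (phi : 'I_m -> T -> R) (z : T) :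
  (forall i, bounded_measurable (phi i)) ->
  \int[mu]_y ((\1_(B z) y - \sum_(i < m) c i * phi i y) ^+ 2) =
  nbh_volume mu B z - \sum_(i < m) 2 * c i * nbh_integral mu B (phi i) z +
  \sum_(i < m) \sum_(j < m) c i * c j * \int[mu]_y (phi i y * phi j y).
Proof.
move=> bphi.
have b1 : bounded_measurable (\1_(B z) : T -> R).
  by apply: bounded_measurable_indic; exact: measurable_nbh.
have i1 : mu.-integrable setT (EFin \o (fun y => \1_(B z) y * cst 1 y)).
  by apply: bounded_integrable; exact: bounded_measurable_mul (bounded_measurable_cst _ _).
have i2 i : mu.-integrable setT (EFin \o (fun y => \1_(B z) y * phi i y)).
  by apply: bounded_integrable; exact: bounded_measurable_mul.
have i2' i : mu.-integrable setT (EFin \o (fun y => 2 * c i * (\1_(B z) y * phi i y))).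
  exact: (integrableZl measurableT (2 * c i) (i2 i)).
have i3 i j : mu.-integrable setT (EFin \o (fun y => phi i y * phi j y)).
  by apply: bounded_integrable; exact: bounded_measurable_mul.
have i3' i j : mu.-integrable setT (EFin \o (fun y => c i * c j * (phi i y * phi j y))).
  exact: (integrableZl measurableT (c i * c j) (i3 i j)).
have s2 : mu.-integrable setT (EFin \o (fun y =>
    \sum_(i < m) 2 * c i * (\1_(B z) y * phi i y))).
  by apply: integrable_sumr => i _; exact: i2'.
have s3' i : mu.-integrable setT (EFin \o (fun y =>
    \sum_(j < m) c i * c j * (phi i y * phi j y))).
  by apply: integrable_sumr => j _; exact: i3'.
have s3 : mu.-integrable setT (EFin \o (fun y =>
    \sum_(i < m) \sum_(j < m) c i * c j * (phi i y * phi j y))).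
  by apply: integrable_sumr => i _; exact: s3'.
transitivity (\int[mu]_y ((\1_(B z) y * cst 1 y -
    \sum_(i < m) 2 * c i * (\1_(B z) y * phi i y)) +
    \sum_(i < m) \sum_(j < m) c i * c j * (phi i y * phi j y))).
  apply: eq_Rintegral => y _; set b := \1_(B z) y.
  have bb : b ^+ 2 = b by rewrite /b indicE; case: (_ \in _); rewrite ?expr1n ?expr0n.
  have -> : \sum_(i < m) 2 * c i * (b * phi i y) = 2 * b * \sum_(i < m) c i * phi i y.
    by rewrite mulr_sumr; apply: eq_bigr => i _; ring.
  have -> : \sum_(i < m) \sum_(j < m) c i * c j * (phi i y * phi j y) =
      (\sum_(i < m) c i * phi i y) ^+ 2.
    rewrite expr2 mulr_suml; apply: eq_bigr => i _; rewrite mulr_sumr.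
    by apply: eq_bigr => j _; ring.
  by rewrite sqrrB bb mulr1 -mulrA mulr_natl mulrC.
rewrite RintegralD //; last first.
  exact: (integrableB measurableT i1 s2).
rewrite RintegralB // !Rintegral_sum //.
rewrite nbh_volumeE // nbh_integralE; congr (_ - _ + _).
  by apply: eq_bigr => i _; rewrite RintegralZl // nbh_integralE.
apply: eq_bigr => i _; rewrite Rintegral_sum //.
by apply: eq_bigr => j _; rewrite RintegralZl.
Qed.

(** * Convergence of the eigenvalues *)

Section mm_convergence.
Context (R : realType) (Xn : nat -> mmSpace R) (X : mmSpace R).
Variables (sigma : nat -> R) (f : forall n, Xn n -> X).
Arguments f : clear implicits.
Hypothesis sigma_cvg : sigma n @[n --> \oo] --> (0 : R).
Hypothesis mf : forall n, measurable_fun [set: borel (Xn n)]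
  (f n : borel (Xn n) -> borel X).
Hypothesis f_dist : forall n (x y : Xn n),
  `|mdist (f n x) (f n y) - mdist x y| < sigma n.
Hypothesis f_weak : weak_cvg
  (fun n => pushforward (mm_measure (Xn n)) (f n : borel (Xn n) -> borel X))
  (mm_measure X).
Arguments mf : clear implicits.

Variable rho : R.
Hypothesis rho0 : 0 < rho.
Hypothesis small_annuli : forall eta, 0 < eta -> exists h,
  [/\ 0 < h, h < rho & forall z, fine (mm_measure X (annulus rho h z)) <= eta].
Hypothesis ball_lower : forall r, 0 < r ->
  exists2 b, 0 < b & forall x, b <= fine (mm_measure X (mm_ball r x)).

Local Notation mu := (mm_measure X).
Local Notation M := (fine (mu setT)).
Local Notation mun n := (mm_measure (Xn n)).
Local Notation J := (nbh_integral mu (mm_ball rho)).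
Local Notation vol := (nbh_volume mu (mm_ball rho)).
Local Notation Jn n := (nbh_integral (mun n) (mm_ball rho)).
Local Notation voln n := (nbh_volume (mun n) (mm_ball rho)).
Local Notation lam := (lambda_ mu (nbh_laplacian mu (mm_ball rho) rho)).
Local Notation lamn n :=
  (lambda_ (mun n) (nbh_laplacian (mun n) (mm_ball rho) rho)).
Local Notation mB := (@measurable_mm_ball_rel R X rho).
Local Notation mBn n := (@measurable_mm_ball_rel R (Xn n) rho).
Local Notation sB := (@mm_ball_sym R X rho).
Local Notation sBn n := (@mm_ball_sym R (Xn n) rho).
Local Notation tau := (avg_eigenvalue rho).
Local Notation comp_bm n := (continuous_comp_bounded mf n).

Let vol_cvg eta (eta0 : 0 < eta) :=
  nbh_volume_comp_cvg sigma_cvg mf f_dist f_weak small_annuli eta0.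

Lemma integral_comp_cvg (Fn : forall n, borel (Xn n) -> R) (F phi : X -> R) :
  (forall n, bounded_measurable (Fn n)) -> continuous F -> continuous phi ->
  (forall eta, 0 < eta ->
    \forall n \near \oo, forall x : Xn n, `|Fn n x - F (f n x)| <= eta) ->
  \int[mun n]_x (Fn n x * phi (f n x)) @[n --> \oo] --> \int[mu]_x (F x * phi x).
Proof.
move=> bFn cF cphi HF.
have cFphi : continuous (fun x => F x * phi x).
  by move=> x; apply: cvgM; [exact: cF|exact: cphi].
have [N HN] := mm_continuous_bounded cphi.
have N0 : 0 <= N by exact: le_trans (normr_ge0 _) (HN point).
have M0 : 0 <= M by exact: fine_ge0.
apply/cvgrPdist_le => e e0.
have H1 := weak_Rintegral_cvg mf f_weak cFphi.
move/cvgrPdist_le : H1 => /(_ (e / 2) ltac:(lra)) H1.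
have h0 : 0 < e / (2 * (N + 1) * (M + 1)).
  by rewrite divr_gt0 // !mulr_gt0 //; lra.
apply: filterS2 (filterI H1 (HF _ h0)) (near_mass_le mf f_weak) => n [{}H1 H2] Hn.
set h := e / _ in h0 H2.
have H3 : `|\int[mun n]_x (Fn n x * phi (f n x)) -
    \int[mun n]_x (F (f n x) * phi (f n x))| <= h * N * fine (mun n setT).
  apply: Rintegral_dist_le_cst.
  - exact: bounded_measurable_mul (bFn n) (comp_bm n cphi).
  - exact: (comp_bm n cFphi).
  - by move=> x; rewrite -mulrBl normrM ler_pM.
have E : h * N * (M + 1) <= e / 2.
  rewrite /h (_ : _ * N * _ = e / 2 * (N / (N + 1))); last first.
    by field; rewrite !lt0r_neq0 //; lra.
  by rewrite ler_piMr //; [lra|rewrite ler_pdivrMr //; lra].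
have E1 : h * N * fine (mun n setT) <= h * N * (M + 1).
  by rewrite ler_wpM2l // mulr_ge0 // ltW.
rewrite distrC; move: H1 H3; rewrite !ler_norml; lra.
Qed.

(** The spaces [X_n] come without a ratio hypothesis; for large [n] they inherit half of the lower
    bound on volumes, which makes the operator theory available on them. *)
Lemma near_volume_ge c : 0 < c -> (forall x : borel X, c <= vol x) ->
  \forall n \near \oo, forall x : borel (Xn n), c / 2 <= voln n x.
Proof.
move=> c0 vol_ge; have c20 : 0 < c / 2 by lra.
apply: filterS (vol_cvg c20) => n H x.
by have := H x; have := vol_ge (f n x); rewrite ler_norml; lra.
Qed.

Lemma lambda_upper k s s' : (1 <= k)%N -> s' < s -> s < rho ^- 2 ->
  (lam k < s'%:E)%E -> \forall n \near \oo, (lamn n k <= s%:E)%E.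
Proof.
move=> k1 ss srho lams; have [c c0 vol_ge] := ball_lower rho0.
have ltau : tau s < tau s' by rewrite /avg_eigenvalue ltrD2l ltrN2 ltr_pM2l ?exprn_gt0.
have taus : 0 < tau s.
  by rewrite /avg_eigenvalue subr_gt0 mulrC -ltr_pdivlMr ?exprn_gt0 // div1r.
have [u [al Hu]] := lambda_lt mB sB c0 vol_ge rho0 (lt_trans ss srho) lams.
pose A := avg_op mB c0 vol_ge.
pose ip := @ipw _ _ _ mu vol.
have ipP : semi_inner_product ip := vol_sip mB c0 vol_ge.
have AP : hilbert_schmidt ip A := avg_op_hilbert_schmidt mB sB c0 vol_ge.
have {}Hu l : [/\ forall j, ip (u l) (u j) = (l == j)%:R,
    ip (A (u l) - al l *: u l) (A (u l) - al l *: u l) = 0 & tau s' <= al l].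
  exact: Hu.
have al0 l : al l != 0.
  by have [_ _ H] := Hu l; rewrite gt_eqF // (lt_le_trans _ H) // (lt_trans taus).
(* These differ from the eigenvectors by null vectors and are continuous at every point, so
   composing them with [f n] makes sense. *)
pose g l := (al l)^-1 *: A (u l).
have gu l : ip (g l - u l) (g l - u l) = 0.
  have [_ H _] := Hu l; have -> : g l - u l = (al l)^-1 *: (A (u l) - al l *: u l).
    by rewrite scalerBr scalerA mulVf ?al0 // scale1r.
  by rewrite (qZ ipP) H mulr0.
have cg l : continuous (g l : X -> R).
  by move=> x; apply: cvgM; [exact: cvg_cst|exact: avg_op_continuous].
have gg i j : ip (g i) (g j) = (i == j)%:R.
  rewrite (nullB_ip ipP _ (gu i)) (sipC ipP) (nullB_ip ipP _ (gu j)) (sipC ipP).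
  by have [-> _ _] := Hu i.
have Agg i j : ip (A (g i)) (g j) = al i * (i == j)%:R.
  have H : ip (A (g i) - A (u i)) (A (g i) - A (u i)) = 0.
    by rewrite -(hsB AP) (null_hs ipP AP).
  rewrite (nullB_ip ipP _ H) (sipC ipP) (nullB_ip ipP _ (gu j)) (sipC ipP).
  have [uu Au _] := Hu i.
  by rewrite (nullB_ip ipP _ Au) (sipZ ipP) uu.
(* Entrywise errors [h] move the quadratic forms by at most [h * k] times the sum of squares, which
   has to fit into the gap [tau s' - tau s]; the bound by 1 yields [h * k < 1], which keeps the
   transported functions independent. *)
pose de := Num.min (tau s' - tau s) 1.
have de0 : 0 < de by rewrite lt_min subr_gt0 ltau ltr01.
have de1 : de <= 1 by rewrite ge_min lexx orbT.
have detau : de <= tau s' - tau s by rewrite ge_min lexx.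
pose h := de / ((1 + tau s) * (k%:R + 1)).
have k0 : 0 <= k%:R :> R by [].
have h0 : 0 < h by rewrite divr_gt0 ?mulr_gt0 //; lra.
have hk : (1 + tau s) * (h * k%:R) < de.
  have -> : (1 + tau s) * (h * k%:R) = de * (k%:R / (k%:R + 1)).
    by rewrite /h; field; rewrite !lt0r_neq0 //; lra.
  by rewrite gtr_pMr // ltr_pdivrMr //; lra.
have cgg i j : continuous (fun x : X => g i x * g j x).
  by move=> x; apply: cvgM; exact: cg.
have H1 (i j : 'I_k) : \forall n \near \oo, `|\int[mun n]_x
    (voln n x * (g i (f n x) * g j (f n x))) - (i == j)%:R| <= h.
  have cv := integral_comp_cvg (fun n => nbh_volume_bounded (mun n) (mBn n))
    (nbh_volume_continuous small_annuli) (cgg i j) (fun eta => @vol_cvg eta).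
  have E : \int[mu]_x (vol x * (g i x * g j x)) = (i == j)%:R := gg i j.
  rewrite E in cv; move/cvgrPdist_le : cv => /(_ h h0); apply: filterS => n.
  by rewrite distrC.
have H2 (i j : 'I_k) : \forall n \near \oo, `|\int[mun n]_x
    (Jn n (fun y => g i (f n y)) x * g j (f n x)) - al i * (i == j)%:R| <= h.
  have bJ n : bounded_measurable (Jn n (fun y => g i (f n y))).
    apply: nbh_integral_bounded; first exact: (mBn n).
    exact: bounded_integrable (comp_bm n (cg i)).
  have cJ : continuous (J (g i) : X -> R) by exact: nbh_integral_continuous.
  have cv := integral_comp_cvg bJ cJ (cg j)
    (fun eta eta0 => nbh_integral_comp_cvg sigma_cvg mf f_dist f_weak small_annuli (cg i) eta0).
  have E : \int[mu]_x (J (g i) x * g j x) = al i * (i == j)%:R.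
    by rewrite -(ipE_avg mB c0 vol_ge); exact: Agg.
  rewrite E in cv; move/cvgrPdist_le : cv => /(_ h h0); apply: filterS => n.
  by rewrite distrC.
have {}H1 : \forall n \near \oo, forall i j, `|\int[mun n]_x
    (voln n x * (g i (f n x) * g j (f n x))) - (i == j)%:R| <= h.
  apply: filter_forall => i; exact: filter_forall (H1 i).
have {}H2 : \forall n \near \oo, forall i j, `|\int[mun n]_x
    (Jn n (fun y => g i (f n y)) x * g j (f n x)) - al i * (i == j)%:R| <= h.
  apply: filter_forall => i; exact: filter_forall (H2 i).
apply: filterS2 (filterI H1 H2) (near_volume_ge c0 vol_ge) => n [{}H1 {}H2] vn.
have c20 : 0 < c / 2 by lra.
pose ug l := toL2 (Lfun2_bounded (mun n) (comp_bm n (cg l))).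
pose ipn := @ipw _ _ _ (mun n) (voln n).
have ipnP : semi_inner_product ipn := vol_sip (mBn n) c20 vn.
pose An := avg_op (mBn n) c20 vn.
have AnP : hilbert_schmidt ipn An := avg_op_hilbert_schmidt (mBn n) (sBn n) c20 vn.
have qE (x : 'I_k -> R) : ipn (\sum_(l < k) x l *: ug l) (\sum_(l < k) x l *: ug l)
    = \sum_(i < k) \sum_(j < k) x i * x j * ipn (ug i) (ug j).
  rewrite (ip_suml ipnP); apply: eq_bigr => i _; rewrite (ip_sumr ipnP).
  by apply: eq_bigr => j _; rewrite (sipZ ipnP) (ipZr ipnP) mulrA.
have AqE (x : 'I_k -> R) : ipn (An (\sum_(l < k) x l *: ug l)) (\sum_(l < k) x l *: ug l)
    = \sum_(i < k) \sum_(j < k) x i * x j * ipn (An (ug i)) (ug j).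
  have -> : An (\sum_(l < k) x l *: ug l) = \sum_(l < k) x l *: An (ug l).
    elim/big_rec2 : _ => [|i y z _ <-]; first exact: hs0 AnP.
    by rewrite (hs_linear AnP).
  rewrite (ip_suml ipnP); apply: eq_bigr => i _; rewrite (ip_sumr ipnP).
  by apply: eq_bigr => j _; rewrite (sipZ ipnP) (ipZr ipnP) mulrA.
have G1 i j : `|ipn (ug i) (ug j) - 1 * (i == j)%:R| <= h.
  by rewrite mul1r; exact: H1.
have G2 i j : `|ipn (An (ug i)) (ug j) - al i * (i == j)%:R| <= h.
  have -> : ipn (An (ug i)) (ug j) = \int[mun n]_x (Jn n (ug i) x * ug j x).
    exact: ipE_avg.
  exact: H2.
have B1 (x : 'I_k -> R) := quadratic_form_near_diag x G1.
have B2 (x : 'I_k -> R) := quadratic_form_near_diag x G2.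
have S2 (x : 'I_k -> R) : 0 <= \sum_(i < k) x i ^+ 2.
  by apply: sumr_ge0 => i _; exact: sqr_ge0.
have hk0 : 0 <= h * k%:R by rewrite mulr_ge0 // ltW.
have hk1 : h * k%:R < 1 by nra.
apply: (le_lambda_minmax (mB := mBn n) (sBn n) rho0 k1 srho (u := ug) (c0 := c20) (vol_ge := vn)).
  move=> x; rewrite -/An -/ipn.
  have D : tau s' * \sum_(i < k) x i ^+ 2 <= \sum_(i < k) al i * x i ^+ 2.
    rewrite mulr_sumr; apply: ler_sum => i _; have [_ _ H] := Hu i.
    by rewrite ler_wpM2r // sqr_ge0.
  have := B1 x; have := B2 x; rewrite -qE -AqE -mulr_sumr mul1r.
  move: (S2 x) D; set S := \sum_(i < k) x i ^+ 2 => S0 D.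
  rewrite !ler_norml => /andP[? _] /andP[_ ?].
  have : (1 + tau s) * (h * k%:R) * S <= (tau s' - tau s) * S.
    by rewrite ler_wpM2r //; lra.
  have : tau s * ipn (\sum_(l < k) x l *: ug l) (\sum_(l < k) x l *: ug l) <=
      tau s * (S + h * k%:R * S) by rewrite ler_pM2l //; lra.
  lra.
move=> x q0 l.
have {}q0 : ipn (\sum_(l < k) x l *: ug l) (\sum_(l < k) x l *: ug l) = 0 by [].
have := B1 x; rewrite -qE -mulr_sumr mul1r q0.
have := S2 x; set S := \sum_(i < k) x i ^+ 2 => S0.
rewrite sub0r normrN (ger0_norm S0) => H.
have {}S0 : S = 0 by apply/eqP; rewrite eq_le S0 andbT; nra.
have /eqP := S0; rewrite psumr_eq0 => [/allP/(_ l)|i _]; last exact: sqr_ge0.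
by rewrite mem_index_enum => /(_ isT)/=; rewrite sqrf_eq0 => /eqP.
Qed.

Lemma near_square_integral_le (m : nat) (al : 'I_m -> R) (phi : 'I_m -> X -> R)
    (D : R) : (forall i, continuous (phi i)) -> 0 < D ->
  (forall z : borel X, \int[mu]_y ((\1_(mm_ball rho z) y -
    \sum_(i < m) al i * phi i z * phi i y) ^+ 2) <= D / 2) ->
  \forall n \near \oo, forall x : borel (Xn n),
    \int[mun n]_y ((\1_(mm_ball rho x) y -
      \sum_(i < m) al i * phi i (f n x) * phi i (f n y)) ^+ 2) <= D.
Proof.
move=> cphi D0 HD.
have /choice[N HN] : forall i, exists N, forall z, `|phi i z| <= N.
  by move=> i; exact: mm_continuous_bounded.
pose C := \sum_(i < m) `|al i| * N i.
have C0 i : 0 <= `|al i| * N i.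
  by rewrite mulr_ge0 // (le_trans (normr_ge0 _) (HN i point)).
have C_ge0 : 0 <= C by apply: sumr_ge0 => i _.
have sC z : \sum_(i < m) `|al i * phi i z| <= C.
  by apply: ler_sum => i _; rewrite normrM ler_wpM2l.
(* Volumes, ball integrals and moments enter with total coefficients at most [1], [2 * C] and
   [C ^+ 2], so errors [h] add up to at most [D / 2]. *)
pose h := D / (2 * (1 + C) ^+ 2).
have C1 : 0 < (1 + C) ^+ 2 by rewrite exprn_gt0 //; lra.
have h0 : 0 < h by rewrite divr_gt0 // mulr_gt0.
have H1 := vol_cvg h0.
have H2 : \forall n \near \oo, forall i, forall x : Xn n,
    `|Jn n (fun y => phi i (f n y)) x - J (phi i) (f n x)| <= h.
  apply: filter_forall => i.
  exact: (nbh_integral_comp_cvg sigma_cvg mf f_dist f_weak small_annuli (cphi i) h0).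
have H3 : \forall n \near \oo, forall i j,
    `|\int[mun n]_y (phi i (f n y) * phi j (f n y)) -
      \int[mu]_y (phi i y * phi j y)| <= h.
  apply: filter_forall => i; apply: filter_forall => j.
  have cij : continuous (fun y => phi i y * phi j y).
    by move=> y; apply: cvgM; exact: cphi.
  have := weak_Rintegral_cvg mf f_weak cij; move=> /cvgrPdist_le/(_ h h0).
  by apply: filterS => n; rewrite distrC.
apply: filterS2 (filterI H1 H2) H3 => n [{}H1 {}H2] {}H3 x.
have := HD (f n x).
rewrite (nbh_square_expand mu mB (fun i => al i * phi i (f n x)) (f n x)
  (fun i => mm_bounded_measurable (cphi i))).
rewrite (nbh_square_expand (mun n) (mBn n) (fun i => al i * phi i (f n x)) x
  (fun i => comp_bm n (cphi i))).
pose a i := al i * phi i (f n x).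
have E2 : `|\sum_(i < m) 2 * a i * Jn n (fun y => phi i (f n y)) x -
    \sum_(i < m) 2 * a i * J (phi i) (f n x)| <= 2 * C * h.
  rewrite -sumrB; apply: le_trans (ler_norm_sum _ _ _) _.
  apply: (@le_trans _ _ (\sum_(i < m) 2 * `|a i| * h)).
    apply: ler_sum => i _; rewrite -mulrBr normrM normrM ger0_norm //.
    by rewrite ler_wpM2l // mulr_ge0.
  by rewrite -mulr_suml -mulr_sumr ler_wpM2r ?(ltW h0) // ler_wpM2l // sC.
have E3 : `|\sum_(i < m) \sum_(j < m) a i * a j *
      \int[mun n]_y (phi i (f n y) * phi j (f n y)) -
    \sum_(i < m) \sum_(j < m) a i * a j * \int[mu]_y (phi i y * phi j y)| <=
    C * C * h.
  rewrite -sumrB; apply: le_trans (ler_norm_sum _ _ _) _.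
  apply: (@le_trans _ _ (\sum_(i < m) `|a i| * (C * h))).
    apply: ler_sum => i _; rewrite -sumrB; apply: le_trans (ler_norm_sum _ _ _) _.
    apply: (@le_trans _ _ (\sum_(j < m) `|a i| * (`|a j| * h))).
      apply: ler_sum => j _; rewrite -mulrBr normrM normrM -mulrA.
      by rewrite ler_wpM2l // ler_wpM2l.
    rewrite -mulr_sumr -mulr_suml ler_wpM2l // ler_wpM2r ?(ltW h0) //.
    exact: sC.
  rewrite -mulr_suml mulrA ler_wpM2r ?(ltW h0) // ler_wpM2r //.
  exact: sC.
have Eh : (1 + C) ^+ 2 * h = D / 2.
  by rewrite /h; field; apply: lt0r_neq0; lra.
have E1 := H1 x; move: E1 E2 E3; rewrite !ler_norml -/a; nra.
Qed.

Lemma lambda_lower k s s' : (1 <= k)%N -> s < s' -> s' < rho ^- 2 ->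
  (s'%:E < lam k)%E -> \forall n \near \oo, (s%:E <= lamn n k)%E.
Proof.
move=> k1 ss srho lams; have [c c0 vol_ge] := ball_lower rho0.
have ltau : tau s' < tau s.
  by rewrite /avg_eigenvalue ltrD2l ltrN2 ltr_pM2l ?exprn_gt0.
have taus : 0 < tau s'.
  by rewrite /avg_eigenvalue subr_gt0 mulrC -ltr_pdivlMr ?exprn_gt0 // div1r.
set a := tau s in ltau; set a' := tau s' in ltau taus.
have M0 : 0 <= M by exact: fine_ge0.
(* The gap [a - a'] is shared out: the kernel error takes [kap / (c / 2)], a quarter of it, with
   [c / 2] bounding the volumes in [X_n]; the change of weight and of Gram matrix takes [a' * b],
   another quarter. *)
pose kap := c * (a - a') / 8.
have kap0 : 0 < kap by rewrite divr_gt0 // mulr_gt0 // subr_gt0.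
pose D := kap ^+ 2 / (M + 1).
have D0 : 0 < D by rewrite divr_gt0 ?exprn_gt0 //; lra.
have M30 : 0 <= M ^+ 3 by rewrite exprn_ge0.
pose eta := D / (2 * (M ^+ 3 + 1)).
have eta0 : 0 < eta by rewrite divr_gt0 // mulr_gt0 //; lra.
have [eps0 eps00 Heps] := kernel_residual_small c0 vol_ge small_annuli ball_lower eta0.
pose ip := @ipw _ _ _ mu vol.
pose A := avg_op mB c0 vol_ge.
have ipP : semi_inner_product ip := vol_sip mB c0 vol_ge.
have AP : hilbert_schmidt ip A := avg_op_hilbert_schmidt mB sB c0 vol_ge.
have a'20 : 0 < a' ^+ 2 by rewrite exprn_gt0.
(* At most [eps0] for the kernel approximation, and below [a' ^+ 2] so that the decomposition
   contains all eigenvalues of [A] from [a'] on. *)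
pose eps := Num.min eps0 (a' ^+ 2 / 2).
have eps_gt0 : 0 < eps by rewrite lt_min eps00 divr_gt0.
have eps_le : eps <= eps0 by rewrite ge_min lexx.
have eps_a' : eps < a' ^+ 2.
  apply: (@le_lt_trans _ _ (a' ^+ 2 / 2)); first by rewrite ge_min lexx orbT.
  by rewrite ltr_pdivrMr // ltr_pMr // ltr1n.
have [m [e0 [al eD0]]] := hs_decomposition ipP AP eps_gt0.
have [e0E eD] := ed_smooth ipP AP (ltW eps_gt0) eD0.
pose e i := (al i)^-1 *: A (e0 i).
have al0 i : (i < m)%N -> al i != 0.
  move=> im; rewrite -sqrf_eq0 gt_eqF //.
  exact: lt_trans eps_gt0 (ed_gt eD0 im).
(* [e i] and [e0 i] differ by a null vector, and values of [A] are inner products, so the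
   eigen-equation holds at every point. *)
have eE i x : (i < m)%N -> A (e i) x = al i * e i x.
  move=> im; have -> : A (e i) x = A (e0 i) x.
    rewrite -!(ip_avg_kernel mB c0 vol_ge) ![ipw _ _ (_ i)](sipC ipP).
    exact: (nullB_ip ipP _ (e0E i im)).
  by rewrite -[e i x]/((al i)^-1 * A (e0 i) x) mulrA mulfV ?mul1r // al0.
have ce i : continuous (e i : X -> R).
  by move=> x; apply: cvgM; [exact: cvg_cst|exact: avg_op_continuous].
have cvol : continuous (vol : X -> R) by exact: nbh_volume_continuous.
have mk : (#|[pred i : 'I_m | (a' <= al i)%R]| < k)%N.
  rewrite ltnNge; apply/negP => km; move: lams; rewrite ltNge => /negP; apply.
  exact: (le_lambda (mB := mB) sB (c0 := c0) (vol_ge := vol_ge) rho0 eps_gt0 eD).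
pose b := (a - a') / (4 * a').
have b0 : 0 < b by rewrite divr_gt0 ?subr_gt0 // mulr_gt0.
pose h' := b / 2; have h'0 : 0 < h' by rewrite divr_gt0.
have m0 : 0 <= m%:R :> R by [].
(* Gives [(1 + h') / (1 - h * m%:R) <= 1 + b] with [h' = b / 2]. *)
pose h := b / (2 * (1 + b) * (m%:R + 1)).
have h0 : 0 < h by rewrite divr_gt0 // !mulr_gt0 //; lra.
have hm : h * m%:R * (1 + b) <= b / 2.
  have -> : h * m%:R * (1 + b) = b / 2 * (m%:R / (m%:R + 1)).
    by rewrite /h; field; rewrite !lt0r_neq0 //; lra.
  by rewrite ler_piMr //; [lra|rewrite ler_pdivrMr //; lra].
have hm1 : h * m%:R < 1.
  have : 0 <= h * m%:R by rewrite mulr_ge0 // ltW.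
  nra.
have cphi (i : 'I_m) : continuous (fun y : X => vol y * e i y).
  by move=> y; apply: cvgM; [exact: cvol|exact: ce].
have HD (z : borel X) : \int[mu]_y ((\1_(mm_ball rho z) y -
    \sum_(i < m) al i * (vol z * e i z) * (vol y * e i y)) ^+ 2) <= D / 2.
  apply: le_trans (kernel_residual_integral z eE) _.
  apply: (@le_trans _ _ (M ^+ 3 * eta)).
    by rewrite ler_wpM2l //; exact: (Heps eps m e al eps_gt0 eps_le eD z).
  rewrite /eta; move: (M ^+ 3) M30 => t t0.
  have -> : t * (D / (2 * (t + 1))) = D / 2 * (t / (t + 1)).
    by field; rewrite lt0r_neq0 //; lra.
  by rewrite ler_piMr //; [lra|rewrite ler_pdivrMr //; lra].
have Hn1 := near_square_integral_le cphi D0 HD.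
have Hn2 : \forall n \near \oo, forall i j : 'I_m, `|\int[mun n]_x
    (vol (f n x) * (e i (f n x) * e j (f n x))) - (i == j)%:R| <= h.
  have H (i j : 'I_m) : \forall n \near \oo, `|\int[mun n]_x
      (vol (f n x) * (e i (f n x) * e j (f n x))) - (i == j)%:R| <= h.
    have cij : continuous (fun x : X => vol x * (e i x * e j x)).
      move=> x; apply: cvgM; first exact: cvol.
      by apply: cvgM; exact: ce.
    have cv := weak_Rintegral_cvg mf f_weak cij.
    have E : \int[mu]_x (vol x * (e i x * e j x)) = (i == j)%:R.
      exact: (ed_orth eD (ltn_ord i) (ltn_ord j)).
    rewrite E in cv; move/cvgrPdist_le : cv => /(_ h h0); apply: filterS => n.
    by rewrite distrC.
  apply: filter_forall => i; exact: filter_forall (H i).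
(* An additive error [h' * (c / 2)] on volumes is a relative error [h'], since volumes in [X_n] are
   eventually at least [c / 2]. *)
have hc0 : 0 < h' * (c / 2) by rewrite mulr_gt0 // divr_gt0.
apply: filterS2 (filterI Hn1 Hn2) (filterI (near_volume_ge c0 vol_ge)
  (filterI (vol_cvg hc0) (near_mass_le mf f_weak))) => n [{}Hn1 {}Hn2] [vn [Hv Mn]].
rewrite leNgt; apply/negP => lamns.
have c20 : 0 < c / 2 by lra.
have [U [be HU]] := lambda_lt (mBn n) (sBn n) c20 vn rho0 (lt_trans ss srho) lamns.
pose g (i : 'I_m) := toL2 (Lfun2_bounded (mun n) (comp_bm n (ce i))).
have Hbad : kap / (c / 2) + a' * (1 + h') / (1 - h * m%:R) < a.
  have -> : kap / (c / 2) = (a - a') / 4 by rewrite /kap; field; rewrite gt_eqF.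
  have H1 : (1 + h') / (1 - h * m%:R) <= 1 + b.
    by rewrite ler_pdivrMr ?subr_gt0 // /h'; lra.
  have H2 : a' * ((1 + h') / (1 - h * m%:R)) <= a' * (1 + b) by rewrite ler_pM2l.
  have H3 : a' * b = (a - a') / 4 by rewrite /b; field; rewrite gt_eqF.
  rewrite -mulrA; lra.
suff : a <= kap / (c / 2) + a' * (1 + h') / (1 - h * m%:R) by rewrite leNgt Hbad.
apply: (approx_kernel_eigenspace (mB := mBn n) (sBn n) (c0 := c20) (vol_ge := vn)
  (al := fun i : 'I_m => al i) (g := g) (w := fun x => vol (f n x)) (comp_bm n cvol)
  (D := D) (h := h) (h' := h') (kap := kap) (a := a) (a' := a') (U := U) (be := be)).
- by move=> x; exact: le_trans (ltW c0) (vol_ge _).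
- exact: Hn1.
- by move=> i; exact: (comp_bm n (ce i)).
- exact: Hn2.
- exact: hm1.
- move=> x; have := Hv x; rewrite ler_norml => /andP[H _].
  have : h' * (c / 2) <= h' * voln n x by rewrite ler_pM2l.
  lra.
- by move=> i j; have [-> _ _] := HU i.
- by move=> i; have [_ -> _] := HU i.
- by move=> i; have [_ _] := HU i.
- exact: mk.
- exact: ltW.
- exact: ltW.
- apply: (@le_trans _ _ ((M + 1) * D)); first by rewrite ler_wpM2r // ltW.
  by rewrite /D mulrC divfK // lt0r_neq0 //; lra.
Qed.

End mm_convergence.

Theorem theorem1p2 (R : realType) (Xn : nat -> mmSpace R) (X : mmSpace R)
    (hconv : fukaya_cvg Xn X)
    (hlength : length_metric X)
    (Lambda : R) (hLambda : 0 < Lambda)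
    (hpos : forall (x : X) (r : R), 0 < r ->
      (0 < mm_measure X (ball x r))%E)
    (hratio : forall (x : X) (r1 r2 : R), 0 < r2 -> r2 <= r1 ->
      fine (mm_measure X (ball x r1)) / fine (mm_measure X (ball x r2))
        <= (r1 / r2) `^ Lambda)
    (rho : R) (hrho : 0 < rho) (k : nat) (hk : (1 <= k)%N)
    (hlt : (lambda X rho k < (rho ^- 2)%:E)%E) :
  lambda (Xn n) rho k @[n --> \oo] --> lambda X rho k.
Proof.
have [sigma [f [[_ sigma_cvg] mf _ f_dist f_weak]]] := hconv.
have small_annuli eta (eta0 : 0 < eta) :=
  annulus_small hLambda hpos hratio hrho eta0.
have ball_lower r (r0 : 0 < r) := mm_ball_lower hpos r0.
apply: ereal_cvg_squeeze => s sl.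
(* Taking the minimum with [rho ^- 2] keeps the argument in the range where [tau] is positive. *)
- have : (lambda X rho k < (Num.min s (rho ^- 2))%:E)%E.
    by rewrite EFin_min lt_min sl.
  set t := Num.min s _ => lt.
  (* Two intermediate values, as [lambda_upper] takes eigenfunctions below [s''] and only concludes
     at a larger [s'], itself below [rho ^- 2]. *)
  have [s' [s'' [ls'' ss' st]]] : exists s' s'' : R,
      [/\ (lambda X rho k < s''%:E)%E, s'' < s' & s' < t].
    case: (lambda X rho k) lt => [r||_] //.
      rewrite lte_fin => rt; exists ((r + 2 * t) / 3), ((2 * r + t) / 3); rewrite lte_fin.
      by split; lra.
    by exists (t - 1), (t - 2); split; [exact: ltNyr|lra|lra].
  have [ts trho] : t <= s /\ t <= rho ^- 2 by rewrite !ge_min !lexx orbT.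
  have := lambda_upper sigma_cvg mf f_dist f_weak hrho small_annuli ball_lower
    hk ss' (lt_le_trans st trho) ls''.
  apply: filterS => n /le_trans; apply; rewrite lee_fin.
  exact: ltW (lt_le_trans st ts).
- have [s' [ss' s'rho s'l]] : exists s' : R,
      [/\ s < s', s' < rho ^- 2 & (s'%:E < lambda X rho k)%E].
    move: hlt sl; case: (lambda X rho k) => [r||] //; rewrite !lte_fin => rrho sr.
    by exists ((s + r) / 2); rewrite lte_fin; split; lra.
  exact: (lambda_lower sigma_cvg mf f_dist f_weak hrho small_annuli ball_lower
    hk ss' s'rho s'l).
Qed.
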